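(* Consider the detection problem for the Gaussian model with $m\ge2$ graphs ($m$ fixed) and correlation $\rho=\rho_n\in[0,1]$. Let $\epsilon>0$ denote a fixed constant. If $$\rho^2\le\frac{4-\epsilon}{m-1}\cdot\frac{\log n}{n},$$ then weak detection is impossible.
   Context: Let $m\ge2$ be fixed and $n\to\infty$. Let $\mathcal{E}_n=\binom{[n]}{2}$ and $\mathfrak{S}_n$ the set of permutations of $[n]$, acting on $\mathcal{E}_n$ by $\tau(\{i,j\})=\{\tau(i),\tau(j)\}$. An alignment is an $m$-tuple $\pi=(\pi_1,\dots,\pi_m)$ of permutations with $\pi_1=\mathrm{Id}$. The observation $X=(X^1,\dots,X^m)$ consists of $m$ random symmetric $n\times n$ matrices with zero diagonal. Under $H_1$ the observation has law $\mathsf{P}$: there is a uniformly distributed random alignment $\pi^\star$ such that, conditioned on $\pi^\star$, the $m$-vectors $(X^1_e,X^2_{\pi^\star_2(e)},\dots,X^m_{\pi^\star_m(e)})$, $e\in\mathcal{E}_n$, are mutually independent, each jointly Gaussian with mean zero, unit variances and all pairwise covariances equal to $\rho$. Under $H_0$ the observation has law $\mathsf{Q}=\mathsf{P}_{X^1}\otimes\cdots\otimes\mathsf{P}_{X^m}$ (independent matrices with the same marginals). A test statistic $T(X)$ with threshold $\tau$ achieves weak detection if $\mathsf{P}(T(X)<\tau)+\mathsf{Q}(T(X)\ge\tau)=1-\Omega(1)$. Weak detection is impossible if no decision rule achieves it; this is equivalent to $\mathrm{TV}(\mathsf{P},\mathsf{Q})=o(1)$, where $\mathrm{TV}$ is the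 total variation distance between the laws of $X$. *)

(* Defs.v *)
From HB Require Import structures.
From mathcomp Require Import all_boot all_order all_algebra all_fingroup.
From mathcomp Require Import all_classical all_reals all_analysis.

Set Implicit Arguments.
Unset Strict Implicit.
Unset Printing Implicit Defensive.

Import Order.TTheory GRing.Theory Num.Theory.
Import numFieldNormedType.Exports.

Local Open Scope classical_set_scope.
Local Open Scope ring_scope.

(* Observations are m-tuples of n x n real matrices. Nested tuples are used
   because the library equips them with the product sigma-algebra. *)
Notation observation R m n := (m.-tuple (n.-tuple (n.-tuple R))).

Definition entry (R : realType) (m n : nat) (x : observation R m n)
    (k : 'I_m) (i j : 'I_n) : R :=
  tnth (tnth (tnth x k) i) j.

(* The unordered pair {i, j} is represented by its increasing listing (i, j). *)
Definition edge (n : nat) := {ij : 'I_n * 'I_n | (ij.1 < ij.2)%N}.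

Definition alignment (m n : nat) : {set {ffun 'I_m -> 'S_n}} :=
  [set pi : {ffun 'I_m -> 'S_n} |
     [forall k : 'I_m, (k == 0%N :> nat) ==> (pi k == 1%g)]]%SET.

(* (x^1_e, x^2_{pi_2(e)}, ..., x^m_{pi_m(e)}). As pi_k need not preserve the
   order, (pi_k i, pi_k j) may be a decreasing pair; x^k_{pi_k(e)} is
   nevertheless well defined since x^k is symmetric. *)
Definition aligned_vector (R : realType) (m n : nat)
    (pi : {ffun 'I_m -> 'S_n}) (x : observation R m n) (e : edge n) :
    m.-tuple R :=
  [tuple entry x k (pi k (val e).1) (pi k (val e).2) | k < m].

Section ProbabilityNotions.
Context (R : realType) (d : measure_display) (Omega : measurableType d).
Local Open Scope ereal_scope.

(* mu( . | A); mnormalize returns its second argument when mu A = 0. *)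
Definition conditional (mu : probability Omega R) (A : set Omega)
    (mA : measurable A) : probability Omega R :=
  mnormalize (mrestr mu mA) mu.

Definition mutually_independent (mu : probability Omega R) (I : finType)
    (d' : measure_display) (T : measurableType d') (Y : I -> Omega -> T) :=
  forall (S : {set I}) (B : I -> set T), (forall i, measurable (B i)) ->
    mu (\bigcap_(i in [set` S]) (Y i @^-1` B i)) =
    \big[*%E/1]_(i in S) mu (Y i @^-1` B i).

Definition standard_normal_vector (nu : probability Omega R) (l : nat)
    (Z : 'I_l -> {RV nu >-> R}) :=
  (forall i B, measurable B ->
    distribution nu (Z i) B = normal_prob 0%R 1%R B) /\
  mutually_independent nu (fun i w => Z i w).

End ProbabilityNotions.

(* Y has the law of A Z + b for some standard normal vector Z; A may be
   rank-deficient, so degenerate Gaussian vectors are included. *)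
Definition jointly_gaussian (R : realType) (d : measure_display)
    (Omega : measurableType d) (mu : probability Omega R) (m : nat)
    (Y : Omega -> m.-tuple R) : Prop :=
  exists (d' : measure_display) (Omega' : measurableType d')
    (nu : probability Omega' R) (l : nat) (Z : 'I_l -> {RV nu >-> R})
    (A : 'M[R]_(m, l)) (b : 'I_m -> R),
    standard_normal_vector Z /\
    forall B : set (m.-tuple R), measurable B ->
      mu (Y @^-1` B) =
      nu ((fun w => [tuple \sum_(i < l) A k i * Z i w + b k | k < m]) @^-1` B).

Record correlated_gaussian_model (R : realType) (m n : nat) (rho : R)
    (d : measure_display) (Omega : measurableType d) (mu : probability Omega R)
    (pistar : Omega -> {ffun 'I_m -> 'S_n})
    (X : {RV mu >-> observation R m n}) : Prop := {
  pistar_measurable : forall pi, measurable (pistar @^-1` [set pi]) ;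
  pistar_alignment : forall w, pistar w \in alignment m n ;
  pistar_uniform : forall pi, pi \in alignment m n ->
    mu (pistar @^-1` [set pi]) = (#|alignment m n|%:R^-1)%:E ;
  X_symmetric : forall w k i j, entry (X w) k i j = entry (X w) k j i ;
  X_diagonal : forall w k i, entry (X w) k i i = 0 ;
  X_independent : forall pi, pi \in alignment m n ->
    mutually_independent (conditional mu (pistar_measurable pi))
      (fun (e : edge n) w => aligned_vector pi (X w) e) ;
  X_gaussian : forall pi (e : edge n), pi \in alignment m n ->
    jointly_gaussian (conditional mu (pistar_measurable pi))
      (fun w => aligned_vector pi (X w) e) ;
  X_mean : forall pi (e : edge n) k, pi \in alignment m n ->
    ('E_(conditional mu (pistar_measurable pi))
      [fun w => tnth (aligned_vector pi (X w) e) k] = 0)%E ;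
  X_variance : forall pi (e : edge n) k, pi \in alignment m n ->
    ('V_(conditional mu (pistar_measurable pi))
      [fun w => tnth (aligned_vector pi (X w) e) k] = 1)%E ;
  X_covariance : forall pi (e : edge n) k l, pi \in alignment m n -> k != l ->
    covariance (conditional mu (pistar_measurable pi))
      (fun w => tnth (aligned_vector pi (X w) e) k)
      (fun w => tnth (aligned_vector pi (X w) e) l) = rho%:E
}.

Definition H1_law (R : realType) (m n : nat) (rho : R)
    (P : probability (observation R m n) R) : Prop :=
  exists (d : measure_display) (Omega : measurableType d)
    (mu : probability Omega R) (pistar : Omega -> {ffun 'I_m -> 'S_n})
    (X : {RV mu >-> observation R m n}),
    correlated_gaussian_model rho pistar X /\
    forall A, measurable A -> P A = distribution mu X A.

Section Detection.
Context (R : realType) (m : nat).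
Local Open Scope ereal_scope.

Definition marginal (n : nat) (P : probability (observation R m n) R)
    (k : 'I_m) (B : set (n.-tuple (n.-tuple R))) : \bar R :=
  P [set x | B (tnth x k)].

(* Q is the product of the marginals of P. *)
Definition H0_law (n : nat) (P Q : probability (observation R m n) R) : Prop :=
  forall B : 'I_m -> set (n.-tuple (n.-tuple R)),
    (forall k, measurable (B k)) ->
    Q [set x | forall k, B k (tnth x k)] =
    \big[*%E/1]_(k < m) marginal P k (B k).

Definition achieves_weak_detection
    (P Q : forall n, probability (observation R m n) R)
    (T : forall n, observation R m n -> R) (tau : nat -> R) : Prop :=
  exists2 c : R, (0 < c)%R &
    \forall n \near \oo,
      P n [set x | (T n x < tau n)%R] + Q n [set x | (tau n <= T n x)%R] <=
      (1 - c)%:E.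

Definition no_test_achieves_weak_detection
    (P Q : forall n, probability (observation R m n) R) : Prop :=
  forall (T : forall n, observation R m n -> R) (tau : nat -> R),
    (forall n, measurable_fun setT (T n)) ->
    ~ achieves_weak_detection P Q T tau.

Definition tv_distance (n : nat) (P Q : probability (observation R m n) R) :
    \bar R :=
  ereal_sup [set `|P A - Q A| | A in measurable].

(* The second conjunct does not follow from the first for a fixed sequence:
   1 - Omega(1) bounds the error for all large n, so the first conjunct alone
   only excludes tests that work for all large n, and not those that work along
   a subsequence. *)
Definition weak_detection_impossible
    (P Q : forall n, probability (observation R m n) R) : Prop :=
  no_test_achieves_weak_detection P Q /\
  tv_distance (P n) (Q n) @[n --> \oo] --> 0.

End Detection.

(* Main.v *)
Require Import Defs.
From HB Require Import structures.
From mathcomp Require Import all_boot all_order all_algebra all_fingroup.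
From mathcomp Require Import all_classical all_reals all_analysis.
From mathcomp Require Import measurable_realfun.
From mathcomp Require Import ring lra zify.

(** The proof reduces the statement to two graphs and treats that case by a
    truncated second moment.

    A centred Gaussian vector whose covariances are 1 on the diagonal and [rho]
    elsewhere can be produced one coordinate at a time: given the first [K]
    coordinates, the next one is [pcorr rho K] times their normalized sum plus
    independent noise ([equicorr], [gaussian_equicorr]). So both hypotheses are
    images of the same array of standard normal variables ([H1_H0_laws]), and one
    passes from one to the other by making the graphs correlated one at a time.
    Each step replaces an independent graph by a randomly relabelled graph that
    has correlation [pcorr rho K] with a standard one, and it changes the law by
    at most the total variation distance of the detection problem with two graphs
    at that correlation ([hybrid_step], [reduction]). As
    [pcorr rho K ^+ 2 <= K * rho ^+ 2] and [K <= m - 1], the assumption on [rho]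
    puts all these problems below the threshold [r ^+ 2 <= (4 - eps) * ln n / n].

    For two graphs, the likelihood ratio is an average over the permutations of a
    product of Mehler kernels, and its second moment is an average over a uniform
    relative permutation [s]. There each cycle of length [l] of [s] on the edges
    contributes [1 / (1 - r ^+ (2 * l))], because the composition of Mehler
    kernels multiplies correlations ([cycles_integral_le]). The cycles of length 1
    dominate: most of them are the pairs of fixed points of [s], and for [k] fixed
    points the contribution is about [exp (r ^+ 2 * k ^+ 2 / 2)], against a
    probability of about [1 / k!]. For [k] close to [n] this is only enough below
    half the threshold. The likelihood ratio is therefore restricted to the event
    that, on every set of at least [n / 4] vertices, the overlap of the aligned
    graphs hardly exceeds its mean. Chernoff's bound shows that the event is
    typical under the planted law ([plr_untame], [untamed_le]), and on it the
    exponent of the pairs of fixed points is halved ([edge_square], [tamed_le]).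
    Since a chord of the logarithm lies below its graph, [theta_le_ln] then bounds
    the exponent by [(1 - eps / 8) * k * ln k] for all [k], so that the sum of the
    contributions over [k] converges uniformly and its terms vanish in the limit
    ([theta_sum]). The edge cycles of length 2 are controlled by the number of
    2-cycles of [s], which has the same kind of factorial tail
    ([card_perm_fix_swap]), and the longer ones are negligible. *)

Set Implicit Arguments.
Unset Strict Implicit.
Unset Printing Implicit Defensive.
Import Order.TTheory GRing.Theory Num.Theory.
Import numFieldNormedType.Exports.
Local Open Scope classical_set_scope.
Local Open Scope ring_scope.

(** * Laws and product measures *)

Section Laws.
Context d d' (Omega : measurableType d) (T : measurableType d') (R : realType).
Local Open Scope ereal_scope.
Implicit Types (P : {measure set Omega -> \bar R}) (Y : Omega -> T)
  (nu : {measure set T -> \bar R}).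

Definition has_law P Y (nu : {measure set T -> \bar R}) :=
  measurable_fun setT Y /\ forall A, measurable A -> P (Y @^-1` A) = nu A.

Let has_law_ge0_integral P Y nu (f : T -> \bar R) :
  has_law P Y nu -> measurable_fun setT f -> (forall y, 0 <= f y) ->
  \int[P]_w f (Y w) = \int[nu]_y f y.
Proof.
move=> [mY PY] mf f0.
pose Ym : {mfun Omega >-> T} :=
  HB.pack Y (isMeasurableFun.Build _ _ _ _ _ mY).
transitivity (\int[@pushforward _ _ Omega T R P Ym]_y f y).
  by rewrite ge0_integral_pushforward.
by apply: eq_measure_integral => A mA _; exact: PY.
Qed.

Lemma has_law_integral P Y nu (f : T -> \bar R) :
  has_law P Y nu -> measurable_fun setT f ->
  \int[P]_w f (Y w) = \int[nu]_y f y.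
Proof.
move=> PY mf; rewrite integralE [RHS]integralE; congr (_ - _).
- have mp : measurable_fun setT f^\+ by apply: measurable_funepos.
  rewrite -(has_law_ge0_integral PY mp)//.
  by apply: eq_integral => w _; rewrite !funeposE.
- have mn : measurable_fun setT f^\- by apply: measurable_funeneg.
  rewrite -(has_law_ge0_integral PY mn)//.
  by apply: eq_integral => w _; rewrite !funenegE.
Qed.

Lemma integral_has_law P Y nu : measurable_fun setT Y ->
  (forall f : T -> \bar R, measurable_fun setT f -> (forall y, 0 <= f y) ->
    \int[P]_w f (Y w) = \int[nu]_y f y) -> has_law P Y nu.
Proof.
move=> mY PY; split => // A mA.
have mYA : measurable (Y @^-1` A) by rewrite -[X in measurable X]setTI; exact: mY.
have -> : nu A = \int[nu]_y (EFin \o \1_A) y by rewrite integral_indic// setIT.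
rewrite -PY; last 2 first.
- exact/measurable_EFinP/measurable_indic.
- by move=> y; rewrite lee_fin.
transitivity (\int[P]_w (\1_(Y @^-1` A) w)%:E); last by [].
by rewrite integral_indic// setIT.
Qed.

End Laws.

Section UniqueOnRectangles.
Context d (T : measurableType d) (R : realType).
Local Open Scope ereal_scope.

Definition rectangle n (B : 'I_n -> set T) : set (n.-tuple T) :=
  [set t | forall i, B i (tnth t i)].

Lemma measurable_rectangle n (B : 'I_n -> set T) :
  (forall i, measurable (B i)) -> measurable (rectangle B).
Proof.
move=> mB.
rewrite (_ : rectangle B =
    \bigcap_(i in [set: 'I_n]) ((fun t => tnth t i) @^-1` B i)); last first.
  by apply/seteqP; split => [t Bt i _|t Bt i]; [exact: Bt|exact: (Bt i I)].
apply: fin_bigcap_measurable; first exact: finite_finset.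
move=> i _; rewrite -[X in measurable X]setTI.
exact: (measurable_tnth i).
Qed.

Definition rectangles n : set (set (n.-tuple T)) :=
  [set rectangle B | B in [set B | forall i, measurable (B i)]].

Lemma measurable_rectanglesE n :
  @measurable _ (n.-tuple T) = <<s @rectangles n >>.
Proof.
apply/seteqP; split.
- apply: smallest_sub; first exact: smallest_sigma_algebra.
  case: n => [|n]; first by rewrite big_ord0.
  rewrite -bigcup_mkord_ord => X [i /= ltin [B mB <-]].
  apply: sub_sigma_algebra.
  exists (fun j => if j == inord i then B else setT).
    by move=> j; case: ifP.
  apply/seteqP; split => t /=.
    by move=> /(_ (inord i)); rewrite eqxx.
  by move=> [_ Bt] j; case: eqP => // ->.
- apply: smallest_sub; first exact: sigma_algebra_measurable.
  by move=> _ [B mB <-]; exact: measurable_rectangle.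
Qed.

(** Rectangles are stable under intersection and generate the product
    sigma-algebra, so the pi-lambda theorem applies. *)
Lemma rectangle_unique n (m1 m2 : probability (n.-tuple T) R) :
  (forall B, (forall i, measurable (B i)) ->
    m1 (rectangle B) = m2 (rectangle B)) ->
  forall A, measurable A -> m1 A = m2 A.
Proof.
move=> m12 A mA.
apply: (measure_unique (@rectangles n) (fun=> setT)) => //.
- exact: measurable_rectanglesE.
- move=> _ _ [B mB <-] [B' mB' <-]; exists (fun i => B i `&` B' i).
    by move=> i; exact: measurableI.
  apply/seteqP; split => [t BB|t [Bt B't] i]; last by split; [exact: Bt|exact: B't].
  by split=> i; case: (BB i).
- by move=> _; exists (fun=> setT) => //; apply/seteqP; split.
- by rewrite bigcup_const//; exists 0%N.
- by move=> _ [B mB <-]; exact: m12.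
- by move=> _; rewrite ltey_eq fin_num_measure.
Qed.

End UniqueOnRectangles.

Section IidTuple.
Context d (T : measurableType d) (R : realType) (mu : probability T R).
Local Open Scope ereal_scope.

Definition tcons n (xt : T * n.-tuple T) : n.+1.-tuple T :=
  [the n.+1.-tuple T of xt.1 :: xt.2].

Lemma measurable_tcons n : measurable_fun setT (@tcons n).
Proof. exact: measurable_cons. Qed.

HB.instance Definition _ n :=
  @isMeasurableFun.Build _ _ _ _ _ (@measurable_tcons n).

Fixpoint iid n : probability (n.-tuple T) R :=
  if n is n'.+1 then
    distribution (mu \x iid n' : probability _ R)
      (@tcons n' : {mfun (T * n'.-tuple T)%type >-> n'.+1.-tuple T})
  else dirac ([tuple] : 0.-tuple T).

Lemma iidS n (f : n.+1.-tuple T -> \bar R) :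
  measurable_fun setT f -> (forall t, 0 <= f t) ->
  \int[iid n.+1]_t f t = \int[mu]_x \int[iid n]_t f (tcons (x, t)).
Proof.
move=> mf f0.
rewrite /= ge0_integral_distribution//.
rewrite fubini_tonelli1//; last by move=> x; exact: f0.
exact: (measurableT_comp mf (@measurable_tcons n)).
Qed.

Lemma iid0 (f : 0.-tuple T -> \bar R) :
  measurable_fun setT f -> \int[iid 0]_t f t = f [tuple].
Proof. by move=> mf; rewrite integral_dirac//= diracT mul1e. Qed.

Definition upd n (t : n.-tuple T) (i : 'I_n) (x : T) : n.-tuple T :=
  [tuple if j == i then x else tnth t j | j < n].

Lemma tnth_upd n (t : n.-tuple T) i x j :
  tnth (upd t i x) j = if j == i then x else tnth t j.
Proof. by rewrite tnth_mktuple. Qed.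

Lemma measurable_upd n (i : 'I_n) :
  measurable_fun setT (fun p : n.-tuple T * T => upd p.1 i p.2).
Proof.
apply/measurable_fun_tnthP => j.
rewrite (_ : _ \o _ = fun p => if j == i then p.2 else tnth p.1 j); last first.
  by apply/funext => p /=; rewrite tnth_upd.
case: (j == i); first exact: measurable_snd.
exact: (measurableT_comp (measurable_tnth j) measurable_fst).
Qed.

Lemma upd_tcons0 n x (t : n.-tuple T) y :
  upd (tcons (x, t)) ord0 y = tcons (y, t).
Proof.
apply/eq_from_tnth => j; rewrite tnth_upd.
by case: (unliftP ord0 j) => [k ->|->] //=; rewrite !tnthS.
Qed.

Lemma upd_tconsS n x (t : n.-tuple T) i y :
  upd (tcons (x, t)) (lift ord0 i) y = tcons (x, upd t i y).
Proof.
apply/eq_from_tnth => j; rewrite tnth_upd.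
case: (unliftP ord0 j) => [k ->|->] //=; rewrite !tnthS tnth_upd.
by rewrite (inj_eq (@lift_inj _ ord0)).
Qed.

Lemma measurable_tcons2 n x : measurable_fun setT (fun t => @tcons n (x, t)).
Proof. exact: (measurableT_comp (@measurable_tcons n) (pair1_measurable x)). Qed.

Lemma measurable_upd2 n (t : n.-tuple T) i : measurable_fun setT (upd t i).
Proof. exact: (measurableT_comp (measurable_upd i) (pair1_measurable t)). Qed.

Lemma measurable_resample n i (f : n.-tuple T -> \bar R) :
  measurable_fun setT f -> (forall t, 0 <= f t) ->
  measurable_fun setT (fun t => \int[mu]_x f (upd t i x)).
Proof.
move=> mf f0.
apply: (measurable_fun_fubini_tonelli_F (fun p : n.-tuple T * T => f (upd p.1 i p.2))) => //.
exact: (measurableT_comp mf (measurable_upd i)).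
Qed.

(** Integrating over one coordinate, the others being fixed, is written as
    drawing a fresh value for that coordinate. *)
Lemma iid_resample n (i : 'I_n) (f : n.-tuple T -> \bar R) :
  measurable_fun setT f -> (forall t, 0 <= f t) ->
  \int[iid n]_t f t = \int[iid n]_t \int[mu]_x f (upd t i x).
Proof.
elim: n => [|n IH] in i f *; first by case: i.
move=> mf f0.
have mf2 x : measurable_fun setT (fun t => f (tcons (x, t))).
  exact: (measurableT_comp mf (@measurable_tcons2 n x)).
rewrite iidS// iidS//; last 2 first.
- exact: measurable_resample.
- by move=> t; exact: integral_ge0.
case: (unliftP ord0 i) => [j ->|->].
- apply: eq_integral => x _.
  rewrite (IH j (fun t => f (tcons (x, t))))//.
  by apply: eq_integral => t _; apply: eq_integral => y _; rewrite upd_tconsS.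
- rewrite (fubini_tonelli (fun p : T * n.-tuple T => f (tcons p)))//; last first.
    exact: (measurableT_comp mf (@measurable_tcons n)).
  under [RHS]eq_integral do under eq_integral do
    under eq_integral do rewrite upd_tcons0.
  by rewrite integral_cst//= probability_setT mule1.
Qed.

Lemma iid_prod n (phi : 'I_n -> T -> \bar R) :
  (forall i, measurable_fun setT (phi i)) -> (forall i x, 0 <= phi i x) ->
  \int[iid n]_t \big[*%E/1]_(i < n) phi i (tnth t i) =
  \big[*%E/1]_(i < n) \int[mu]_x phi i x.
Proof.
have mprod m (psi : 'I_m -> T -> \bar R) : (forall i, measurable_fun setT (psi i)) ->
    measurable_fun setT (fun t => \big[*%E/1]_(i < m) psi i (tnth t i)).
  move=> mpsi; elim: (index_enum _) => [|i s IHs].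
    by under eq_fun do rewrite big_nil; exact: measurable_cst.
  under eq_fun do rewrite big_cons.
  apply: emeasurable_funM => //.
  exact: (measurableT_comp (mpsi i) (measurable_tnth i)).
have prod0 m (psi : 'I_m -> \bar R) : (forall i, 0 <= psi i) ->
    0 <= \big[*%E/1]_(i < m) psi i.
  by move=> psi0; elim/big_ind : _ => // x y; exact: mule_ge0.
elim: n phi => [|n IH] phi mphi phi0.
  rewrite iid0; last exact: mprod.
  by rewrite !big_ord0.
rewrite iidS; [|exact: mprod|by move=> t; exact: prod0].
rewrite big_ord_recl -IH//.
transitivity (\int[mu]_x (phi ord0 x *
    \int[iid n]_t \prod_(i < n) phi (lift ord0 i) (tnth t i))).
  apply: eq_integral => x _.
  rewrite -ge0_integralZl//; [|exact: (mprod _ (fun i => phi (lift ord0 i)))|by move=> t _; exact: (prod0 _ (fun i => phi (lift ord0 i) (tnth t i)))].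
  apply: eq_integral => t _; rewrite big_ord_recl; congr (_ * _).
  by apply: eq_bigr => i _; rewrite tnthS.
rewrite ge0_integralZr//.
by apply: integral_ge0 => t _; exact: prod0.
Qed.

Lemma iid_rectangle n (B : 'I_n -> set T) : (forall i, measurable (B i)) ->
  iid n (rectangle B) = \big[*%E/1]_(i < n) mu (B i).
Proof.
move=> mB.
have -> : iid n (rectangle B) = \int[iid n]_t (\1_(rectangle B) t)%:E.
  by rewrite integral_indic ?setIT//; exact: measurable_rectangle.
transitivity (\int[iid n]_t \big[*%E/1]_(i < n) (EFin \o \1_(B i)) (tnth t i)).
  apply: eq_integral => t _; rewrite indicE.
  case: (boolP (t \in rectangle B)) => [/set_mem tB|tB].
    by rewrite big1// => i _ /=; rewrite indicE mem_set//; exact: tB.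
  have [i iB] : exists i, ~ B i (tnth t i).
    by apply/not_existsP => H; move/negP : tB; apply; apply/mem_set => i;
      apply: contrapT; exact: H.
  by rewrite (bigD1 i)//= indicE memNset// mul0e.
rewrite (iid_prod (phi := fun i => EFin \o \1_(B i)))//.
- by apply: eq_bigr => i _; rewrite integral_indic// setIT.
- by move=> i; exact/measurable_EFinP/measurable_indic.
- by move=> i x /=; rewrite lee_fin.
Qed.

Lemma has_law_iid d' (Omega : measurableType d') (P : probability Omega R) n
    (Y : Omega -> n.-tuple T) : measurable_fun setT Y ->
  (forall B : 'I_n -> set T, (forall i, measurable (B i)) ->
    P (Y @^-1` rectangle B) = \big[*%E/1]_(i < n) mu (B i)) ->
  has_law P Y (iid n).
Proof.
move=> mY PY; split => //.
pose Ym : {mfun Omega >-> n.-tuple T} :=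
  HB.pack Y (isMeasurableFun.Build _ _ _ _ _ mY).
apply: (@rectangle_unique _ _ _ _ (distribution P Ym)) => B mB.
by rewrite iid_rectangle// -PY.
Qed.

Definition free_of n (i : 'I_n) (A : Type) (g : n.-tuple T -> A) :=
  forall t x, g (upd t i x) = g t.

Lemma iid_pull n (i : 'I_n) (phi : T -> \bar R) (g : n.-tuple T -> \bar R) :
  measurable_fun setT phi -> (forall x, 0 <= phi x) ->
  measurable_fun setT g -> (forall t, 0 <= g t) -> free_of i g ->
  \int[iid n]_t (phi (tnth t i) * g t) =
  \int[mu]_x phi x * \int[iid n]_t g t.
Proof.
move=> mphi phi0 mg g0 gi.
rewrite (iid_resample i); last 2 first.
- apply: emeasurable_funM => //.
  exact: (measurableT_comp mphi (measurable_tnth i)).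
- by move=> t; exact: mule_ge0.
rewrite -ge0_integralZl//; last by exact: integral_ge0.
apply: eq_integral => t _.
under eq_integral do rewrite gi tnth_upd eqxx.
by rewrite ge0_integralZr.
Qed.

End IidTuple.

(** * The standard normal law and the Mehler kernel *)

Section Gaussian.
Context (R : realType).
Local Notation lambda := (@lebesgue_measure R).

(** [normal_prob] lives on a copy of [R] whose measurable structure carries
    another display; this is the same measure on [R] itself. *)
Definition gam_set : set R -> \bar R := normal_prob (0 : R) 1.

Let gam0 : gam_set set0 = 0%E. Proof. exact: measure0. Qed.
Let gam_ge0 A : (0 <= gam_set A)%E. Proof. exact: measure_ge0. Qed.
Let gam_sigma_additive : semi_sigma_additive (gam_set : set R -> \bar R).
Proof.
move=> F mF tF mUF.
exact: (@measure_semi_sigma_additive _ _ _ (normal_prob (0 : R) 1)).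
Qed.
HB.instance Definition _ := isMeasure.Build _ R R gam_set
  gam0 gam_ge0 gam_sigma_additive.
Let gam_setT : gam_set setT = 1%E.
Proof. exact: (probability_setT (normal_prob (0 : R) 1)). Qed.
HB.instance Definition _ := Measure_isProbability.Build _ R R gam_set gam_setT.

Definition gam : probability R R := gam_set.

Lemma gam_normal (f : R -> \bar R) :
  measurable_fun setT f -> (forall x, 0 <= f x)%E ->
  (\int[gam]_x f x = \int[normal_prob (0 : R) 1]_x f x)%E.
Proof.
move=> mf f0; apply/esym.
apply: (has_law_integral (Y := id : measurableTypeR R -> R)) => //.
Qed.

Lemma gam_density (f : R -> \bar R) :
  measurable_fun setT f -> (forall x, 0 <= f x)%E ->
  (\int[gam]_x f x = \int[lambda]_x (f x * (normal_pdf 0 1 x)%:E))%E.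
Proof.
move=> mf f0; rewrite gam_normal//.
have dom : normal_prob (0 : R) 1 `<< lambda by exact: normal_prob_dominates.
rewrite -(Radon_Nikodym_SigmaFinite.change_of_variables dom)//.
have mpdf : measurable_fun setT (fun x : measurableTypeR R => (normal_pdf 0 1 x)%:E).
  by apply/measurable_EFinP; exact: measurable_normal_pdf.
have mRN := measurable_int _ (Radon_Nikodym_SigmaFinite.f_integrable dom).
apply: ge0_ae_eq_integral => //.
- by apply: emeasurable_funM.
- by apply: emeasurable_funM.
- by move=> x _; rewrite mule_ge0//; exact: Radon_Nikodym_SigmaFinite.f_ge0.
- by move=> x _; rewrite mule_ge0// lee_fin normal_pdf_ge0.
apply: ae_eqe_mul2l; apply: integral_ae_eq => //.
  exact: Radon_Nikodym_SigmaFinite.f_integrable.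
by move=> E _ mE; rewrite -Radon_Nikodym_SigmaFinite.f_integral.
Qed.

Lemma lebesgue_affine (c b : R) (f : R -> \bar R) : 0 < c ->
  measurable_fun setT f -> (forall x, 0 <= f x)%E ->
  (\int[lambda]_x f (c * x + b)%R = c^-1%:E * \int[lambda]_x f x)%E.
Proof.
move=> c0 mf f0.
have c0' : 0 <= c by exact: ltW.
have maff : @measurable_fun _ _ (measurableTypeR R) (measurableTypeR R) setT
    (fun x : R => c * x + b).
  suff : measurable_fun setT (fun x : R => c * x + b) by [].
  apply: measurable_funD; last exact: measurable_cst.
  by apply: measurable_funM => //; exact: measurable_cst.
pose aff (x : measurableTypeR R) : measurableTypeR R := c * x + b.
pose push : {measure set (measurableTypeR R) -> \bar R} :=
  measure_function_pushforward__canonical__measure_function_Measure lambda maff.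
pose nu : {measure set (measurableTypeR R) -> \bar R} :=
  mscale (NngNum c0') push.
have nuE A : measurable A -> lambda A = nu A.
  apply: lebesgue_measure_unique => _ [[u v] _ <-].
  rewrite /nu /= /mscale/= /pushforward/= -/aff.
  rewrite (_ : aff @^-1` _ = `](u - b) / c, (v - b) / c]%classic); last first.
    apply/seteqP; split => x /=; rewrite !in_itv/= ltr_pdivrMr// ler_pdivlMr//;
      by rewrite ltrBlDr lerBrDr (mulrC x).
  rewrite !lebesgue_measure_itv/= !lte_fin ltr_pM2r ?invr_gt0// ltrD2r.
  case: ifPn => _; last by rewrite mule0.
  by rewrite -!EFinB -EFinM; congr _%:E; field; rewrite gt_eqF.
transitivity (c^-1%:E * \int[nu]_x f x)%E; last first.
  congr *%E; apply: eq_measure_integral => A mA _; exact/esym/nuE.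
rewrite /nu ge0_integral_mscale//= muleA -EFinM mulVf ?gt_eqF// mul1e.
by rewrite ge0_integral_pushforward.
Qed.

(** Density of a standard Gaussian pair of correlation [r] with respect to the
    independent pair. *)
Definition mehler (r x y : R) : R :=
  (Num.sqrt (1 - r ^+ 2))^-1 *
  expR ((2 * r * x * y - r ^+ 2 * (x ^+ 2 + y ^+ 2)) / (2 * (1 - r ^+ 2))).

Lemma mehlerC r x y : mehler r x y = mehler r y x.
Proof.
rewrite /mehler (addrC (y ^+ 2)) (_ : 2 * r * y * x = 2 * r * x * y)//.
by rewrite mulrAC.
Qed.

Lemma mehler_ge0 r x y : 0 <= mehler r x y.
Proof. by rewrite mulr_ge0 ?expR_ge0// invr_ge0 sqrtr_ge0. Qed.

Lemma mehler0 x y : mehler 0 x y = 1.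
Proof.
by rewrite /mehler expr0n/= subr0 sqrtr1 invr1 !(mulr0, mul0r) subr0 mul0r expR0 mulr1.
Qed.

Lemma measurable_mehler r d (T : measurableType d) (f g : T -> R) :
  measurable_fun setT f -> measurable_fun setT g ->
  measurable_fun setT (fun t => mehler r (f t) (g t)).
Proof.
move=> mf mg; apply: measurable_funM; first exact: measurable_cst.
apply: measurableT_comp => //.
apply: measurable_funM; last exact: measurable_cst.
apply: measurable_funB.
  apply: measurable_funM => //; apply: measurable_funM => //; exact: measurable_cst.
apply: measurable_funM; first exact: measurable_cst.
by apply: measurable_funD; exact: measurable_funX.
Qed.

(** Completing the square. *)
Lemma gam_expquad (a v : R) : 0 < v ->
  (\int[gam]_x (expR (a * x - (v - 1) * x ^+ 2 / 2))%:E =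
   ((Num.sqrt v)^-1 * expR (a ^+ 2 / (2 * v)))%:E)%E.
Proof.
move=> v0.
have sv0 : 0 < Num.sqrt v by rewrite sqrtr_gt0.
rewrite gam_density; last 2 first.
- apply/measurable_EFinP; apply: measurableT_comp => //.
  apply: measurable_funB.
    by apply: measurable_funM => //; exact: measurable_cst.
  apply: measurable_funM; last exact: measurable_cst.
  by apply: measurable_funM; [exact: measurable_cst|exact: measurable_funX].
- by move=> x; rewrite lee_fin expR_ge0.
set C := _ * expR (a ^+ 2 / _).
have C0 : 0 <= C by rewrite mulr_ge0 ?expR_ge0// invr_ge0 sqrtr_ge0.
transitivity (\int[lambda]_x
    (C%:E * (normal_pdf (a / v) (Num.sqrt v)^-1 x)%:E))%E; last first.
  rewrite ge0_integralZl//.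
  - by rewrite integral_normal_pdf mule1.
  - by apply/measurable_EFinP; exact: measurable_normal_pdf.
  - by move=> x _; rewrite lee_fin normal_pdf_ge0.
apply: eq_integral => x _; rewrite -!EFinM; congr _%:E.
have svn0 : (Num.sqrt v)^-1 != 0 by rewrite invr_eq0 gt_eqF.
rewrite !normal_pdfE ?oner_neq0// /normal_peak /normal_fun /C.
have -> : Num.sqrt (((Num.sqrt v)^-1) ^+ 2 * pi *+ 2) =
    (Num.sqrt v)^-1 * Num.sqrt (1 ^+ 2 * pi *+ 2) :> R.
  rewrite -mulrnAr -[in RHS]mulrnAr sqrtrM ?sqr_ge0// sqrtr_sqr.
  by rewrite ger0_norm ?invr_ge0 ?sqrtr_ge0// expr1n mul1r.
rewrite (invfM (Num.sqrt v)^-1) invrK.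
set p := (Num.sqrt _)^-1.
rewrite mulrCA -expRD.
rewrite [RHS](_ : _ = p * ((Num.sqrt v)^-1 * Num.sqrt v) *
  (expR (a ^+ 2 / (2 * v)) *
   expR (- (x - a / v) ^+ 2 / ((Num.sqrt v)^-1 ^+ 2 *+ 2)))); last by ring.
rewrite mulVf ?gt_eqF// mulr1 -expRD; congr (_ * expR _).
rewrite exprVn sqr_sqrtr ?ltW//.
by field; rewrite gt_eqF.
Qed.

Lemma gam_opp (f : R -> \bar R) :
  measurable_fun setT f -> (forall x, 0 <= f x)%E ->
  (\int[gam]_x f (- x)%R = \int[gam]_x f x)%E.
Proof.
move=> mf f0.
have mfN : measurable_fun setT (fun x : R => f (- x)) by exact: measurableT_comp.
rewrite !gam_density//.
pose g x := (f x * (normal_pdf 0 1 x)%:E)%E.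
have mg : measurable_fun setT g.
  by apply: emeasurable_funM => //; apply/measurable_EFinP; exact: measurable_normal_pdf.
transitivity (\int[lambda]_x g (- x)%R)%E.
  apply: eq_integral => x _; rewrite /g; congr (_ * _%:E)%E.
  by rewrite !normal_pdfE ?oner_neq0// /normal_fun !subr0 sqrrN.
transitivity (\int[pushforward lambda (-%R : _ -> measurableTypeR R)]_x g x)%E.
  rewrite ge0_integral_pushforward//= => x _.
  by rewrite mule_ge0// lee_fin normal_pdf_ge0.
by apply: eq_measure_integral => A mA _; exact: lebesgue_measureN.
Qed.

(** The variable [s x + c y], with [y] standard normal and [c > 0], has
    density [mehler s x] with respect to the standard normal law. *)
Lemma mehler_shift_pos (s c x : R) (f : R -> \bar R) : 0 < c ->
  c ^+ 2 + s ^+ 2 = 1 ->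
  measurable_fun setT f -> (forall x, 0 <= f x)%E ->
  (\int[gam]_y f (s * x + c * y)%R = \int[gam]_y (f y * (mehler s x y)%:E))%E.
Proof.
move=> c0 cs mf f0.
have c2 : 1 - s ^+ 2 = c ^+ 2 by rewrite -cs; ring.
rewrite !gam_density//; last 3 first.
- apply: emeasurable_funM => //; apply/measurable_EFinP.
  by apply: measurable_mehler => //; exact: measurable_cst.
- by move=> y; rewrite mule_ge0// lee_fin mehler_ge0.
- apply: measurableT_comp => //; apply: measurable_funD; first exact: measurable_cst.
  by apply: measurable_funM => //; exact: measurable_cst.
pose g z := (f z * (normal_pdf 0 1 ((z - s * x) / c))%:E)%E.
have g0 z : (0 <= g z)%E by rewrite mule_ge0// lee_fin normal_pdf_ge0.
have mg : measurable_fun setT g.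
  apply: emeasurable_funM => //; apply/measurable_EFinP.
  apply: measurableT_comp; first exact: measurable_normal_pdf.
  apply: measurable_funM; last exact: measurable_cst.
  by apply: measurable_funB => //; exact: measurable_cst.
transitivity (\int[lambda]_y g (c * y + s * x)%R)%E.
  apply: eq_integral => y _; rewrite /g addrC addrK.
  by have -> : c * y / c = y by rewrite mulrC mulKf// gt_eqF.
rewrite lebesgue_affine// -ge0_integralZl ?lee_fin ?invr_ge0 ?ltW//.
apply: eq_integral => y _; rewrite /g muleCA -!muleA -!EFinM; congr (_ * _%:E)%E.
rewrite !normal_pdfE ?oner_neq0// /mehler c2 sqrtr_sqr gtr0_norm//.
rewrite /normal_fun mulrCA [RHS]mulrCA; congr (_ * _).
rewrite -[RHS]mulrA; congr (_ * _); rewrite -expRD; congr expR.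
have s2 : s ^+ 2 = 1 - c ^+ 2 by rewrite -cs; ring.
rewrite s2; apply/eqP; rewrite -subr_eq0; apply/eqP.
rewrite (_ : _ - _ = (1 - c ^+ 2 - s ^+ 2) * x ^+ 2 / (2 * c ^+ 2)); last first.
  by field; rewrite gt_eqF.
by rewrite s2 subrr mul0r mul0r.
Qed.

Lemma mehler_shift (s c x : R) (f : R -> \bar R) : c != 0 ->
  c ^+ 2 + s ^+ 2 = 1 ->
  measurable_fun setT f -> (forall x, 0 <= f x)%E ->
  (\int[gam]_y f (s * x + c * y)%R = \int[gam]_y (f y * (mehler s x y)%:E))%E.
Proof.
move=> c0 cs mf f0; have [c_gt0|c_le0] := ltP 0 c; first exact: mehler_shift_pos.
have c_lt0 : 0 < - c by rewrite oppr_gt0 lt_neqAle c0.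
rewrite -(mehler_shift_pos (c := - c))//; last by rewrite sqrrN.
rewrite -[RHS]gam_opp//.
- by apply: eq_integral => y _; rewrite mulrNN.
- apply: measurableT_comp => //; apply: measurable_funD; first exact: measurable_cst.
  by apply: measurable_funM => //; exact: measurable_cst.
Qed.

(** Composing two Gaussian channels multiplies their correlations. Completing
    the square in the intermediate variable makes this explicit. *)
Lemma mehler_semigroup (q r x z : R) : q ^+ 2 < 1 -> r ^+ 2 < 1 ->
  (\int[gam]_y ((mehler q x y)%:E * (mehler r y z)%:E) =
   (mehler (q * r) x z)%:E)%E.
Proof.
move=> q1 r1.
have q0 : 0 < 1 - q ^+ 2 by rewrite subr_gt0.
have r0 : 0 < 1 - r ^+ 2 by rewrite subr_gt0.
have qr0 : 0 < 1 - (q * r) ^+ 2.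
  by rewrite subr_gt0 exprMn mulr_ilt1// sqr_ge0.
pose v := (1 - (q * r) ^+ 2) / ((1 - q ^+ 2) * (1 - r ^+ 2)).
have v0 : 0 < v by rewrite divr_gt0// mulr_gt0.
pose a := q * x / (1 - q ^+ 2) + r * z / (1 - r ^+ 2).
pose K := (Num.sqrt (1 - q ^+ 2))^-1 * (Num.sqrt (1 - r ^+ 2))^-1 *
  expR (- (q ^+ 2 * x ^+ 2 / (2 * (1 - q ^+ 2))) -
        r ^+ 2 * z ^+ 2 / (2 * (1 - r ^+ 2))).
have K0 : 0 <= K by rewrite !mulr_ge0 ?expR_ge0 ?invr_ge0 ?sqrtr_ge0.
transitivity (\int[gam]_y (K%:E * (expR (a * y - (v - 1) * y ^+ 2 / 2))%:E))%E.
  apply: eq_integral => y _; rewrite -!EFinM; congr _%:E.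
  rewrite /mehler /K mulrACA -expRD -[RHS]mulrA -expRD; congr (_ * expR _).
  by rewrite /a /v; field; rewrite !gt_eqF.
rewrite ge0_integralZl//.
- rewrite gam_expquad// -EFinM; congr _%:E.
  rewrite /K /mehler mulrACA -expRD; congr (_ * expR _).
    rewrite -invfM -sqrtrM ?ltW// -invfM -sqrtrM ?mulr_ge0 ?ltW//.
    by congr (Num.sqrt _)^-1; rewrite /v; field; rewrite !gt_eqF.
  by rewrite /a /v; field; rewrite !gt_eqF.
- apply/measurable_EFinP; apply: measurableT_comp => //.
  apply: measurable_funB.
    by apply: measurable_funM => //; exact: measurable_cst.
  apply: measurable_funM; last exact: measurable_cst.
  by apply: measurable_funM; [exact: measurable_cst|exact: measurable_funX].
Qed.

Lemma mehler_trace (q : R) : 0 <= q < 1 ->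
  (\int[gam]_x (mehler q x x)%:E = ((1 - q)^-1)%:E)%E.
Proof.
move=> /andP[q0 q1].
have q2 : 0 < 1 - q ^+ 2 by rewrite subr_gt0 expr_lt1.
have p1 : 0 < 1 + q by rewrite ltr_wpDr.
pose v := (1 - q) / (1 + q).
have v0 : 0 < v by rewrite divr_gt0 ?subr_gt0.
transitivity (\int[gam]_x (((Num.sqrt (1 - q ^+ 2))^-1)%:E *
    (expR (0 * x - (v - 1) * x ^+ 2 / 2))%:E))%E.
  apply: eq_integral => x _; rewrite -EFinM /mehler; congr (_ * expR _)%:E.
  by rewrite /v; field; rewrite !gt_eqF.
rewrite ge0_integralZl//.
- rewrite gam_expquad// expr0n/= mul0r expR0 mulr1 -EFinM -invfM.
  rewrite -sqrtrM ?ltW//; congr (_^-1)%:E.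
  rewrite (_ : _ * _ = (1 - q) ^+ 2); last first.
    by rewrite /v; field; rewrite gt_eqF.
  by rewrite sqrtr_sqr gtr0_norm// subr_gt0.
- apply/measurable_EFinP; apply: measurableT_comp => //.
  apply: measurable_funB.
    by apply: measurable_funM => //; exact: measurable_cst.
  apply: measurable_funM; last exact: measurable_cst.
  by apply: measurable_funM; [exact: measurable_cst|exact: measurable_funX].
Qed.

Lemma gam2_expquad (p u : R) : 0 < 1 + 2 * u -> p ^+ 2 < (1 + 2 * u) ^+ 2 ->
  (\int[gam]_a \int[gam]_b (expR (p * a * b - u * (a ^+ 2 + b ^+ 2)))%:E =
   ((Num.sqrt ((1 + 2 * u) ^+ 2 - p ^+ 2))^-1)%:E)%E.
Proof.
move=> v0 pv.
set v := 1 + 2 * u in v0 pv *.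
have w0 : 0 < (v ^+ 2 - p ^+ 2) / v by rewrite divr_gt0// subr_gt0.
have inner a : (\int[gam]_b (expR (p * a * b - u * (a ^+ 2 + b ^+ 2)))%:E =
   ((Num.sqrt v)^-1)%:E *
   (expR (0 * a - ((v ^+ 2 - p ^+ 2) / v - 1) * a ^+ 2 / 2))%:E)%E.
  transitivity (\int[gam]_b ((expR (- u * a ^+ 2))%:E *
      (expR (p * a * b - (v - 1) * b ^+ 2 / 2))%:E))%E.
    apply: eq_integral => b _; rewrite -EFinM -expRD; congr (expR _)%:E.
    by rewrite /v; field.
  rewrite ge0_integralZl//.
  - rewrite gam_expquad// -!EFinM mulrCA -expRD; congr (_ * expR _)%:E.
    by rewrite /v; field; rewrite gt_eqF.
  - apply/measurable_EFinP; apply: measurableT_comp => //.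
    apply: measurable_funB.
      by apply: measurable_funM => //; exact: measurable_cst.
    apply: measurable_funM; last exact: measurable_cst.
    by apply: measurable_funM; [exact: measurable_cst|exact: measurable_funX].
under eq_integral do rewrite inner.
rewrite ge0_integralZl//.
- rewrite gam_expquad// expr0n/= mul0r expR0 mulr1 -EFinM -invfM.
  rewrite -sqrtrM ?ltW//; congr ((Num.sqrt _)^-1)%:E.
  by field; rewrite gt_eqF.
- apply/measurable_EFinP; apply: measurableT_comp => //.
  apply: measurable_funB.
    by apply: measurable_funM => //; exact: measurable_cst.
  apply: measurable_funM; last exact: measurable_cst.
  by apply: measurable_funM; [exact: measurable_cst|exact: measurable_funX].
Qed.

(** Rotating first the second variable into [v = s x + c y] and then the
    first one back uses the Mehler density twice; the two uses cancel because
    the kernel is symmetric. *)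
Lemma gam_rotation (c s : R) (f : R * R -> \bar R) : c ^+ 2 + s ^+ 2 = 1 ->
  measurable_fun setT f -> (forall x, 0 <= f x)%E ->
  (\int[gam]_x \int[gam]_y f (c * x - s * y, s * x + c * y)%R =
   \int[gam]_x \int[gam]_y f (x, y))%E.
Proof.
move=> cs mf f0.
have mf1 y : measurable_fun setT (fun x => f (x, y)).
  exact: (measurableT_comp mf (pair2_measurable y)).
have mf2 x : measurable_fun setT (fun y => f (x, y)).
  exact: (measurableT_comp mf (pair1_measurable x)).
have [c0|c0] := eqVneq c 0.
  have s1 : (s == 1) || (s == -1).
    by rewrite -eqf_sqr expr1n -cs c0 expr0n/= add0r.
  case/orP : s1 => /eqP s1.
  - transitivity (\int[gam]_x \int[gam]_y f (y, x))%E.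
      apply: eq_integral => x _; rewrite -[RHS]gam_opp//.
      by apply: eq_integral => y _; rewrite c0 s1 !mul0r !mul1r sub0r addr0.
    rewrite (fubini_tonelli (fun p => f (p.2, p.1)))//.
    by apply: (measurableT_comp mf); exact: measurable_fun_pair.
  - transitivity (\int[gam]_x \int[gam]_y f (y, - x)%R)%E.
      apply: eq_integral => x _.
      by apply: eq_integral => y _; rewrite c0 s1 !mul0r !mulN1r add0r opprK addr0.
    rewrite (fubini_tonelli (fun p : R * R => f (p.2, - p.1)%R))//; last first.
      apply: (measurableT_comp mf); apply: measurable_fun_pair => //.
      exact: measurableT_comp.
    by apply: eq_integral => x _; rewrite (gam_opp (f := fun y => f (x, y))).
have mshear : measurable_fun setT (fun p : R * R => f ((p.1 - s * p.2) / c, p.2)).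
  apply: measurableT_comp => //; apply: measurable_fun_pair => //.
  apply: measurable_funM; last exact: measurable_cst.
  apply: measurable_funB => //.
  by apply: measurable_funM => //; exact: measurable_cst.
transitivity (\int[gam]_x \int[gam]_y
    (f ((x - s * y) / c, y)%R * (mehler s x y)%:E))%E.
  apply: eq_integral => x _.
  rewrite -(@mehler_shift s c x (fun v => f ((x - s * v) / c, v)%R))//; last first.
    exact: (measurableT_comp mshear (pair1_measurable x)).
  apply: eq_integral => y _; congr (f (_, _)).
  have -> : c * x - s * y = ((c ^+ 2 + s ^+ 2) * x - s * (s * x + c * y)) / c.
    by field.
  by rewrite cs mul1r.
rewrite (fubini_tonelli (fun p : R * R => f ((p.1 - s * p.2) / c, p.2)%R *
    (mehler s p.1 p.2)%:E)%E)/=; last 2 first.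
- by apply: emeasurable_funM => //; apply/measurable_EFinP; exact: measurable_mehler.
- by move=> x; rewrite mule_ge0// lee_fin mehler_ge0.
rewrite [RHS](fubini_tonelli f)//; apply: eq_integral => y _.
transitivity (\int[gam]_x (f ((x - s * y) / c, y)%R * (mehler s y x)%:E))%E.
  by apply: eq_integral => x _; rewrite mehlerC.
rewrite -(@mehler_shift s c y (fun x => f ((x - s * y) / c, y)%R))//; last first.
  exact: (measurableT_comp mshear (pair2_measurable y)).
by apply: eq_integral => x _; congr (f (_, _)); field.
Qed.

End Gaussian.

(** * Linear images of standard normal vectors *)

Section Moments.
Context (R : realType).
Local Notation gam := (gam R).
Local Open Scope ereal_scope.

Lemma invsqrt_le (a y : R) : (0 < a)%R -> (0 < y)%R -> (1 <= a * y ^+ 2)%R ->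
  ((Num.sqrt a)^-1 <= y)%R.
Proof.
move=> a0 y0 ay; rewrite -[leLHS]mul1r ler_pdivrMr ?sqrtr_gt0//.
rewrite -(@ler_pXn2r _ 2%N) ?nnegrE ?mulr_ge0 ?sqrtr_ge0 ?(ltW y0)//.
by rewrite expr1n exprMn sqr_sqrtr ?(ltW a0)// mulrC.
Qed.

(** The bounds [e^u >= 1 + u] at [u = x^2 h/2] and [u = - x^2 h/2] pinch the
    second moment between two quantities that tend to [1] with [h]. *)
Lemma gam_moment2 : \int[gam]_x ((x ^+ 2)%R)%:E = 1.
Proof.
have msq : measurable_fun setT (fun x : R => ((x ^+ 2)%R)%:E).
  by apply/measurable_EFinP; exact: measurable_funX.
have sq0 (x : R) : 0 <= ((x ^+ 2)%R)%:E by rewrite lee_fin sqr_ge0.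
have mexp (c : R) : measurable_fun setT (fun x : R => (expR (c * x ^+ 2)%R)%:E).
  apply/measurable_EFinP; apply: measurableT_comp => //.
  by apply: measurable_funM; [exact: measurable_cst|exact: measurable_funX].
have gexp (h : R) : (0 < 1 + h)%R ->
    \int[gam]_x (expR (- (h / 2) * x ^+ 2)%R)%:E = ((Num.sqrt (1 + h))^-1)%:E.
  move=> h0.
  transitivity (\int[gam]_x (expR (0 * x - ((1 + h) - 1) * x ^+ 2 / 2)%R)%:E).
    by apply: eq_integral => x _; congr (expR _)%:E; field.
  by rewrite gam_expquad// expr0n/= mul0r expR0 mulr1.
have cst1 : \int[gam]_x (cst 1 x) = 1.
  by rewrite integral_cst//= mul1e probability_setT.
set kappa := \int[gam]_x _.
have up (h : R) : (0 < h < 1)%R ->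
    (h / 2)%:E * kappa + 1 <= ((Num.sqrt (1 - h))^-1)%:E.
  move=> /andP[h0 h1].
  have hh : 0 <= (h / 2)%:E by rewrite lee_fin divr_ge0// ltW.
  rewrite -(gexp (- h)%R) ?subr_gt0// -cst1 -ge0_integralZl//.
  rewrite -ge0_integralD//; last 2 first.
  - by move=> x _; rewrite mule_ge0.
  - by apply: emeasurable_funM => //; exact: measurable_cst.
  apply: ge0_le_integral => //.
  - by move=> x _; rewrite adde_ge0// mule_ge0.
  - by apply: emeasurable_funD => //; apply: emeasurable_funM => //; exact: measurable_cst.
  - move=> x _; rewrite -EFinM -EFinD lee_fin !mulNr opprK addrC.
    exact: expR_ge1Dx.
have lo (h : R) : (0 < h < 1)%R ->
    1 <= ((Num.sqrt (1 + h))^-1)%:E + (h / 2)%:E * kappa.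
  move=> /andP[h0 h1].
  have hh : 0 <= (h / 2)%:E by rewrite lee_fin divr_ge0// ltW.
  rewrite -gexp ?addr_gt0// -[leLHS]cst1 -ge0_integralZl//.
  rewrite -ge0_integralD//; last 2 first.
  - by move=> x _; rewrite mule_ge0.
  - by apply: emeasurable_funM => //; exact: measurable_cst.
  apply: ge0_le_integral => //.
  - by apply: emeasurable_funD => //; apply: emeasurable_funM => //; exact: measurable_cst.
  - move=> x _; rewrite -EFinM -EFinD lee_fin -lerBlDr.
    by rewrite (le_trans _ (expR_ge1Dx _))// mulNr.
have kfin : kappa \is a fin_num.
  rewrite ge0_fin_numE; last exact: integral_ge0.
  rewrite ltey; apply/eqP => ky; have := up 2^-1%R.
  rewrite ky invr_gt0 invf_lt1// ltr1n ltr0n/= mulry gtr0_sg ?divr_gt0 ?invr_gt0//.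
  by rewrite mul1e addye// leye_eq => /(_ isT).
move: up lo; rewrite -(fineK kfin); set k := fine kappa => up lo.
have bup (h : R) : (0 < h < 4^-1)%R -> (k <= 1 + 2 * h)%R.
  move=> /andP[h0 h4]; have h1 : (h < 1)%R by lra.
  have := up h; rewrite h0 h1 => /(_ isT).
  rewrite -EFinM -EFinD lee_fin => hk.
  have : ((Num.sqrt (1 - h))^-1 <= 1 + h / 2 + h ^+ 2)%R.
    apply: invsqrt_le; [lra|by have := sqr_ge0 h; lra|].
    rewrite (_ : _ * _ = 1 + h ^+ 2 * (5 / 4 - 5 / 4 * h - h ^+ 3))%R; last by field.
    rewrite lerDl mulr_ge0 ?sqr_ge0//.
    have : (h ^+ 3 <= h)%R by rewrite ler_iXnr// ltW.
    lra.
  move=> hs; have {hk hs} hk := le_trans hk hs; nra.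
have blo (h : R) : (0 < h < 4^-1)%R -> (1 - 2 * h <= k)%R.
  move=> /andP[h0 h4]; have h1 : (h < 1)%R by lra.
  have := lo h; rewrite h0 h1 => /(_ isT).
  rewrite -EFinM -EFinD lee_fin => hk.
  have : ((Num.sqrt (1 + h))^-1 <= 1 - h / 2 + h ^+ 2)%R.
    apply: invsqrt_le; [lra|by have := sqr_ge0 h; lra|].
    rewrite (_ : _ * _ = 1 + h ^+ 2 * (5 / 4 + 5 / 4 * h + h ^+ 3))%R; last by field.
    rewrite lerDl mulr_ge0 ?sqr_ge0//.
    have : (0 <= h ^+ 3)%R by rewrite exprn_ge0// ltW.
    lra.
  move=> hs; nra.
congr _%:E; apply/eqP; rewrite eq_le; apply/andP; split; apply/ler_addgt0Pr => e e0.
- have [e4|e4] := ltP (e / 2)%R 4^-1%R.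
    have := bup (e / 2)%R; rewrite divr_gt0// e4 => /(_ isT); lra.
  have := bup 8^-1%R; have -> : (0 < (8^-1 : R) < 4^-1)%R by lra.
  by move=> /(_ isT); lra.
- have [e4|e4] := ltP (e / 2)%R 4^-1%R.
    have := blo (e / 2)%R; rewrite divr_gt0// e4 => /(_ isT); lra.
  have := blo 8^-1%R; have -> : (0 < (8^-1 : R) < 4^-1)%R by lra.
  by move=> /(_ isT); lra.
Qed.

Lemma iid_coord d (T : measurableType d) (mu : probability T R) n (i : 'I_n)
    (f : T -> \bar R) : measurable_fun setT f -> (forall x, 0 <= f x) ->
  \int[iid mu n]_t f (tnth t i) = \int[mu]_x f x.
Proof.
move=> mf f0.
have := @iid_pull _ _ _ mu n i f (cst 1) mf f0 (measurable_cst _).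
rewrite integral_cst//= probability_setT !mule1 => <-//.
by apply: eq_integral => t _; rewrite mule1.
Qed.

Lemma integrable_coordM n (i j : 'I_n) :
  (iid gam n).-integrable setT (fun t => (tnth t i * tnth t j)%:E).
Proof.
have int2 (k : 'I_n) : (iid gam n).-integrable setT (fun t => (tnth t k ^+ 2)%:E).
  apply/integrableP; split.
    apply/measurable_EFinP; apply: measurable_funX; exact: measurable_tnth.
  under eq_integral do rewrite gee0_abs ?lee_fin ?sqr_ge0//.
  rewrite (iid_coord gam k (f := fun x : R => (x ^+ 2)%:E)).
  - by rewrite gam_moment2 ltry.
  - by apply/measurable_EFinP; exact: measurable_funX.
  - by move=> x; rewrite lee_fin sqr_ge0.
apply: (le_integrable _ _ _ (integrableD _ (int2 i) (int2 j))) => //.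
- by apply/measurable_EFinP; apply: measurable_funM; exact: measurable_tnth.
- move=> t _ /=; rewrite lee_fin [leRHS]ger0_norm ?addr_ge0 ?sqr_ge0// ler_norml.
  by apply/andP; split; nra.
Qed.

Lemma integrable_coord n (i : 'I_n) :
  (iid gam n).-integrable setT (fun t => (tnth t i)%:E).
Proof.
have int1 : (iid gam n).-integrable setT (cst 1%:E).
  exact: finite_measure_integrable_cst.
apply: (le_integrable _ _ _ (integrableD _ int1 (integrable_coordM i i))) => //.
- by apply/measurable_EFinP; exact: measurable_tnth.
- move=> t _ /=; have := sqr_ge0 (tnth t i); rewrite expr2 => t2.
  rewrite lee_fin [leRHS]ger0_norm ?addr_ge0// ler_norml.
  by apply/andP; split; nra.
Qed.

(** Reflecting one coordinate preserves the law and changes the sign. *)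
Lemma iid_gam_odd n (i : 'I_n) (g : n.-tuple R -> R) :
  (iid gam n).-integrable setT (EFin \o g) ->
  (forall t : n.-tuple R, g (upd t i (- tnth t i)%R) = (- g t)%R) ->
  \int[iid gam n]_t (g t)%:E = 0.
Proof.
move=> ig gN; have mg := measurable_int _ ig.
have mrefl : measurable_fun setT (fun t : n.-tuple R => upd t i (- tnth t i)%R).
  apply/measurable_fun_tnthP => j.
  rewrite (_ : _ \o _ = fun t : n.-tuple R =>
      if j == i then (- tnth t i)%R else tnth t j); last first.
    by apply/funext => t /=; rewrite tnth_upd.
  case: (j == i); last exact: measurable_tnth.
  by apply: measurableT_comp => //; exact: measurable_tnth.
have refl : has_law (iid gam n) (fun t : n.-tuple R => upd t i (- tnth t i)%R)
    (iid gam n).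
  apply: integral_has_law => // f mf f0.
  rewrite (iid_resample _ i)//; last exact: measurableT_comp.
  rewrite [RHS](iid_resample gam i mf f0); apply: eq_integral => t _.
  rewrite -[RHS](gam_opp (f := fun x => f (upd t i x)))//.
    apply: eq_integral => x _; congr (f _); apply: eq_from_tnth => j.
    rewrite tnth_upd [RHS]tnth_upd; case: eqVneq => ji.
      by rewrite tnth_upd eqxx.
    by rewrite tnth_upd (negbTE ji).
  exact: (measurableT_comp mf (measurable_upd2 t i)).
have := has_law_integral refl mg.
under eq_integral do rewrite /= gN EFinN.
rewrite integralN; last first.
  exact: (integrable_add_def measurableT ig).
have := integrable_fin_num measurableT ig.
rewrite /=; case: (\int[iid gam n]_t _) => // r _ [] rr.
by congr _%:E; apply/eqP; rewrite -eqNr rr.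
Qed.

Lemma iid_gam_lin n (a : 'I_n -> R) (b : R) :
  \int[iid gam n]_t (\sum_i a i * tnth t i + b)%:E = b%:E.
Proof.
under eq_integral do rewrite EFinD -sumEFin.
have ia i : (iid gam n).-integrable setT (fun t => (a i * tnth t i)%:E).
  exact: (integrableZl measurableT (a i) (integrable_coord i)).
rewrite integralD//; last 2 first.
- exact: integrable_sum.
- exact: finite_measure_integrable_cst.
rewrite integral_cst//= probability_setT mule1.
rewrite integral_sum// big1 ?add0e// => i _.
apply: (iid_gam_odd (i := i) (g := fun t => a i * tnth t i)%R); first exact: ia.
by move=> t; rewrite tnth_upd eqxx mulrN.
Qed.

Lemma iid_gam_bilin n (a b : 'I_n -> R) :
  \int[iid gam n]_t ((\sum_i a i * tnth t i) * (\sum_i b i * tnth t i))%:E =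
  (\sum_i a i * b i)%:E.
Proof.
have iab i j : (iid gam n).-integrable setT
    (fun t => (a i * b j * (tnth t i * tnth t j))%:E).
  exact: (integrableZl measurableT (a i * b j) (integrable_coordM i j)).
transitivity (\int[iid gam n]_t
    \sum_i \sum_j (a i * b j * (tnth t i * tnth t j))%:E).
  apply: eq_integral => t _; rewrite mulr_suml -sumEFin; apply: eq_bigr => i _.
  by rewrite mulr_sumr -sumEFin; apply: eq_bigr => j _; congr _%:E; ring.
rewrite integral_sum//; last by move=> i; exact: integrable_sum.
rewrite -sumEFin; apply: eq_bigr => i _.
rewrite integral_sum// (bigD1 i)//= [X in _ + X]big1 ?adde0.
  under eq_integral do rewrite EFinM.
  rewrite integralZl//; last exact: integrable_coordM.
  transitivity ((a i * b i)%:E * \int[iid gam n]_t (tnth t i ^+ 2)%:E).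
    by congr (_ * _); apply: eq_integral => t _; rewrite expr2.
  rewrite (iid_coord gam i (f := fun x : R => (x ^+ 2)%:E)).
  - by rewrite gam_moment2 mule1.
  - by apply/measurable_EFinP; exact: measurable_funX.
  - by move=> x; rewrite lee_fin sqr_ge0.
move=> j ji.
apply: (iid_gam_odd (i := i) (g := fun t => a i * b j * (tnth t i * tnth t j))%R).
  exact: iab.
by move=> t; rewrite !tnth_upd eqxx (negbTE ji) mulNr mulrN.
Qed.

End Moments.

Section Columns.
Context (R : realType) (m : nat).
Local Notation gam := (gam R).
Local Open Scope ereal_scope.
Implicit Types (a b c : 'I_m -> R) (cs : seq ('I_m -> R)).
Implicit Types (f g : m.-tuple R -> \bar R) (x : m.-tuple R).

Definition addcol x (z : R) c : m.-tuple R :=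
  [tuple (tnth x k + z * c k)%R | k < m].

Lemma measurable_addcol c :
  measurable_fun setT (fun p : m.-tuple R * R => addcol p.1 p.2 c).
Proof.
apply/measurable_fun_tnthP => k.
rewrite (_ : _ \o _ = fun p => tnth p.1 k + p.2 * c k)%R; last first.
  by apply/funext => p /=; rewrite tnth_mktuple.
apply: measurable_funD.
  exact: (measurableT_comp (measurable_tnth k) measurable_fst).
by apply: measurable_funM => //; exact: measurable_cst.
Qed.

Definition good f := measurable_fun setT f /\ (forall x, 0 <= f x).

(** The law of [x + z_1 c_1 + ... + z_l c_l] for independent standard normal
    [z_i], seen as an operator on test functions. The columns [c_i] may be
    permuted and rotated pairwise without changing it, which is all that the
    reduction of a matrix with orthonormal rows requires. *)
Definition smear c f : m.-tuple R -> \bar R :=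
  fun x => \int[gam]_z f (addcol x z c).
Definition smears cs f := foldr smear f cs.

Lemma good_comp c f : good f ->
  measurable_fun setT (fun p : m.-tuple R * R => f (addcol p.1 p.2 c)).
Proof. by move=> [mf _]; exact: (measurableT_comp mf (measurable_addcol c)). Qed.

Lemma good_comp2 c f x : good f -> measurable_fun setT (fun z => f (addcol x z c)).
Proof. by move=> gf; exact: (measurableT_comp (good_comp c gf) (pair1_measurable x)). Qed.

Lemma good_smear c f : good f -> good (smear c f).
Proof.
move=> gf; split; last by move=> x; apply: integral_ge0 => z _; apply: gf.2.
apply: (measurable_fun_fubini_tonelli_F
  (fun p : m.-tuple R * R => f (addcol p.1 p.2 c))).
  exact: good_comp.
by move=> p; exact: gf.2.
Qed.

Lemma good_smears cs f : good f -> good (smears cs f).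
Proof. by move=> gf; elim: cs => //= c cs; exact: good_smear. Qed.

Lemma measurable_addcol2 a b f x : good f ->
  measurable_fun setT (fun p : R * R => f (addcol (addcol x p.1 a) p.2 b)).
Proof.
move=> [mf _]; apply: (measurableT_comp mf).
apply/measurable_fun_tnthP => k.
rewrite (_ : _ \o _ = fun p => tnth x k + p.1 * a k + p.2 * b k)%R; last first.
  by apply/funext => p /=; rewrite !tnth_mktuple.
apply: measurable_funD.
  apply: measurable_funD; first exact: measurable_cst.
  by apply: measurable_funM => //; exact: measurable_cst.
by apply: measurable_funM => //; exact: measurable_cst.
Qed.

Lemma smearC a b f : good f -> smear a (smear b f) = smear b (smear a f).
Proof.
move=> gf; apply/funext => x; rewrite /smear.
rewrite (fubini_tonelli (fun p : R * R => f (addcol (addcol x p.1 a) p.2 b))).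
- apply: eq_integral => z _; apply: eq_integral => w _; congr (f _).
  by apply/eq_from_tnth => k; rewrite !tnth_mktuple addrAC.
- exact: measurable_addcol2.
- by move=> p; exact: gf.2.
Qed.

Lemma smear_rot a b f (u v : R) : good f -> (u ^+ 2 + v ^+ 2 = 1)%R ->
  smear (fun k => u * a k + v * b k)%R (smear (fun k => u * b k - v * a k)%R f) =
  smear a (smear b f).
Proof.
move=> gf uv; apply/funext => x; rewrite /smear.
rewrite -(gam_rotation (f := fun p : R * R => f (addcol (addcol x p.1 a) p.2 b)) uv).
- apply: eq_integral => z _; apply: eq_integral => w _; congr (f _).
  by apply/eq_from_tnth => k; rewrite !tnth_mktuple /=; ring.
- exact: measurable_addcol2.
- by move=> p; exact: gf.2.
Qed.

Lemma smear0 c f : (forall k, c k = 0%R) -> smear c f = f.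
Proof.
move=> c0; apply/funext => x; rewrite /smear.
under eq_integral => z _.
  rewrite (_ : addcol x z c = x); last first.
    by apply/eq_from_tnth => k; rewrite !tnth_mktuple c0 mulr0 addr0.
  over.
by rewrite integral_cst//= probability_setT mule1.
Qed.

Lemma smear_opp c f : good f -> smear (fun k => - c k)%R f = smear c f.
Proof.
move=> gf; apply/funext => x; rewrite /smear.
rewrite -[RHS]gam_opp; [|exact: good_comp2|by move=> z; exact: gf.2].
apply: eq_integral => z _; congr (f _).
by apply/eq_from_tnth => k; rewrite !tnth_mktuple mulrN mulNr.
Qed.

Definition gram cs (i j : 'I_m) : R := (\sum_(c <- cs) c i * c j)%R.

Lemma gram_cons c cs i j : gram (c :: cs) i j = (c i * c j + gram cs i j)%R.
Proof. by rewrite /gram big_cons. Qed.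

Lemma gram0 cs i : gram cs i i = 0%R -> forall c, List.In c cs -> c i = 0%R.
Proof.
elim: cs => //= c cs IH; rewrite gram_cons => /eqP.
have g0 : (0 <= gram cs i i)%R.
  by rewrite /gram big_seq sumr_ge0// => e _; rewrite -expr2 sqr_ge0.
rewrite paddr_eq0 ?mulf_eq0 ?orbb -?expr2 ?sqr_ge0// => /andP[/eqP ci /eqP gi].
by move=> c' [<-//|]; exact: IH.
Qed.

(** Rotating the first column against each other one clears the [k]-th
    coordinate of the latter. *)
Lemma smears_sweep (k : 'I_m) a cs : exists a' cs',
  [/\ forall f, good f -> smears (a :: cs) f = smears (a' :: cs') f,
      forall c, List.In c cs' -> c k = 0%R &
      forall i j, gram (a :: cs) i j = gram (a' :: cs') i j].
Proof.
elim: cs a => [|c cs IH] a; first by exists a, [::].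
pose h := Num.sqrt (a k ^+ 2 + c k ^+ 2).
have h2 : (h ^+ 2 = a k ^+ 2 + c k ^+ 2)%R by rewrite sqr_sqrtr// addr_ge0 ?sqr_ge0.
have [h0|h0] := eqVneq h 0%R.
  have /esym/eqP := h2; rewrite h0 expr0n/=.
  rewrite paddr_eq0 ?sqr_ge0// !sqrf_eq0 => /andP[_ /eqP ck].
  have [a' [cs' [sE c0 gE]]] := IH a.
  exists a', (c :: cs'); split.
  - move=> f gf; rewrite /= smearC; last exact: good_smears.
    have /= -> := sE f gf; rewrite smearC//; exact: good_smears.
  - by move=> d [<-//|]; exact: c0.
  - move=> i j; have := gE i j; rewrite !gram_cons => gij.
    by rewrite addrCA gij addrCA.
pose u := (a k / h)%R; pose v := (c k / h)%R.
have uv : (u ^+ 2 + v ^+ 2 = 1)%R.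
  by rewrite /u /v !expr_div_n -mulrDl -h2 divff// sqrf_eq0.
pose a1 l := (u * a l + v * c l)%R.
pose c1 l := (u * c l - v * a l)%R.
have [a' [cs' [sE c0 gE]]] := IH a1.
exists a', (c1 :: cs'); split.
- move=> f gf; rewrite /= -(smear_rot a c _ uv); last exact: good_smears.
  rewrite smearC; last exact: good_smears.
  have /= -> := sE f gf; rewrite smearC//; exact: good_smears.
- by move=> d [<-|]; [rewrite /c1 /u /v; field|exact: c0].
- move=> i j; have := gE i j; rewrite !gram_cons => gij.
  rewrite [RHS]addrCA -gij /a1 /c1.
  have v2 : (v ^+ 2 = 1 - u ^+ 2)%R by rewrite -uv; ring.
  apply/eqP; rewrite -subr_eq0; apply/eqP.
  rewrite (_ : _ - _ = (1 - u ^+ 2 - v ^+ 2) * (a i * a j + c i * c j))%R; last by ring.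
  by rewrite v2; ring.
Qed.

Definition unitcol (i : 'I_m) : 'I_m -> R := fun k => (k == i)%:R.

Lemma filter_iota_geq p q : (p <= q)%N ->
  [seq x <- iota 0 q | (p <= x)%N] = iota p (q - p).
Proof.
move=> pq; rewrite -[in LHS](subnKC pq) iotaD filter_cat add0n.
rewrite (eq_in_filter (a2 := pred0)); last first.
  by move=> i; rewrite mem_iota /=; lia.
rewrite filter_pred0 cat0s (eq_in_filter (a2 := predT)) ?filter_predT//.
by move=> i; rewrite mem_iota /=; lia.
Qed.

Lemma smears_orthonormal n cs f : (n <= m)%N ->
  (forall i j : 'I_m, gram cs i j = ((i == j) && (m - n <= i)%N)%:R) -> good f ->
  smears cs f =
  smears [seq unitcol i | i <- [seq i : 'I_m <- enum 'I_m | (m - n <= i)%N]] f.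
Proof.
elim: n cs => [|n IH] cs nm gE gf.
  rewrite subn0 (eq_filter (a2 := pred0)); last first.
    by move=> i /=; rewrite leqNgt ltn_ord.
  rewrite filter_pred0 /=.
  have : forall c, List.In c cs -> forall i, c i = 0%R.
    move=> c cin i; apply: (gram0 _ cin).
    by rewrite gE subn0 [(m <= i)%N]leqNgt ltn_ord andbF.
  elim: cs {gE} => //= c cs IHcs c0.
  rewrite smear0; last by move=> k; apply: c0; left.
  by apply: IHcs => d din i; apply: c0; right.
have ltk : (m - n.+1 < m)%N by rewrite ltn_subrL (leq_trans _ nm).
pose k := Ordinal ltk.
case: cs gE => [|a cs] gE.
  by have := gE k k; rewrite /gram big_nil eqxx leqnn => /eqP; rewrite eq_sym oner_eq0.
have [a' [cs' [sE c0 gE']]] := smears_sweep k a cs.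
have g'k j : gram cs' k j = 0%R.
  elim: (cs') c0 => [|c s IHs] c0; first by rewrite /gram big_nil.
  rewrite gram_cons c0 ?mul0r ?add0r; last by left.
  by apply: IHs => d din; apply: c0; right.
have a'k j : (a' k * a' j = (k == j)%:R)%R.
  by have := gE k j; rewrite gE' gram_cons g'k addr0 leqnn andbT.
have ak1 : (a' k ^+ 2 = 1)%R by rewrite expr2 a'k eqxx.
have ak0 : a' k != 0%R by rewrite -sqrf_eq0 ak1 oner_eq0.
have a'E j : j != k -> a' j = 0%R.
  by move=> jk; apply: (mulfI ak0); rewrite a'k eq_sym (negbTE jk) mulr0.
have filtE : [seq i : 'I_m <- enum 'I_m | (m - n.+1 <= i)%N] =
    k :: [seq i : 'I_m <- enum 'I_m | (m - n <= i)%N].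
  apply: (inj_map val_inj); rewrite /= -!filter_map val_enum_ord.
  rewrite !filter_iota_geq; try lia.
  by rewrite subKn// subKn ?(ltnW nm)//= subnSK.
rewrite filtE sE//= -(IH cs')//; last 2 first.
- exact: ltnW.
- move=> i j; have [->|ik] := eqVneq i k.
    rewrite g'k (_ : (m - n <= k)%N = false) ?andbF//=.
    by apply/negbTE; rewrite -ltnNge /= ltn_sub2l.
  have := gE i j; rewrite gE' gram_cons a'E// mul0r add0r => ->.
  have : (i : nat) != (m - n.+1)%N by move: ik; rewrite -(inj_eq val_inj).
  by move=> ik'; congr (_ && _)%:R; lia.
have -> : a' = (fun l => a' k * unitcol k l)%R.
  apply/funext => l; rewrite /unitcol; case: eqVneq => [->|/a'E->].
    by rewrite mulr1.
  by rewrite mulr0.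
move/eqP : ak1; rewrite sqrf_eq1 => /orP[] /eqP ->.
  by rewrite (_ : (fun l => _) = unitcol k)//; apply/funext => l; rewrite mul1r.
rewrite -[RHS]smear_opp; last exact: good_smears.
by rewrite (_ : (fun l => -1 * _)%R = (fun l => - unitcol k l)%R)//; apply/funext => l; rewrite mulN1r.
Qed.

(** A vector [A Z] with [Z] standard normal, obtained one column at a time. *)
Lemma iid_smears n (A : 'I_n -> 'I_m -> R) f x : good f ->
  \int[iid gam n]_t f [tuple (tnth x k + \sum_(i < n) A i k * tnth t i)%R | k < m] =
  smears [seq A i | i <- enum 'I_n] f x.
Proof.
have mlin n' (B : 'I_n' -> 'I_m -> R) (y : m.-tuple R) : measurable_fun setT
    (fun t : n'.-tuple R =>
      [tuple (tnth y k + \sum_(i < n') B i k * tnth t i)%R | k < m]).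
  apply/measurable_fun_tnthP => k.
  rewrite (_ : _ \o _ = fun t => tnth y k + \sum_(i < n') B i k * tnth t i)%R;
    last by apply/funext => t /=; rewrite tnth_mktuple.
  apply: measurable_funD; first exact: measurable_cst.
  apply: measurable_sum => i; apply: measurable_funM; first exact: measurable_cst.
  exact: measurable_tnth.
elim: n A x => [|n IH] A x gf.
  rewrite iid0; last exact: (measurableT_comp gf.1 (mlin _ _ _)).
  rewrite (size0nil (size_enum_ord 0)) /=; congr f.
  by apply/eq_from_tnth => k; rewrite tnth_mktuple big_ord0 addr0.
rewrite iidS; last 2 first.
- exact: (measurableT_comp gf.1 (mlin _ _ _)).
- by move=> t; exact: gf.2.
rewrite enum_ordSl /= -map_comp; apply: eq_integral => z _.
rewrite -(IH (fun i => A (lift ord0 i)))//; apply: eq_integral => t _; congr f.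
apply/eq_from_tnth => k; rewrite !tnth_mktuple big_ord_recl addrA mulrC.
by congr (_ + _)%R; apply: eq_bigr => i _; rewrite tnthS.
Qed.

Lemma iid_orthonormal n (O : 'I_m -> 'I_n -> R) f : good f ->
  (forall k l, \sum_(i < n) O k i * O l i = (k == l)%:R)%R ->
  \int[iid gam n]_t f [tuple (\sum_(i < n) O k i * tnth t i)%R | k < m] =
  \int[iid gam m]_t f t.
Proof.
move=> gf OO; pose o : m.-tuple R := [tuple 0%R | k < m].
transitivity (smears [seq (fun k => O k i) | i <- enum 'I_n] f o).
  rewrite -iid_smears//; apply: eq_integral => t _; congr f.
  by apply/eq_from_tnth => k; rewrite !tnth_mktuple add0r.
rewrite (@smears_orthonormal m)//; last first.
  move=> i j; rewrite subnn andbT /gram big_map big_enum -OO.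
  by apply: eq_bigr => l _.
rewrite subnn filter_predT -iid_smears//; apply: eq_integral => t _; congr f.
apply/eq_from_tnth => k; rewrite !tnth_mktuple add0r (bigD1 k)//=.
rewrite /unitcol eqxx mul1r big1 ?addr0// => i ik.
by rewrite eq_sym (negbTE ik) mul0r.
Qed.

End Columns.

(** * Equicorrelated Gaussian vectors *)

Section Canonical.
Context (R : realType) (rho : R).
Hypothesis rho0 : 0 <= rho.
Hypothesis rho1 : rho < 1.
Local Notation gam := (gam R).

Definition regcoef (k : nat) : R := rho / (1 + (k%:R - 1) * rho).
Definition resid (k : nat) : R := Num.sqrt (1 - k%:R * rho * regcoef k).

(** Partial sums of the vector defined by [equicorr]; [regcoef k] is the
    regression coefficient of an equicorrelated [x_k] on the sum of its [k]
    predecessors and [resid k] the residual standard deviation. *)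
Fixpoint psum (b : nat -> R) (k : nat) : R :=
  if k is k'.+1 then psum b k' + (regcoef k' * psum b k' + resid k' * b k') else 0.
Definition equicorr (b : nat -> R) (k : nat) : R :=
  regcoef k * psum b k + resid k * b k.

Definition psum_sd (k : nat) : R := Num.sqrt (k%:R * (1 + (k%:R - 1) * rho)).
Definition pcorr (k : nat) : R := regcoef k * psum_sd k.

Lemma regden_gt0 k : 0 < 1 + (k%:R - 1) * rho.
Proof.
case: k => [|k]; first by rewrite sub0r mulN1r subr_gt0.
by rewrite -natr1 addrK ltr_wpDr// mulr_ge0// ler0n.
Qed.

Lemma resid_gt0_subproof k : 0 < 1 - k%:R * rho * regcoef k.
Proof.
have d0 := regden_gt0 k.
rewrite /regcoef (_ : _ - _ = (1 - rho) * (1 + k%:R * rho) / (1 + (k%:R - 1) * rho)).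
  by rewrite divr_gt0// mulr_gt0 ?subr_gt0// ltr_wpDr// mulr_ge0// ler0n.
by field; rewrite gt_eqF.
Qed.

Lemma resid_gt0 k : 0 < resid k.
Proof. by rewrite sqrtr_gt0 resid_gt0_subproof. Qed.

Lemma sqr_resid k : resid k ^+ 2 = 1 - k%:R * rho * regcoef k.
Proof. by rewrite sqr_sqrtr// ltW// resid_gt0_subproof. Qed.

Lemma sqr_psum_sd k : psum_sd k ^+ 2 = k%:R * (1 + (k%:R - 1) * rho).
Proof. by rewrite sqr_sqrtr// mulr_ge0 ?ler0n// ltW// regden_gt0. Qed.

Lemma psum_sd_gt0 k : 0 < psum_sd k.+1.
Proof. by rewrite sqrtr_gt0 mulr_gt0 ?ltr0n// regden_gt0. Qed.

Lemma sqr_pcorr k : pcorr k ^+ 2 = k%:R * rho * regcoef k.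
Proof.
rewrite exprMn sqr_psum_sd /regcoef; field.
by rewrite gt_eqF// regden_gt0.
Qed.

Lemma pcorr_resid k : resid k ^+ 2 + pcorr k ^+ 2 = 1.
Proof. by rewrite sqr_resid sqr_pcorr subrK. Qed.

Lemma regcoef_ge0 k : 0 <= regcoef k.
Proof. by rewrite divr_ge0// ltW// regden_gt0. Qed.

Lemma pcorr_ge0 k : 0 <= pcorr k.
Proof. by rewrite mulr_ge0 ?regcoef_ge0 ?sqrtr_ge0. Qed.

Lemma sqr_pcorr_le k : pcorr k ^+ 2 <= k%:R * rho ^+ 2.
Proof.
rewrite sqr_pcorr; case: k => [|k]; first by rewrite !mul0r.
rewrite -mulrA ler_wpM2l// expr2 ler_wpM2l// /regcoef.
rewrite ler_pdivrMr ?regden_gt0// ler_peMr//.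
by rewrite -natr1 addrK lerDl mulr_ge0.
Qed.

Lemma psum_step k : ((1 + regcoef k) * psum_sd k) ^+ 2 + resid k ^+ 2 =
  psum_sd k.+1 ^+ 2.
Proof.
rewrite sqr_resid exprMn !sqr_psum_sd /regcoef -natr1; field.
by rewrite gt_eqF// regden_gt0.
Qed.

Lemma eq_psum b b' k : (forall j, (j < k)%N -> b j = b' j) -> psum b k = psum b' k.
Proof.
elim: k => //= k IH bb'; rewrite IH; first by rewrite bb'.
by move=> j jk; apply: bb'; rewrite ltnS ltnW.
Qed.

(** The map [b |-> equicorr b] is onto: each [b k] is recovered as a
    normalised regression residual. *)
Lemma equicorr_onto (y b : nat -> R) n :
  (forall k, (k < n)%N -> b k = (y k - regcoef k * \sum_(j < k) y j) / resid k) ->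
  forall k, (k < n)%N -> equicorr b k = y k.
Proof.
move=> bE.
have psumE k : (k <= n)%N -> psum b k = \sum_(j < k) y j.
  elim: k => [|k IH] kn; first by rewrite big_ord0.
  rewrite /= IH ?(ltnW kn)// big_ord_recr bE//=; congr (_ + _).
  by rewrite mulrCA divff ?gt_eqF ?resid_gt0// mulr1 addrC subrK.
move=> k kn; rewrite /equicorr psumE ?(ltnW kn)// bE//.
by rewrite mulrCA divff ?gt_eqF ?resid_gt0// mulr1 addrC subrK.
Qed.

Section Vector.
Context (m : nat).
Implicit Types b : m.-tuple R.
Local Notation crd b := (nth 0 (tval b)).

Definition equicorr_vec b : m.-tuple R := [tuple equicorr (crd b) k | k < m].

Lemma measurable_nth k : measurable_fun setT (fun b => crd b k).
Proof.
have [km|mk] := ltnP k m.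
  rewrite (_ : (fun b => _) = fun b => tnth b (Ordinal km)).
    exact: measurable_tnth.
  by apply/funext => b; rewrite (tnth_nth 0).
rewrite (_ : (fun b => _) = fun=> 0); first exact: measurable_cst.
by apply/funext => b; rewrite nth_default// size_tuple.
Qed.

Lemma measurable_psum k : measurable_fun setT (fun b => psum (crd b) k).
Proof.
elim: k => [|k IH] /=; first exact: measurable_cst.
apply: measurable_funD => //; apply: measurable_funD; apply: measurable_funM => //;
  try exact: measurable_cst.
exact: measurable_nth.
Qed.

Lemma measurable_equicorr k : measurable_fun setT (fun b => equicorr (crd b) k).
Proof.
apply: measurable_funD; apply: measurable_funM; try exact: measurable_cst.
- exact: measurable_psum.
- exact: measurable_nth.
Qed.

Lemma measurable_equicorr_vec : measurable_fun setT equicorr_vec.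
Proof.
apply/measurable_fun_tnthP => k.
rewrite (_ : _ \o _ = fun b => equicorr (crd b) k); first exact: measurable_equicorr.
by apply/funext => b /=; rewrite tnth_mktuple.
Qed.

Lemma nth_upd b (i : 'I_m) x j :
  crd (upd b i x) j = if j == i then x else crd b j.
Proof.
have [jm|mj] := ltnP j m.
  have := tnth_upd b i x (Ordinal jm).
  by rewrite !(tnth_nth 0) /= -val_eqE.
rewrite !nth_default ?size_tuple//.
by case: eqP => // ji; have := ltn_ord i; rewrite -ji ltnNge mj.
Qed.

Lemma psum_upd b (i : 'I_m) x k : (k <= i)%N ->
  psum (crd (upd b i x)) k = psum (crd b) k.
Proof.
move=> ki; apply: eq_psum => j jk; rewrite nth_upd.
by rewrite ltn_eqF// (leq_trans jk).
Qed.

Lemma gam_mix (u v : R) (f : R -> \bar R) : u ^+ 2 + v ^+ 2 = 1 ->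
  measurable_fun setT f -> (forall x, 0 <= f x)%E ->
  (\int[gam]_x \int[gam]_y f (u * x + v * y)%R = \int[gam]_x f x)%E.
Proof.
move=> uv mf f0.
have := @gam_rotation R u (- v) (fun p => f p.1).
rewrite sqrrN => /(_ uv) H.
transitivity (\int[gam]_x \int[gam]_y f x)%E; last first.
  by apply: eq_integral => x _; rewrite integral_cst//= probability_setT mule1.
rewrite -H//; last exact: (measurableT_comp mf measurable_fst).
by apply: eq_integral => x _; apply: eq_integral => y _; rewrite /= mulNr opprK.
Qed.

Lemma psum_law k (f : R -> \bar R) : (k < m)%N ->
  measurable_fun setT f -> (forall x, 0 <= f x)%E ->
  (\int[iid gam m]_b f (psum (crd b) k.+1 / psum_sd k.+1)%R = \int[gam]_x f x)%E.
Proof.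
elim: k f => [|k IH] f km mf f0.
  rewrite -(iid_coord gam (Ordinal km) mf f0); apply: eq_integral => b _.
  congr f; rewrite /= mulr0 !add0r (tnth_nth 0) /resid /psum_sd /=.
  by rewrite !mul0r subrr mul0r addr0 subr0 mulr1 !sqrtr1 mul1r divr1.
have mfs : measurable_fun setT
    (fun b => f (psum (crd b) k.+2 / psum_sd k.+2)%R).
  apply: (measurableT_comp mf); apply: measurable_funM; last exact: measurable_cst.
  exact: measurable_psum.
rewrite (iid_resample _ (Ordinal km))//.
pose u := (1 + regcoef k.+1) * psum_sd k.+1 / psum_sd k.+2.
pose v := resid k.+1 / psum_sd k.+2.
have uv : u ^+ 2 + v ^+ 2 = 1.
  rewrite /u /v !expr_div_n -mulrDl psum_step divff//.
  by rewrite sqrf_eq0 gt_eqF ?psum_sd_gt0.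
have mix : measurable_fun setT (fun p : R * R => f (u * p.1 + v * p.2)).
  apply: (measurableT_comp mf); apply: measurable_funD; apply: measurable_funM => //;
    exact: measurable_cst.
transitivity (\int[iid gam m]_b \int[gam]_x
    f (u * (psum (crd b) k.+1 / psum_sd k.+1) + v * x)%R)%E.
  apply: eq_integral => b _; apply: eq_integral => x _; congr f.
  rewrite [psum _ k.+2]/= -[psum _ _ + _]/(psum _ k.+1) psum_upd//.
  rewrite nth_upd eqxx /u /v; field.
  by rewrite !gt_eqF ?psum_sd_gt0.
rewrite (IH (fun s => \int[gam]_x f (u * s + v * x)%R)%E) ?(ltnW km)//.
- exact: gam_mix.
- exact: (measurable_fun_fubini_tonelli_F (fun p : R * R => f (u * p.1 + v * p.2)%R)).
- by move=> x; exact: integral_ge0.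
Qed.

Lemma equicorr_law (k : 'I_m) (f : R -> \bar R) :
  measurable_fun setT f -> (forall x, 0 <= f x)%E ->
  (\int[iid gam m]_b f (equicorr (crd b) k) = \int[gam]_x f x)%E.
Proof.
move=> mf f0; case: k => -[|k] km /=.
  rewrite -(iid_coord gam (Ordinal km) mf f0); apply: eq_integral => b _.
  congr f; rewrite /equicorr /= mulr0 add0r (tnth_nth 0) /resid /=.
  by rewrite !mul0r subr0 sqrtr1 mul1r.
rewrite (iid_resample _ (Ordinal km))//; last first.
  by apply: (measurableT_comp mf); exact: measurable_equicorr.
have mix : measurable_fun setT
    (fun p : R * R => f (pcorr k.+1 * p.1 + resid k.+1 * p.2)).
  apply: (measurableT_comp mf); apply: measurable_funD; apply: measurable_funM => //;
    exact: measurable_cst.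
transitivity (\int[iid gam m]_b \int[gam]_x
    f (pcorr k.+1 * (psum (crd b) k.+1 / psum_sd k.+1) + resid k.+1 * x)%R)%E.
  apply: eq_integral => b _; apply: eq_integral => x _; congr f.
  rewrite /equicorr psum_upd// nth_upd eqxx /pcorr; congr (_ + _).
  by field; rewrite gt_eqF ?psum_sd_gt0.
rewrite (psum_law (f := fun s => \int[gam]_x f (pcorr k.+1 * s + resid k.+1 * x)%R)%E) ?(ltnW km)//.
- by apply: gam_mix => //; rewrite addrC pcorr_resid.
- exact: (measurable_fun_fubini_tonelli_F
    (fun p : R * R => f (pcorr k.+1 * p.1 + resid k.+1 * p.2)%R)).
- by move=> x; exact: integral_ge0.
Qed.

Definition equicorr_cov (k l : nat) : R := if k == l then 1 else rho.

Lemma sum_equicorr_cov (k l : 'I_m) :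
  \sum_(j < k) equicorr_cov j l = k%:R * rho + (l < k)%:R * (1 - rho).
Proof.
have -> : \sum_(j < k) equicorr_cov j l =
    \sum_(j < k) (rho + (j == l :> nat)%:R * (1 - rho)).
  apply: eq_bigr => j _; rewrite /equicorr_cov; case: eqP => _.
    by rewrite mul1r addrC subrK.
  by rewrite mul0r addr0.
rewrite big_split /= sumr_const card_ord -mulr_suml mulr_natl; congr (_ + _ * _).
have [lk|kl] := ltnP l k.
  rewrite (bigD1 (Ordinal lk))//= eqxx big1 ?addr0// => j.
  by rewrite -val_eqE /= => /negbTE ->.
rewrite big1// => j _; rewrite (_ : (j == l :> nat) = false)//.
by apply/negbTE; rewrite neq_ltn (leq_trans (ltn_ord j) kl).
Qed.

Lemma whitening n (A : 'I_m -> 'I_n -> R) :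
  (forall k l, \sum_i A k i * A l i = equicorr_cov k l) ->
  forall k l : 'I_m,
  \sum_i ((A k i - regcoef k * \sum_(j < m | (j < k)%N) A j i) / resid k) *
    ((A l i - regcoef l * \sum_(j < m | (j < l)%N) A j i) / resid l) = (k == l)%:R.
Proof.
move=> AA.
pose W (k : 'I_m) i := (A k i - regcoef k * \sum_(j < m | (j < k)%N) A j i) / resid k.
have sumE (k : 'I_m) (F : nat -> R) :
    \sum_(j < m | (j < k)%N) F j = \sum_(j < k) F j.
  by rewrite (big_ord_widen m F (ltnW (ltn_ord k))).
have WE (l : 'I_m) (B : 'I_n -> R) : \sum_i B i * W l i =
    (\sum_i B i * A l i -
     regcoef l * \sum_(j < m | (j < l)%N) \sum_i B i * A j i) / resid l.
  rewrite exchange_big /= mulr_sumr -sumrB mulr_suml; apply: eq_bigr => i _.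
  by rewrite /W -mulr_sumr; field; rewrite gt_eqF ?resid_gt0.
have WA (k l : 'I_m) : (l <= k)%N -> \sum_i W k i * A l i = (k == l)%:R * resid k.
  move=> lk.
  under eq_bigr do rewrite mulrC.
  rewrite WE// AA.
  under [X in regcoef k * X]eq_bigr do (under eq_bigr do rewrite mulrC; rewrite AA).
  rewrite (sumE k (fun j => equicorr_cov j l)) sum_equicorr_cov.
  have d0 := regden_gt0 k.
  move: lk; rewrite leq_eqVlt => /orP[/eqP/val_inj ->|lk].
    rewrite ltnn mul0r addr0 /equicorr_cov !eqxx mul1r.
    apply: (mulIf (x := resid k)); first by rewrite gt_eqF ?resid_gt0.
    rewrite mulfVK ?gt_eqF ?resid_gt0// -expr2 sqr_resid; ring.
  have -> : (k == l) = false by apply/negbTE; rewrite -val_eqE neq_ltn lk orbT.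
  rewrite mul0r lk mul1r /equicorr_cov ltn_eqF// /regcoef.
  apply/eqP; rewrite mulf_eq0; apply/orP; left; apply/eqP; field.
  by rewrite gt_eqF.
have main (k l : 'I_m) : (l <= k)%N -> \sum_i W k i * W l i = (k == l)%:R.
  move=> lk; rewrite WE// WA// big1 => [|j jl].
    rewrite mulr0 subr0; have [->|_] := eqVneq k l; last by rewrite !mul0r.
    by rewrite mul1r divff// gt_eqF ?resid_gt0.
  rewrite WA; last by rewrite (leq_trans (ltnW jl)).
  by rewrite -val_eqE gtn_eqF ?mul0r// (leq_trans jl).
move=> k l; have [lk|/ltnW kl] := leqP l k; first exact: main.
by rewrite eq_sym -(main _ _ kl); apply: eq_bigr => i _; rewrite mulrC.
Qed.

End Vector.

(** Whitening by regression residuals turns a centred Gaussian vector with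
    this covariance into a standard one, and [equicorr_vec] undoes it. *)
Lemma gaussian_equicorr m d (Omega : measurableType d) (mu : probability Omega R)
    (Y : Omega -> m.-tuple R) :
  measurable_fun setT Y -> jointly_gaussian mu Y ->
  (forall k, 'E_mu[fun w => tnth (Y w) k] = 0)%E ->
  (forall k, 'V_mu[fun w => tnth (Y w) k] = 1)%E ->
  (forall k l, k != l ->
    covariance mu (fun w => tnth (Y w) k) (fun w => tnth (Y w) l) = rho%:E) ->
  forall B, measurable B ->
    mu (Y @^-1` B) = iid gam m (@equicorr_vec m @^-1` B).
Proof.
move=> mY [d0 [Om [nu [n [Z [A [b0 [[Zn Zi] YE]]]]]]]] EY VY covY.
pose aff (t : n.-tuple R) : m.-tuple R :=
  [tuple \sum_(i < n) A k i * tnth t i + b0 k | k < m].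
have maff : measurable_fun setT aff.
  apply/measurable_fun_tnthP => k.
  rewrite (_ : _ \o _ = fun t : n.-tuple R => \sum_(i < n) A k i * tnth t i + b0 k);
    last by apply/funext => t /=; rewrite tnth_mktuple.
  apply: measurable_funD; last exact: measurable_cst.
  apply: measurable_sum => i; apply: measurable_funM; first exact: measurable_cst.
  exact: measurable_tnth.
pose Zt w := [tuple Z i w | i < n].
have mZt : measurable_fun setT Zt.
  apply/measurable_fun_tnthP => k.
  rewrite (_ : _ \o _ = Z k); first exact: measurable_funP.
  by apply/funext => t /=; rewrite tnth_mktuple.
have lawZ : has_law nu Zt (iid gam n).
  apply: has_law_iid => // B mB.
  transitivity (nu (\bigcap_(i in [set` [set: 'I_n]%SET]) (Z i @^-1` B i))).
    congr (nu _); apply/seteqP; split => w /=.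
      by move=> Bw i _; have := Bw i; rewrite tnth_mktuple.
    by move=> Bw i; rewrite tnth_mktuple; apply: Bw; rewrite /= inE.
  rewrite Zi//; apply: eq_big => [i|i _]; first by rewrite inE.
  exact: Zn.
have lawY B : measurable B -> mu (Y @^-1` B) = iid gam n (aff @^-1` B).
  move=> mB; rewrite YE// -(lawZ.2 (aff @^-1` B)); last first.
    by rewrite -[X in measurable X]setTI; exact: maff.
  congr (nu _); apply/seteqP; split => w /=; congr (B _);
    apply/eq_from_tnth => k; rewrite !tnth_mktuple; congr (_ + _);
    by apply: eq_bigr => i _; rewrite tnth_mktuple.
pose affm : {mfun n.-tuple R >-> m.-tuple R} :=
  HB.pack aff (isMeasurableFun.Build _ _ _ _ _ maff).
pose lam := distribution (iid gam n) affm.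
have YI (g : m.-tuple R -> \bar R) : measurable_fun setT g ->
    (\int[mu]_w g (Y w) = \int[iid gam n]_t g (aff t))%E.
  move=> mg; transitivity (\int[lam]_y g y)%E.
    by apply: (has_law_integral (nu := lam)) => //; split => // B mB; exact: lawY.
  apply/esym; apply: (has_law_integral (P := iid gam n) (nu := lam)) => //.
have mtn k : measurable_fun setT (fun y : m.-tuple R => (tnth y k)%:E).
  by apply/measurable_EFinP; exact: measurable_tnth.
have b00 k : b0 k = 0.
  have := EY k; rewrite unlock (YI (fun y => (tnth y k)%:E))//.
  under eq_integral do rewrite tnth_mktuple.
  by rewrite iid_gam_lin => -[].
have AA (k l : 'I_m) : \sum_i A k i * A l i = equicorr_cov k l.
  have covE : covariance mu (fun w => tnth (Y w) k) (fun w => tnth (Y w) l) =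
      (\sum_i A k i * A l i)%:E.
    rewrite unlock !EY/= unlock.
    rewrite (YI (fun y => (((tnth y k - 0) * (tnth y l - 0))%R)%:E)).
      under eq_integral do rewrite !tnth_mktuple !b00 !addr0 !subr0.
      exact: iid_gam_bilin.
    apply/measurable_EFinP; apply: measurable_funM; apply: measurable_funB;
      by [exact: measurable_tnth|exact: measurable_cst].
  rewrite /equicorr_cov; have [/val_inj kl|kl] := eqVneq (k : nat) l.
    by subst l; have := VY k; rewrite /variance covE => -[].
  by have := covY k l kl; rewrite covE => -[].
pose O (k : 'I_m) (i : 'I_n) :=
  (A k i - regcoef k * \sum_(j < m | (j < k)%N) A j i) / resid k.
have OO : forall k l, \sum_i O k i * O l i = (k == l)%:R by exact: whitening.
pose Ot (t : n.-tuple R) : m.-tuple R := [tuple \sum_(i < n) O k i * tnth t i | k < m].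
have affE t : aff t = equicorr_vec (Ot t).
  apply/eq_from_tnth => k; rewrite !tnth_mktuple b00 addr0.
  pose y j := nth 0 (tval (aff t)) j.
  have yE (j : 'I_m) : y j = \sum_(i < n) A j i * tnth t i.
    by rewrite /y -(tnth_nth 0) tnth_mktuple b00 addr0.
  rewrite -yE; apply/esym; apply: (equicorr_onto (n := m)) => // j jm.
  rewrite -[nth _ _ _](tnth_nth 0 (Ot t) (Ordinal jm)) tnth_mktuple.
  have -> : \sum_(l < j) y l = \sum_(l < m | (l < j)%N) \sum_(i < n) A l i * tnth t i.
    rewrite (big_ord_widen m y (ltnW jm)); apply: eq_bigr => l _; exact: yE.
  rewrite (yE (Ordinal jm)) exchange_big /= mulr_sumr -sumrB mulr_suml.
  apply: eq_bigr => i _; rewrite /O -mulr_suml; field.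
  by rewrite gt_eqF ?resid_gt0.
move=> B mB; rewrite lawY//.
have good_ind : good (fun y : m.-tuple R => (\1_B (equicorr_vec y))%:E).
  split; last by move=> y; rewrite lee_fin.
  apply: (measurableT_comp (f := fun y => (\1_B y)%:E)).
    exact/measurable_EFinP/measurable_indic.
  exact: measurable_equicorr_vec.
have maffB : measurable (aff @^-1` B).
  by have := maff measurableT B mB; rewrite setTI.
have meqB : measurable (@equicorr_vec m @^-1` B).
  by rewrite -[X in measurable X]setTI; exact: measurable_equicorr_vec.
have -> : iid gam n (aff @^-1` B) = (\int[iid gam n]_t (\1_B (aff t))%:E)%E.
  transitivity (\int[iid gam n]_t (\1_(aff @^-1` B) t)%:E)%E; last by [].
  by rewrite integral_indic// setIT.
have -> : iid gam m (@equicorr_vec m @^-1` B) =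
    (\int[iid gam m]_t (\1_B (equicorr_vec t))%:E)%E.
  transitivity (\int[iid gam m]_t (\1_(@equicorr_vec m @^-1` B) t)%:E)%E; last by [].
  by rewrite integral_indic// setIT.
rewrite -(iid_orthonormal good_ind OO); apply: eq_integral => t _.
by rewrite affE.
Qed.

End Canonical.

(** * Edges and their relabelling *)

Section Edges.
Context (n : nat).
Implicit Types (i j : 'I_n) (s t : 'S_n).

Definition sort_pair i j : 'I_n * 'I_n := if (i < j)%N then (i, j) else (j, i).

Lemma sort_pair_lt i j : i != j -> ((sort_pair i j).1 < (sort_pair i j).2)%N.
Proof.
rewrite /sort_pair; case: (ltngtP i j) => //= ij.
by rewrite (val_inj ij) eqxx.
Qed.

Lemma edge_neq s (e : edge n) : s (val e).1 != s (val e).2.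
Proof.
rewrite (inj_eq perm_inj); apply/eqP => e12.
by have := valP e; rewrite e12 ltnn.
Qed.

Definition eact s (e : edge n) : edge n :=
  Sub (sort_pair (s (val e).1) (s (val e).2)) (sort_pair_lt (edge_neq s e)).

Definition ends (e : edge n) : {set 'I_n} := [set (val e).1; (val e).2]%SET.

Lemma ends_sort_pair i j : ([set (sort_pair i j).1; (sort_pair i j).2] = [set i; j])%SET.
Proof. by rewrite /sort_pair; case: ifP => //= _; rewrite finset.setUC. Qed.

Lemma ends_eact s e : ends (eact s e) = (s @: ends e)%SET.
Proof. by rewrite /ends /eact SubK ends_sort_pair imsetU1 imset_set1. Qed.

Lemma ends_inj : injective ends.
Proof.
move=> e f ef; apply: val_inj.
have := valP e; have := valP f; move: ef; rewrite /ends.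
case: (val e) => i j; case: (val f) => k l /= ef kl ij.
have : i \in [set k; l]%SET by rewrite -ef set21.
have : j \in [set k; l]%SET by rewrite -ef set22.
rewrite !inE => /orP[] /eqP jE /orP[] /eqP iE; subst.
- by rewrite ltnn in ij.
- by have := ltn_trans ij kl; rewrite ltnn.
- by [].
- by rewrite ltnn in ij.
Qed.

Definition nedge := #|{: edge n}|.
Definition vs (e : 'I_nedge) : {set 'I_n} := ends (enum_val e).

Lemma vs_inj : injective vs.
Proof. by move=> e f /ends_inj/enum_val_inj. Qed.

Definition eperm_fun s (e : 'I_nedge) : 'I_nedge := enum_rank (eact s (enum_val e)).

Lemma vs_eperm_fun s e : vs (eperm_fun s e) = (s @: vs e)%SET.
Proof. by rewrite /vs /eperm_fun enum_rankK ends_eact. Qed.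

Lemma eperm_inj s : injective (eperm_fun s).
Proof.
move=> e f /(congr1 vs); rewrite !vs_eperm_fun => /(imset_inj (@perm_inj _ s)).
exact: vs_inj.
Qed.

(** The permutation of edges induced by a permutation of vertices. *)
Definition eperm s : {perm 'I_nedge} := perm (@eperm_inj s).

Lemma vs_eperm s e : vs (eperm s e) = (s @: vs e)%SET.
Proof. by rewrite permE vs_eperm_fun. Qed.

Lemma epermM s t : eperm (s * t)%g = (eperm s * eperm t)%g.
Proof.
apply/permP => e; apply: vs_inj; rewrite permM !vs_eperm -imset_comp.
by apply: eq_imset => i /=; rewrite permM.
Qed.

Lemma eperm1 : eperm 1%g = 1%g.
Proof.
apply/permP => e; apply: vs_inj; rewrite perm1 vs_eperm.
by rewrite -[RHS]imset_id; apply: eq_imset => i; rewrite perm1.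
Qed.

Lemma epermV s : eperm s^-1%g = (eperm s)^-1%g.
Proof. by apply/esym/eqP; rewrite eq_invg_mul -epermM mulgV eperm1. Qed.

Lemma card_vs e : #|vs e| = 2%N.
Proof.
rewrite cards2; congr (_.+1); apply/eqP; rewrite eqb1.
by apply/eqP => e12; have := valP (enum_val e); rewrite e12 ltnn.
Qed.

Lemma card_edges_in (S : {set 'I_n}) :
  #|[set e | vs e \subset S]%SET| = 'C(#|S|, 2).
Proof.
rewrite -cards_draws -(card_imset _ vs_inj); congr #|pred_of_set _|.
apply/setP => A; rewrite inE; apply/imsetP/andP => [[e]|[AS]].
  by rewrite inE => eS ->; rewrite eS card_vs.
move=> /cards2P[i [j [ij AE]]].
pose e : edge n := Sub (sort_pair i j) (sort_pair_lt ij).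
have eA : vs (enum_rank e) = A by rewrite /vs enum_rankK /ends SubK ends_sort_pair.
by exists (enum_rank e); rewrite ?inE eA.
Qed.

End Edges.

(** * Independent rows and columns *)

Section IidMore.
Context (R : realType).
Local Notation gam := (gam R).
Local Open Scope ereal_scope.

Definition relabel (T : Type) N (p : {perm 'I_N}) (b : N.-tuple T) : N.-tuple T :=
  [tuple tnth b ((p^-1)%g e) | e < N].

Lemma tnth_relabel (T : Type) N (p : {perm 'I_N}) (b : N.-tuple T) e :
  tnth (relabel p b) (p e) = tnth b e.
Proof. by rewrite tnth_mktuple permK. Qed.

Lemma measurable_relabel d (T : measurableType d) N (p : {perm 'I_N}) :
  measurable_fun setT (@relabel T N p).
Proof.
apply/measurable_fun_tnthP => e.
rewrite (_ : _ \o _ = fun b => tnth b ((p^-1)%g e)); first exact: measurable_tnth.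
by apply/funext => b /=; rewrite tnth_mktuple.
Qed.

Lemma iid_relabel d (T : measurableType d) (mu : probability T R) N
    (p : {perm 'I_N}) : has_law (iid mu N) (relabel p) (iid mu N).
Proof.
apply: has_law_iid; first exact: measurable_relabel.
move=> B mB; rewrite (_ : _ @^-1` _ = rectangle (fun e => B (p e))); last first.
  apply/seteqP; split => b /= Bb e; first by rewrite -(tnth_relabel p); exact: Bb.
  by have := Bb ((p^-1)%g e); rewrite tnth_mktuple permKV.
by rewrite iid_rectangle// [RHS](reindex_inj (@perm_inj _ p)).
Qed.

Lemma measurable_eprod d (T : measurableType d) (I : Type) (s : seq I)
    (f : I -> T -> \bar R) : (forall i, measurable_fun setT (f i)) ->
  measurable_fun setT (fun t => \prod_(i <- s) f i t).
Proof.
move=> mf; elim: s => [|i s IH].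
  by under eq_fun do rewrite big_nil; exact: measurable_cst.
by under eq_fun do rewrite big_cons; exact: emeasurable_funM.
Qed.

Lemma eprod_ge0 (I : Type) (s : seq I) (f : I -> \bar R) :
  (forall i, 0 <= f i) -> 0 <= \prod_(i <- s) f i.
Proof. by move=> f0; elim/big_ind : _ => // x y; exact: mule_ge0. Qed.

(** Given one graph, a correlated one has the product of the Mehler kernels of its
    edges as density; this is [mehler_shift], one edge at a time. *)
Lemma mehler_shift_tuple (r q : R) N (s : N.-tuple R) (g : N.-tuple R -> \bar R) :
  (0 < q)%R -> (q ^+ 2 + r ^+ 2 = 1)%R ->
  measurable_fun setT g -> (forall t, 0 <= g t) ->
  \int[iid gam N]_c g [tuple (r * tnth s e + q * tnth c e)%R | e < N] =
  \int[iid gam N]_c (g c * \prod_(e < N) (mehler r (tnth s e) (tnth c e))%:E).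
Proof.
move=> q0 qr; elim: N s g => [|N IH] s g mg g0.
  rewrite !iid0; last 2 first.
  - apply: emeasurable_funM => //.
    by under eq_fun do rewrite big_ord0; exact: measurable_cst.
  - apply: (measurableT_comp mg); apply/measurable_fun_tnthP => -[] //.
  rewrite big_ord0 mule1; congr g; exact: tuple0.
have mch N' (s' : N'.-tuple R) : measurable_fun setT
    (fun c => [tuple (r * tnth s' e + q * tnth c e)%R | e < N']).
  apply/measurable_fun_tnthP => e.
  rewrite (_ : _ \o _ = fun c => r * tnth s' e + q * tnth c e)%R; last first.
    by apply/funext => c /=; rewrite tnth_mktuple.
  apply: measurable_funD; first exact: measurable_cst.
  by apply: measurable_funM; [exact: measurable_cst|exact: measurable_tnth].
have mprod N' (s' : N'.-tuple R) : measurable_fun setT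
    (fun c => \prod_(e < N') (mehler r (tnth s' e) (tnth c e))%:E).
  apply: measurable_eprod => e; apply/measurable_EFinP; apply: measurable_mehler.
    exact: measurable_cst.
  exact: measurable_tnth.
have prod0 N' (s' c : N'.-tuple R) :
    0 <= \prod_(e < N') (mehler r (tnth s' e) (tnth c e))%:E.
  by apply: eprod_ge0 => e; rewrite lee_fin mehler_ge0.
pose s1 : N.-tuple R := [tuple tnth s (lift ord0 e) | e < N].
rewrite !iidS; last 4 first.
- by apply: emeasurable_funM => //; exact: mprod.
- by move=> t; rewrite mule_ge0.
- exact: (measurableT_comp mg (mch _ s)).
- by move=> t; exact: g0.
pose Phi x := \int[iid gam N]_t (g (tcons (x, t)) *
   \prod_(e < N) (mehler r (tnth s1 e) (tnth t e))%:E).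
have mPhi0 : measurable_fun setT (fun p : R * N.-tuple R => g (tcons p) *
    \prod_(e < N) (mehler r (tnth s1 e) (tnth p.2 e))%:E).
  apply: emeasurable_funM; first exact: (measurableT_comp mg (@measurable_tcons _ _ N)).
  exact: (measurableT_comp (mprod N s1) measurable_snd).
have mPhi : measurable_fun setT Phi.
  apply: (measurable_fun_fubini_tonelli_F _ mPhi0).
  by move=> p; rewrite mule_ge0.
have Phi0 x : 0 <= Phi x by apply: integral_ge0 => t _; rewrite mule_ge0.
transitivity (\int[gam]_x Phi (r * tnth s ord0 + q * x)%R).
  apply: eq_integral => x _; rewrite /Phi.
  rewrite -(IH s1 (fun t => g (tcons ((r * tnth s ord0 + q * x)%R, t))))//.
    apply: eq_integral => t _; congr g; apply/eq_from_tnth => e.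
    rewrite tnth_mktuple; case: (unliftP ord0 e) => [f ->|->] //=.
    by rewrite !tnthS tnth_mktuple tnth_mktuple.
  exact: (measurableT_comp mg (measurable_tcons2 _)).
rewrite mehler_shift_pos//; apply: eq_integral => x _.
rewrite muleC /Phi -ge0_integralZl//.
- apply: eq_integral => t _; rewrite muleCA; congr (_ * _).
  rewrite big_ord_recl; congr (_ * _); apply: eq_bigr => e _.
  by rewrite tnth_mktuple tnthS.
- exact: (measurableT_comp mPhi0 (pair1_measurable x)).
- by move=> t _; rewrite mule_ge0.
- by rewrite lee_fin mehler_ge0.
Qed.

Definition slice (T : Type) m N (b : m.-tuple (N.-tuple T)) (e : 'I_N) : m.-tuple T :=
  [tuple tnth (tnth b k) e | k < m].

Lemma measurable_slice d (T : measurableType d) m N (e : 'I_N) :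
  measurable_fun setT (fun b : m.-tuple (N.-tuple T) => slice b e).
Proof.
apply/measurable_fun_tnthP => k.
rewrite (_ : _ \o _ = fun b => tnth (tnth b k) e); last first.
  by apply/funext => b /=; rewrite tnth_mktuple.
exact: (measurableT_comp (measurable_tnth e) (measurable_tnth k)).
Qed.

Lemma iid_slices_prod d (T : measurableType d) (mu : probability T R) m N
    (phi : 'I_N -> m.-tuple T -> \bar R) :
  (forall e, measurable_fun setT (phi e)) -> (forall e t, 0 <= phi e t) ->
  \int[iid (iid mu N) m]_b \prod_(e < N) phi e (slice b e) =
  \prod_(e < N) \int[iid mu m]_t phi e t.
Proof.
have mprod m' (psi : 'I_N -> m'.-tuple T -> \bar R) :
    (forall e, measurable_fun setT (psi e)) ->
    measurable_fun setT (fun b => \prod_(e < N) psi e (slice b e)).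
  move=> mpsi; apply: measurable_eprod => e.
  exact: (measurableT_comp (mpsi e) (measurable_slice e)).
elim: m phi => [|m IH] phi mphi phi0.
  rewrite iid0; last exact: mprod.
  apply: eq_bigr => e _; rewrite iid0//; congr (phi e _); exact: tuple0.
rewrite iidS; [|exact: mprod|by move=> t; exact: eprod_ge0].
transitivity (\int[iid mu N]_x \prod_(e < N)
    \int[iid mu m]_t phi e (tcons (tnth x e, t))).
  apply: eq_integral => x _.
  rewrite -(IH (fun e t => phi e (tcons (tnth x e, t))))//.
    apply: eq_integral => b _; apply: eq_bigr => e _; congr (phi e _).
    apply/eq_from_tnth => k; rewrite tnth_mktuple.
    by case: (unliftP ord0 k) => [j ->|->] //=; rewrite !tnthS tnth_mktuple.
  by move=> e; exact: (measurableT_comp (mphi e) (measurable_tcons2 _)).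
rewrite (iid_prod mu (phi := fun e x => \int[iid mu m]_t phi e (tcons (x, t)))).
- by apply: eq_bigr => e _; rewrite iidS.
- move=> e; apply: (measurable_fun_fubini_tonelli_F (fun p => phi e (tcons p))) => //.
  exact: (measurableT_comp (mphi e) (@measurable_tcons _ _ m)).
- by move=> e x; apply: integral_ge0 => t _.
Qed.

Lemma indic_rectangle d (T : measurableType d) N (B : 'I_N -> set T) t :
  (\1_(rectangle B) t)%:E = \prod_(i < N) (\1_(B i) (tnth t i))%:E :> \bar R.
Proof.
rewrite indicE; case: (boolP (t \in rectangle B)) => [/set_mem tB|tB].
  by rewrite big1// => i _; rewrite indicE mem_set//; exact: tB.
have [i iB] : exists i, ~ B i (tnth t i).
  by apply/not_existsP => H; move/negP : tB; apply; apply/mem_set => i;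
    apply: contrapT; exact: H.
by rewrite (bigD1 i)//= indicE memNset// mul0e.
Qed.

Lemma measurable_slices d (T : measurableType d) m N :
  measurable_fun setT
    (fun b : m.-tuple (N.-tuple T) => [tuple slice b e | e < N]).
Proof.
apply/measurable_fun_tnthP => e.
rewrite (_ : _ \o _ = fun b => slice b e); first exact: measurable_slice.
by apply/funext => b /=; rewrite tnth_mktuple.
Qed.

(** The two laws agree on rectangles, by [iid_slices_prod]. *)
Lemma iid_transpose d (T : measurableType d) (mu : probability T R) m N :
  has_law (iid (iid mu N) m) (fun b => [tuple slice b e | e < N])
    (iid (iid mu m) N).
Proof.
apply: has_law_iid; first exact: measurable_slices.
move=> B mB; pose Y (b : m.-tuple (N.-tuple T)) := [tuple slice b e | e < N].
have mR : measurable (Y @^-1` rectangle B).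
  have := @measurable_slices _ T m N measurableT (rectangle B).
  by rewrite setTI; apply; exact: measurable_rectangle.
transitivity (\int[iid (iid mu N) m]_b (\1_(Y @^-1` rectangle B) b)%:E).
  by rewrite integral_indic// setIT.
transitivity (\int[iid (iid mu N) m]_b \prod_(e < N) (\1_(B e) (slice b e))%:E).
  apply: eq_integral => b _; rewrite -[LHS]/((\1_(rectangle B) (Y b))%:E) indic_rectangle.
  by apply: eq_bigr => e _; rewrite tnth_mktuple.
rewrite (iid_slices_prod mu (phi := fun e t => (\1_(B e) t)%:E)).
- by apply: eq_bigr => e _; rewrite integral_indic// setIT.
- by move=> e; exact/measurable_EFinP/measurable_indic.
- by move=> e t; rewrite lee_fin.
Qed.

Lemma iid_slices d (T : measurableType d) (mu : probability T R) m N
    d' (U : measurableType d') (lam : probability U R) (F : m.-tuple T -> U) :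
  has_law (iid mu m) F lam ->
  has_law (iid (iid mu N) m) (fun b => [tuple F (slice b e) | e < N]) (iid lam N).
Proof.
move=> [mF Flam].
have mFs : measurable_fun setT
    (fun b : m.-tuple (N.-tuple T) => [tuple F (slice b e) | e < N]).
  apply/measurable_fun_tnthP => e.
  rewrite (_ : _ \o _ = fun b => F (slice b e)); last first.
    by apply/funext => b /=; rewrite tnth_mktuple.
  exact: (measurableT_comp mF (measurable_slice e)).
have mFB (B : set U) : measurable B -> measurable (F @^-1` B).
  by move=> mB; rewrite -[X in measurable X]setTI; exact: mF.
apply: has_law_iid => // B mB.
transitivity (iid (iid mu m) N (rectangle (fun e => F @^-1` B e))).
  rewrite -(iid_transpose mu m N).2; last first.
    by apply: measurable_rectangle => e; exact: mFB.
  congr (iid _ _ _); apply/seteqP; split => b /= bB e;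
    by have := bB e; rewrite !tnth_mktuple.
rewrite iid_rectangle; last by move=> e; exact: mFB.
by apply: eq_bigr => e _; exact: Flam.
Qed.

End IidMore.

(** * Reduction to two graphs *)

Lemma has_law_comp d1 d2 d3 (T1 : measurableType d1) (T2 : measurableType d2)
    (T3 : measurableType d3) (R : realType) (P : {measure set T1 -> \bar R})
    (nu : {measure set T2 -> \bar R}) (lam : {measure set T3 -> \bar R})
    (Y : T1 -> T2) (Z : T2 -> T3) :
  has_law P Y nu -> has_law nu Z lam -> has_law P (Z \o Y) lam.
Proof.
move=> [mY PY] [mZ nuZ]; split; first exact: measurableT_comp.
move=> A mA; rewrite comp_preimage PY ?nuZ//.
by rewrite -[X in measurable X]setTI; exact: mZ.
Qed.

Lemma conditionalE (R : realType) d (Omega : measurableType d)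
    (mu : probability Omega R) (A : set Omega) (mA : measurable A) (U : set Omega)
    (r : R) : mu A = r%:E -> r != 0 ->
  conditional mu mA U = (mu (U `&` A) * (r^-1)%:E)%E.
Proof.
move=> Ar r0; rewrite /conditional /= /mnormalize.
case: ifPn => [/orP[]|_]; rewrite /= /mrestr /= setTI Ar//.
by rewrite eqe (negbTE r0).
Qed.

Section Observations.
Context (R : realType) (m n : nat).
Local Notation N := (nedge n).

Definition pair_entry (b : N.-tuple R) (i j : 'I_n) : R :=
  if insub (sort_pair i j) is Some e then tnth b (enum_rank (e : edge n)) else 0.

Definition symmx (b : N.-tuple R) : n.-tuple (n.-tuple R) :=
  [tuple [tuple pair_entry b i j | j < n] | i < n].

Definition obs (c : m.-tuple (N.-tuple R)) : observation R m n :=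
  [tuple symmx (tnth c k) | k < m].

Lemma measurable_symmx : measurable_fun setT symmx.
Proof.
apply/measurable_fun_tnthP => i; apply/measurable_fun_tnthP => j.
rewrite (_ : _ \o _ = fun b => pair_entry b i j); last first.
  by apply/funext => b /=; rewrite !tnth_mktuple.
rewrite /pair_entry; case: insub => [e|]; first exact: measurable_tnth.
exact: measurable_cst.
Qed.

Lemma measurable_obs : measurable_fun setT obs.
Proof.
apply/measurable_fun_tnthP => k.
rewrite (_ : _ \o _ = fun c => symmx (tnth c k)); last first.
  by apply/funext => c /=; rewrite tnth_mktuple.
exact: (measurableT_comp measurable_symmx (measurable_tnth k)).
Qed.

Definition edge_entries (x : observation R m n) (k : 'I_m) : N.-tuple R :=
  [tuple entry x k (val (enum_val e)).1 (val (enum_val e)).2 | e < N].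

Definition symmetric_obs (x : observation R m n) :=
  (forall k i j, entry x k i j = entry x k j i) /\ (forall k i, entry x k i i = 0).

Lemma obs_entries x : symmetric_obs x -> obs [tuple edge_entries x k | k < m] = x.
Proof.
move=> [xs xd]; apply/eq_from_tnth => k; rewrite !tnth_mktuple.
apply/eq_from_tnth => i; rewrite tnth_mktuple.
apply/eq_from_tnth => j; rewrite tnth_mktuple /pair_entry.
case: insubP => [e _ eE|].
  by rewrite tnth_mktuple enum_rankK eE /sort_pair; case: ifP.
have [<- _|ij] := eqVneq i j; first by rewrite -(xd k i).
by rewrite sort_pair_lt.
Qed.

Definition alignedv (pi : {ffun 'I_m -> 'S_n}) (x : observation R m n) :
    N.-tuple (m.-tuple R) :=
  [tuple aligned_vector pi x (enum_val e) | e < N].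

Definition unalign (pi : {ffun 'I_m -> 'S_n}) (v : N.-tuple (m.-tuple R)) :
    m.-tuple (N.-tuple R) :=
  [tuple relabel (eperm (pi k)) (slice v k) | k < m].

Lemma measurable_unalign pi : measurable_fun setT (unalign pi).
Proof.
apply/measurable_fun_tnthP => k.
rewrite (_ : _ \o _ = fun v => relabel (eperm (pi k)) (slice v k)); last first.
  by apply/funext => v /=; rewrite tnth_mktuple.
exact: (measurableT_comp (measurable_relabel _) (measurable_slice k)).
Qed.

Lemma unalign_alignedv pi x : symmetric_obs x ->
  unalign pi (alignedv pi x) = [tuple edge_entries x k | k < m].
Proof.
move=> [xs _]; apply/eq_from_tnth => k; rewrite !tnth_mktuple.
apply/eq_from_tnth => e; set f := ((eperm (pi k))^-1)%g e.
rewrite !tnth_mktuple.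
have -> : e = eperm (pi k) f by rewrite permKV.
rewrite !permK permE /eperm_fun enum_rankK /eact SubK /sort_pair.
by case: ifP => // _; rewrite xs.
Qed.

Lemma measurable_alignedv pi : measurable_fun setT (alignedv pi).
Proof.
apply/measurable_fun_tnthP => e; apply/measurable_fun_tnthP => k.
pose i := pi k (val (enum_val e)).1; pose j := pi k (val (enum_val e)).2.
rewrite (_ : _ \o _ = fun x => tnth (tnth (tnth x k) i) j); last first.
  by apply/funext => x /=; rewrite !tnth_mktuple.
exact: (measurableT_comp (measurable_tnth j)
  (measurableT_comp (measurable_tnth i) (measurable_tnth k))).
Qed.

End Observations.

Lemma card_alignment_gt0 m n : (0 < #|alignment m n|)%N.
Proof.
apply/card_gt0P; exists [ffun=> 1%g]; rewrite inE; apply/forallP => k.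
by rewrite ffunE eqxx implybT.
Qed.

Section Identification.
Context (R : realType) (m n : nat) (rho : R).
Hypothesis rho0 : 0 <= rho.
Hypothesis rho1 : rho < 1.
Local Notation N := (nedge n).
Local Notation gam := (gam R).
Local Notation G := (iid (iid gam N) m).
Local Notation align := (alignment m n).
Local Open Scope ereal_scope.

Definition xblock (b : m.-tuple (N.-tuple R)) (k : nat) : N.-tuple R :=
  [tuple equicorr rho (nth 0%R (slice b e)) k | e < N].

(** The first [K] graphs are correlated and the others are independent of
    everything else. *)
Definition hybrid (K : nat) (pi : {ffun 'I_m -> 'S_n}) (b : m.-tuple (N.-tuple R)) :
    m.-tuple (N.-tuple R) :=
  [tuple if (k < K)%N then relabel (eperm (pi k)) (xblock b k) else tnth b k | k < m].

Lemma measurable_xblock k : measurable_fun setT (fun b => xblock b k).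
Proof.
apply/measurable_fun_tnthP => e.
rewrite (_ : _ \o _ = fun b => equicorr rho (nth 0%R (slice b e)) k); last first.
  by apply/funext => b /=; rewrite tnth_mktuple.
exact: (measurableT_comp (measurable_equicorr rho k) (measurable_slice e)).
Qed.

Lemma measurable_hybrid K pi : measurable_fun setT (hybrid K pi).
Proof.
apply/measurable_fun_tnthP => k.
rewrite (_ : _ \o _ = fun b => if (k < K)%N
    then relabel (eperm (pi k)) (xblock b k) else tnth b k); last first.
  by apply/funext => v /=; rewrite tnth_mktuple.
case: (k < K)%N; last exact: measurable_tnth.
exact: (measurableT_comp (measurable_relabel _) (measurable_xblock k)).
Qed.

Section Model.
Context d (Omega : measurableType d) (mu : probability Omega R)
  (pistar : Omega -> {ffun 'I_m -> 'S_n}) (X : {RV mu >-> observation R m n}).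
Hypothesis model : correlated_gaussian_model rho pistar X.

Let cond pi : probability Omega R :=
  conditional mu (pistar_measurable model pi).

(** Given the alignment, the aligned vectors of the edges are independent and have
    the law of [equicorr_vec] by [gaussian_equicorr]; so all of them together
    have the law of the array of the [equicorr_vec] of the slices. *)
Lemma conditional_law pi A : pi \in align -> measurable A ->
  cond pi (X @^-1` A) = G ((fun b => obs (hybrid m pi b)) @^-1` A).
Proof.
move=> piA mA.
pose lam : probability (m.-tuple R) R :=
  distribution (iid gam m) (HB.pack (@equicorr_vec R rho m)
    (isMeasurableFun.Build _ _ _ _ _ (@measurable_equicorr_vec R rho m)) :
    {mfun m.-tuple R >-> m.-tuple R}).
have lamE : has_law (iid gam m) (@equicorr_vec R rho m) lam.
  by split => //; exact: measurable_equicorr_vec.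
have mX : measurable_fun setT X by exact: measurable_funP.
have mal e : measurable_fun setT (fun w => aligned_vector pi (X w) e).
  rewrite (_ : (fun w => _) = fun w => tnth (alignedv pi (X w)) (enum_rank e)).
    exact: (measurableT_comp (measurable_tnth _)
      (measurableT_comp (measurable_alignedv pi) mX)).
  by apply/funext => w; rewrite tnth_mktuple enum_rankK.
have lawv : has_law (cond pi) (fun w => alignedv pi (X w)) (iid lam N).
  apply: has_law_iid; first exact: (measurableT_comp (measurable_alignedv pi) mX).
  move=> B mB.
  transitivity (cond pi (\bigcap_(e in [set` [set: edge n]%SET])
      ((fun w => aligned_vector pi (X w) e) @^-1` B (enum_rank e)))).
    congr (cond pi _); apply/seteqP; split => w /=.
      by move=> Bw e _; have := Bw (enum_rank e); rewrite tnth_mktuple enum_rankK.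
    move=> Bw i; rewrite tnth_mktuple.
    by have := Bw (enum_val i); rewrite /= inE enum_valK; exact.
  rewrite (X_independent model piA)//.
  rewrite (reindex (@enum_val _ {: edge n}))/=; last first.
    by apply: onW_bij; exact: enum_val_bij.
  apply: eq_big => [i|i _]; first by rewrite inE.
  rewrite enum_valK (gaussian_equicorr rho0 rho1 (mal _))//.
  - exact: X_gaussian.
  - by move=> k; exact: X_mean.
  - by move=> k; exact: X_variance.
  - by move=> k l kl; exact: X_covariance.
have lawb := iid_slices N lamE.
have mC : measurable ((fun v => obs (unalign pi v)) @^-1` A).
  rewrite -[X in measurable X]setTI.
  exact: (measurableT_comp (@measurable_obs R m n) (measurable_unalign pi)).
have symX w : symmetric_obs (X w).
  by split; [exact: (X_symmetric model)|exact: (X_diagonal model)].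
transitivity (cond pi ((fun w => alignedv pi (X w)) @^-1`
    ((fun v => obs (unalign pi v)) @^-1` A))).
  by congr (cond pi _); apply/seteqP; split => w /=;
    rewrite unalign_alignedv// obs_entries.
rewrite lawv.2// -lawb.2//; congr (G _).
have hE b : unalign pi [tuple equicorr_vec rho (slice b e) | e < N] = hybrid m pi b.
  apply/eq_from_tnth => k; rewrite !tnth_mktuple ltn_ord; congr relabel.
  by apply/eq_from_tnth => e; rewrite !tnth_mktuple.
by apply/seteqP; split => b /=; rewrite hE.
Qed.

Lemma mixture_law A : measurable A ->
  mu (X @^-1` A) = (#|align|%:R^-1)%:E *
    \sum_(pi in align) G ((fun b => obs (hybrid m pi b)) @^-1` A).
Proof.
move=> mA.
have mXA : measurable (X @^-1` A).
  by rewrite -[X in measurable X]setTI; exact: measurable_funP.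
have mpi pi : measurable (X @^-1` A `&` pistar @^-1` [set pi]).
  by apply: measurableI => //; exact: (pistar_measurable model).
have -> : mu (X @^-1` A) =
    \sum_(pi in align) mu (X @^-1` A `&` pistar @^-1` [set pi]).
  rewrite (bigfs _ (index_enum_uniq _)); last first.
    by move=> pi _; rewrite mem_index_enum.
  rewrite -measure_fin_bigcup//; last 2 first.
  - by move=> p q _ _ [w [[_ /= <-] [_ /= <-]]].
  - by move=> p _; exact: mpi.
  congr (mu _); apply/seteqP; split => w /=.
    by move=> Xw; exists (pistar w) => //=; exact: (pistar_alignment model).
  by move=> [p _ []].
rewrite ge0_sume_distrr//; apply: eq_bigr => pi piA.
have aln0 : (#|align|%:R^-1 != 0 :> R)%R.
  by rewrite invr_eq0 pnatr_eq0 -lt0n card_alignment_gt0.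
rewrite -conditional_law// /cond.
rewrite (conditionalE _ _ (pistar_uniform model piA) aln0).
by rewrite muleC -muleA -EFinM mulVf// mule1.
Qed.

End Model.

Lemma xblock_law (k : 'I_m) : has_law G (fun b => xblock b k) (iid gam N).
Proof.
apply: (@iid_slices R _ _ gam m N _ _ gam
  (fun b : m.-tuple R => equicorr rho (nth 0%R b) k)).
apply: integral_has_law; first exact: measurable_equicorr.
by move=> f mf f0; exact: equicorr_law.
Qed.

Lemma obs_law (Q : probability (observation R m n) R) :
  (forall B : 'I_m -> set (n.-tuple (n.-tuple R)), (forall k, measurable (B k)) ->
    Q (rectangle B) = \prod_(k < m) iid gam N (@symmx R n @^-1` B k)) ->
  forall A, measurable A -> Q A = G (@obs R m n @^-1` A).
Proof.
move=> QE A mA.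
pose obsm : {mfun m.-tuple (N.-tuple R) >-> observation R m n} :=
  HB.pack (@obs R m n) (isMeasurableFun.Build _ _ _ _ _ (@measurable_obs R m n)).
apply: (rectangle_unique (m2 := distribution G obsm)) => // B mB.
rewrite QE// -iid_rectangle; last first.
  move=> k; rewrite -[X in measurable X]setTI; exact: measurable_symmx.
congr (G _); apply/seteqP; split => b /= bB k; have := bB k; by rewrite !tnth_mktuple.
Qed.

(** Both hypotheses are images of the same array of independent normal variables,
    and only the maps differ; this is what makes hybrids possible. *)
Lemma H1_H0_laws (P Q : probability (observation R m n) R) :
  H1_law rho P -> H0_law P Q -> forall A, measurable A ->
  P A = (#|align|%:R^-1)%:E *
    \sum_(pi in align) G ((fun b => obs (hybrid m pi b)) @^-1` A) /\
  Q A = G (@obs R m n @^-1` A).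
Proof.
move=> [d [Om [mu [pistar [X [model PE]]]]]] Q0 A mA.
have PM B : measurable B -> P B = (#|align|%:R^-1)%:E *
    \sum_(pi in align) G ((fun b => obs (hybrid m pi b)) @^-1` B).
  by move=> mB; rewrite PE//; exact: (mixture_law model).
split; first exact: PM.
apply: obs_law => // B mB; rewrite [LHS]Q0//; apply: eq_bigr => k _.
have mBk : measurable [set x : observation R m n | B k (tnth x k)].
  rewrite -[X in measurable X]setTI.
  by have := @measurable_tnth _ _ m k measurableT (B k) (mB k).
rewrite /marginal PM//.
have lawk (pi : {ffun 'I_m -> 'S_n}) : has_law G
    (fun b => relabel (eperm (pi k)) (xblock b k)) (iid gam N).
  exact: (has_law_comp (xblock_law k) (iid_relabel gam (eperm (pi k)))).
have mS : measurable (@symmx R n @^-1` B k).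
  by rewrite -[X in measurable X]setTI; exact: measurable_symmx.
rewrite (eq_bigr (fun=> iid gam N (@symmx R n @^-1` B k))); last first.
  move=> pi _; rewrite -((lawk pi).2 _ mS); congr (G _).
  by apply/seteqP; split => b /=; rewrite !tnth_mktuple ltn_ord.
have aln0 : (#|align|%:R != 0 :> R)%R.
  by rewrite pnatr_eq0 -lt0n card_alignment_gt0.
have /fineK <- : iid gam N (@symmx R n @^-1` B k) \is a fin_num.
  exact: fin_num_measure.
by rewrite sumEFin sumr_const -EFinM -[X in (_ * X)%R]mulr_natl mulrA mulVf// mul1r.
Qed.

End Identification.

Section Core.
Context (R : realType) (n : nat).
Local Notation N := (nedge n).
Local Notation gam := (gam R).

(** The likelihood ratio of a pair of graphs aligned by [t], and its average. *)
Definition lr (r : R) (a b : N.-tuple R) (t : 'S_n) : R :=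
  \prod_(e < N) mehler r (tnth a e) (tnth b (eperm t e)).
Definition avg_lr (r : R) (a b : N.-tuple R) : R :=
  (n`!%:R)^-1 * \sum_(t : 'S_n) lr r a b t.

(** Twice the total variation distance in the problem with two graphs. *)
Definition core (r : R) : \bar R :=
  (\int[iid gam N]_a \int[iid gam N]_b (`|avg_lr r a b - 1|)%:E)%E.

Lemma lr_ge0 r a b t : 0 <= lr r a b t.
Proof. by apply: prodr_ge0 => e _; exact: mehler_ge0. Qed.

Lemma avg_lr_ge0 r a b : 0 <= avg_lr r a b.
Proof. by rewrite mulr_ge0 ?invr_ge0// sumr_ge0// => t _; exact: lr_ge0. Qed.

Lemma measurable_lr r t d (T : measurableType d) (f g : T -> N.-tuple R) :
  measurable_fun setT f -> measurable_fun setT g ->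
  measurable_fun setT (fun x => lr r (f x) (g x) t).
Proof.
move=> mf mg; apply: measurable_prod => e _; apply: measurable_mehler.
  exact: (measurableT_comp (measurable_tnth e) mf).
exact: (measurableT_comp (measurable_tnth _) mg).
Qed.

Lemma measurable_avg_lr r d (T : measurableType d) (f g : T -> N.-tuple R) :
  measurable_fun setT f -> measurable_fun setT g ->
  measurable_fun setT (fun x => avg_lr r (f x) (g x)).
Proof.
move=> mf mg; apply: measurable_funM; first exact: measurable_cst.
by apply: measurable_sum => t; exact: measurable_lr.
Qed.

Lemma measurable_core_integrand r d (T : measurableType d) (f g : T -> N.-tuple R) :
  measurable_fun setT f -> measurable_fun setT g ->
  measurable_fun setT (fun x => (`|avg_lr r (f x) (g x) - 1|)%:E).
Proof.
move=> mf mg; apply/measurable_EFinP; apply: measurableT_comp => //.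
apply: measurable_funB; last exact: measurable_cst.
exact: measurable_avg_lr.
Qed.

End Core.

Lemma weight_le (R : realType) (g L : R) : 0 <= g <= 1 ->
  g * L <= g + `|L - 1| /\ g <= g * L + `|L - 1|.
Proof.
move=> /andP[g0 g1]; have := ler_piMl (normr_ge0 (L - 1)) g1.
rewrite -{1}(ger0_norm g0) -normrM ler_norml mulrBr mulr1 => /andP[lo up].
by split; lra.
Qed.

Section Hybrids.
Context (R : realType) (m n : nat) (rho : R).
Hypothesis rho0 : 0 <= rho.
Hypothesis rho1 : rho < 1.
Local Notation N := (nedge n).
Local Notation gam := (gam R).
Local Notation G := (iid (iid gam N) m).
Local Notation align := (alignment m n).
Local Notation obsT := (m.-tuple (N.-tuple R)).
Local Open Scope ereal_scope.

(** All that the first [K] aligned graphs tell about the next one: its regression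
    on them is [pcorr rho K] times this normalized sum. *)
Definition sblock (K : nat) (b : obsT) : N.-tuple R :=
  [tuple (psum rho (nth 0%R (slice b e)) K / psum_sd rho K)%R | e < N].

Lemma sblock_law (K : 'I_m) : (0 < K)%N -> has_law G (sblock K) (iid gam N).
Proof.
case: K => -[//|K] Km _.
apply: (@iid_slices R _ _ gam m N _ _ gam
  (fun b : m.-tuple R => psum rho (nth 0%R b) K.+1 / psum_sd rho K.+1)%R).
apply: integral_has_law.
  apply: measurable_funM; last exact: measurable_cst; exact: measurable_psum.
by move=> f mf f0; apply: psum_law => //; exact: ltnW.
Qed.

Section Step.
Context (K : 'I_m).
Hypothesis K0 : (0 < K)%N.

Definition setc (pi : {ffun 'I_m -> 'S_n}) (t : 'S_n) : {ffun 'I_m -> 'S_n} :=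
  [ffun k => if k == K then t else pi k].

Lemma setc_align pi t : pi \in align -> setc pi t \in align.
Proof.
rewrite !inE => /forallP pi0; apply/forallP => k; apply/implyP => /eqP k0.
rewrite /setc ffunE; have [kK|_] := eqVneq k K; first by move: K0; rewrite -kK k0.
by have := pi0 k; rewrite k0 eqxx.
Qed.

(** Right translation of the [K]-th component permutes the alignments, so that
    this component may be drawn afresh. *)
Lemma sum_setc (F : {ffun 'I_m -> 'S_n} -> \bar R) :
  \sum_(pi in align) \sum_(t : 'S_n) F (setc pi t) =
  \sum_(t : 'S_n) \sum_(pi in align) F pi.
Proof.
transitivity (\sum_(pi in align) \sum_(t : 'S_n) F (setc pi (pi K * t)%g)).
  by apply: eq_bigr => pi _; rewrite (reindex_inj (mulgI (pi K))).
rewrite exchange_big /=; apply: eq_bigr => t _.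
rewrite [RHS](reindex_onto (fun pi => setc pi (pi K * t)%g)
  (fun pi => setc pi (pi K * t^-1)%g)) /=.
  apply: eq_bigl => pi; apply/idP/idP => [piA|/andP[piA /eqP <-]].
    rewrite setc_align//=; apply/eqP/ffunP => k; rewrite /setc !ffunE eqxx.
    by case: eqP => // ->; rewrite mulgK.
  exact: setc_align.
move=> pi _; apply/ffunP => k; rewrite /setc !ffunE eqxx.
by case: eqP => // ->; rewrite mulgKV.
Qed.

Lemma slice_upd (b : obsT) c (e : 'I_N) :
  slice (upd b K c) e = upd (slice b e) K (tnth c e).
Proof.
apply/eq_from_tnth => k; rewrite tnth_mktuple !tnth_upd.
by case: eqP => // _; rewrite tnth_mktuple.
Qed.

Definition channel (b : obsT) (c : N.-tuple R) : N.-tuple R :=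
  [tuple (pcorr rho K * tnth (sblock K b) e + resid rho K * tnth c e)%R | e < N].

(** The hybrids [K] and [K.+1] only differ by their [K]-th graph, which is fresh
    noise in the first one and the output of a Gaussian channel with input
    [sblock K] in the second one. *)
Lemma hybridS_upd pi t b c :
  hybrid rho K.+1 (setc pi t) (upd b K c) =
  upd (hybrid rho K pi b) K (relabel (eperm t) (channel b c)).
Proof.
apply/eq_from_tnth => k; rewrite tnth_mktuple !tnth_upd /setc ffunE.
have [->|kK] := eqVneq k K.
  rewrite leqnn; congr relabel; apply/eq_from_tnth => e.
  rewrite !tnth_mktuple slice_upd /equicorr psum_upd// nth_upd eqxx; congr (_ + _)%R.
  rewrite /pcorr; field; move: K0; case: (nat_of_ord K) => // K' _.
  by rewrite gt_eqF ?psum_sd_gt0.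
rewrite tnth_mktuple ltnS [(k <= K)%N]leq_eqVlt.
have kK' : ((k : nat) == K) = false by apply/negbTE; rewrite (inj_eq val_inj).
rewrite kK' /=; case: ltnP => // ltkK; congr relabel; apply/eq_from_tnth => e.
rewrite !tnth_mktuple slice_upd /equicorr nth_upd kK' psum_upd//; exact: ltnW.
Qed.

Lemma hybrid_upd (pi : {ffun 'I_m -> 'S_n}) b c :
  hybrid rho K pi (upd b K c) = upd (hybrid rho K pi b) K c.
Proof.
apply/eq_from_tnth => k; rewrite tnth_mktuple !tnth_upd.
have [->|kK] := eqVneq k K; first by rewrite ltnn.
rewrite tnth_mktuple; case: ltnP => // ltkK; congr relabel; apply/eq_from_tnth => e.
rewrite !tnth_mktuple slice_upd /equicorr nth_upd psum_upd; last exact: ltnW.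
by rewrite ltn_eqF.
Qed.

Context (h : obsT -> R).
Hypothesis mh : measurable_fun setT h.
Hypothesis h01 : forall b, (0 <= h b <= 1)%R.

Let h0 b : 0 <= (h b)%:E.
Proof. by rewrite lee_fin; case/andP : (h01 b). Qed.

Let g (pi : {ffun 'I_m -> 'S_n}) (p : obsT * N.-tuple R) : R := h (upd (hybrid rho K pi p.1) K p.2).

Let mg pi : measurable_fun setT (g pi).
Proof.
apply: (measurableT_comp mh).
apply/measurable_fun_tnthP => k.
rewrite (_ : _ \o _ = fun p => if k == K then p.2 else tnth (hybrid rho K pi p.1) k);
  last by apply/funext => p /=; rewrite tnth_upd.
case: (k == K); first exact: measurable_snd.
exact: (measurableT_comp (measurable_tnth k)
  (measurableT_comp (measurable_hybrid rho K pi) measurable_fst)).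
Qed.

Let g01 pi p : (0 <= g pi p <= 1)%R. Proof. exact: h01. Qed.
Let g0 pi p : (0 <= g pi p)%R. Proof. by case/andP : (g01 pi p). Qed.

Let msblock : measurable_fun setT (sblock K).
Proof. exact: (sblock_law K0).1. Qed.

Lemma hybrid_fresh pi : \int[G]_b (h (hybrid rho K pi b))%:E =
  \int[G]_b \int[iid gam N]_c (g pi (b, c))%:E.
Proof.
rewrite (iid_resample _ K).
- by apply: eq_integral => b _; apply: eq_integral => c _; rewrite hybrid_upd.
- apply/measurable_EFinP; exact: (measurableT_comp mh (measurable_hybrid rho K pi)).
- by [].
Qed.

(** [mehler_shift_tuple] turns the channel into the weight [lr] on fresh noise. *)
Lemma hybridS_fresh pi t : \int[G]_b (h (hybrid rho K.+1 (setc pi t) b))%:E =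
  \int[G]_b \int[iid gam N]_c
    (g pi (b, c) * lr (pcorr rho K) (sblock K b) c t)%:E.
Proof.
rewrite (iid_resample _ K); last 2 first.
- apply/measurable_EFinP; exact: (measurableT_comp mh (measurable_hybrid rho _ _)).
- by [].
apply: eq_integral => b _.
under eq_integral do rewrite hybridS_upd.
have mgb : measurable_fun setT (fun c => (g pi (b, c))%:E).
  by apply/measurable_EFinP; exact: (measurableT_comp (mg pi) (pair1_measurable b)).
rewrite (@mehler_shift_tuple R _ _ N (sblock K b)
    (fun c => (g pi (b, relabel (eperm t) c))%:E)) ?resid_gt0 ?pcorr_resid//; last 2 first.
- exact: (measurableT_comp mgb (measurable_relabel _)).
- by move=> c; rewrite lee_fin.
rewrite -[RHS](has_law_integral (iid_relabel gam (eperm t))); last first.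
  apply/measurable_EFinP; apply: measurable_funM; first exact/measurable_EFinP.
  by apply: measurable_lr => //; exact: measurable_cst.
apply: eq_integral => c _; rewrite EFinM; congr (_ * _).
rewrite /lr -prodEFin; apply: eq_bigr => e _.
by rewrite tnth_relabel.
Qed.

Let hybrid_fin K' (pi : {ffun 'I_m -> 'S_n}) : \int[G]_b (h (hybrid rho K' pi b))%:E \is a fin_num.
Proof.
rewrite ge0_fin_numE; last exact: integral_ge0.
apply: (@le_lt_trans _ _ (\int[G]_b cst 1 b)); last first.
  by rewrite integral_cst//= mul1e probability_setT ltry.
apply: ge0_le_integral => //.
- by apply/measurable_EFinP; exact: (measurableT_comp mh (measurable_hybrid rho _ _)).
- by move=> b _; rewrite lee_fin; case/andP : (h01 (hybrid rho K' pi b)).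
Qed.

Lemma sum_hybridS : \sum_(pi in align) \int[G]_b (h (hybrid rho K.+1 pi b))%:E =
  \sum_(pi in align) \int[G]_b \int[iid gam N]_c
    (g pi (b, c) * avg_lr (pcorr rho K) (sblock K b) c)%:E.
Proof.
set S := LHS.
have Sfin : S \is a fin_num by apply/sum_fin_numP => pi _ _; exact: hybrid_fin.
have nf0 : (n`!%:R != 0 :> R)%R by rewrite pnatr_eq0 -lt0n fact_gt0.
have -> : S = (n`!%:R^-1)%:E * \sum_(t : 'S_n) S.
  rewrite -(fineK Sfin) sumEFin sumr_const card_Sn -EFinM.
  by rewrite -[X in (_ * X)%R]mulr_natl mulrA mulVf// mul1r.
rewrite -sum_setc ge0_sume_distrr; last first.
  by move=> pi _; apply: sume_ge0 => t _; exact: integral_ge0.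
apply: eq_bigr => pi _.
have mglr t : measurable_fun setT (fun p : obsT * N.-tuple R =>
    (g pi (p.1, p.2) * lr (pcorr rho K) (sblock K p.1) p.2 t)%:E).
  apply/measurable_EFinP; apply: measurable_funM.
    by rewrite (_ : (fun p => _) = g pi)//; apply/funext => -[].
  by apply: measurable_lr => //; exact: (measurableT_comp msblock measurable_fst).
have glr0 t p : 0 <= (g pi p * lr (pcorr rho K) (sblock K p.1) p.2 t)%:E.
  by rewrite lee_fin mulr_ge0// lr_ge0.
under eq_bigr do rewrite hybridS_fresh.
rewrite -ge0_integral_sum//=; last 2 first.
- move=> t; exact: (measurable_fun_fubini_tonelli_F _ (mglr t) (fun p => glr0 t p)).
- by move=> t b _; apply: integral_ge0 => c _; exact: (glr0 t (b, c)).
rewrite -ge0_integralZl//; last 2 first.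
- apply: emeasurable_sum => t.
  exact: (measurable_fun_fubini_tonelli_F _ (mglr t) (fun p => glr0 t p)).
- by move=> b _; apply: sume_ge0 => t _; apply: integral_ge0 => c _; exact: (glr0 t (b, c)).
apply: eq_integral => b _.
rewrite -ge0_integral_sum//=; last first.
  by move=> t; exact: (measurableT_comp (mglr t) (pair1_measurable b)).
rewrite -ge0_integralZl//; last 2 first.
- by apply: emeasurable_sum => t; exact: (measurableT_comp (mglr t) (pair1_measurable b)).
- by move=> c _; apply: sume_ge0 => t _; exact: (glr0 t (b, c)).
apply: eq_integral => c _; rewrite sumEFin -EFinM /avg_lr -mulr_sumr; congr _%:E; ring.
Qed.

(** After the average over the [K]-th permutation, the two hybrids only differ by
    the weight [avg_lr], whose first argument has the law of a graph; so their
    laws differ by at most the problem with two graphs of correlation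
    [pcorr rho K]. *)
Lemma hybrid_step :
  \sum_(pi in align) \int[G]_b (h (hybrid rho K.+1 pi b))%:E <=
    \sum_(pi in align) (\int[G]_b (h (hybrid rho K pi b))%:E + core n (pcorr rho K)) /\
  \sum_(pi in align) \int[G]_b (h (hybrid rho K pi b))%:E <=
    \sum_(pi in align) \int[G]_b (h (hybrid rho K.+1 pi b))%:E +
    \sum_(pi in align) core n (pcorr rho K).
Proof.
set r := pcorr rho K.
pose D (b : obsT) := \int[iid gam N]_c (`|avg_lr r (sblock K b) c - 1|)%:E.
have mDc : measurable_fun setT (fun p : obsT * N.-tuple R =>
    (`|avg_lr r (sblock K p.1) p.2 - 1|)%:E).
  by apply: measurable_core_integrand => //; exact: (measurableT_comp msblock measurable_fst).
have mDc2 b : measurable_fun setT (fun c => (`|avg_lr r (sblock K b) c - 1|)%:E).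
  exact: (measurableT_comp mDc (pair1_measurable b)).
have mD : measurable_fun setT D.
  exact: (measurable_fun_fubini_tonelli_F _ mDc).
have D0 b : 0 <= D b by exact: integral_ge0.
have coreE : core n r = \int[G]_b D b.
  rewrite /core -(has_law_integral (sblock_law K0))//.
  apply: (measurable_fun_fubini_tonelli_F
    (fun p : N.-tuple R * N.-tuple R => (`|avg_lr r p.1 p.2 - 1|)%:E)) => //.
  exact: measurable_core_integrand.
have mgE pi : measurable_fun setT (fun p : obsT * N.-tuple R => (g pi (p.1, p.2))%:E).
  apply/measurable_EFinP.
  by rewrite (_ : (fun p => _) = g pi)//; apply/funext => -[].
have mga pi : measurable_fun setT (fun p : obsT * N.-tuple R =>
    (g pi (p.1, p.2) * avg_lr r (sblock K p.1) p.2)%:E).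
  apply/measurable_EFinP; apply: measurable_funM; first by have /measurable_EFinP := mgE pi.
  by apply: measurable_avg_lr => //; exact: (measurableT_comp msblock measurable_fst).
have ga0 pi (b : obsT) c : 0 <= (g pi (b, c) * avg_lr r (sblock K b) c)%:E.
  by rewrite lee_fin mulr_ge0// avg_lr_ge0.
have gE0 pi (b : obsT) c : 0 <= (g pi (b, c))%:E by rewrite lee_fin.
have mg2 pi b : measurable_fun setT (fun c => (g pi (b, c))%:E).
  exact: (measurableT_comp (mgE pi) (pair1_measurable b)).
have mga2 pi b : measurable_fun setT
    (fun c => (g pi (b, c) * avg_lr r (sblock K b) c)%:E).
  exact: (measurableT_comp (mga pi) (pair1_measurable b)).
have mIg pi : measurable_fun setT (fun b => \int[iid gam N]_c (g pi (b, c))%:E).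
  by apply: (measurable_fun_fubini_tonelli_F _ (mgE pi)) => -[b c]; exact: gE0.
have mIga pi : measurable_fun setT
    (fun b => \int[iid gam N]_c (g pi (b, c) * avg_lr r (sblock K b) c)%:E).
  by apply: (measurable_fun_fubini_tonelli_F _ (mga pi)) => -[b c]; exact: ga0.
rewrite sum_hybridS; split.
- apply: lee_sum => pi _; rewrite hybrid_fresh coreE -ge0_integralD//; last first.
    by move=> b _; apply: integral_ge0 => c _; exact: gE0.
  apply: ge0_le_integral => //.
  + by move=> b _; apply: integral_ge0 => c _; exact: ga0.
  + exact: emeasurable_funD.
  + move=> b _; rewrite /D -ge0_integralD//.
    apply: ge0_le_integral => //.
    * exact: emeasurable_funD.
    * move=> c _; rewrite -EFinD lee_fin.
      by case: (weight_le (avg_lr r (sblock K b) c) (g01 pi (b, c))).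
- rewrite -big_split /=; apply: lee_sum => pi _; rewrite hybrid_fresh coreE -ge0_integralD//; last first.
    by move=> b _; apply: integral_ge0 => c _; exact: ga0.
  apply: ge0_le_integral => //.
  + by move=> b _; apply: integral_ge0 => c _; exact: gE0.
  + exact: emeasurable_funD.
  + move=> b _; rewrite /D -ge0_integralD//.
    apply: ge0_le_integral => //.
    * exact: emeasurable_funD.
    * move=> c _; rewrite -EFinD lee_fin.
      by case: (weight_le (avg_lr r (sblock K b) c) (g01 pi (b, c))).
Qed.

End Step.
End Hybrids.

Section Reduction.
Context (R : realType) (m n : nat) (rho : R).
Hypothesis rho0 : 0 <= rho.
Hypothesis rho1 : rho < 1.
Hypothesis m0 : (0 < m)%N.
Local Notation N := (nedge n).
Local Notation gam := (gam R).
Local Notation G := (iid (iid gam N) m).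
Local Notation align := (alignment m n).

Lemma hybrid1 (pi : {ffun 'I_m -> 'S_n}) b :
  pi \in align -> hybrid rho 1 pi b = b.
Proof.
rewrite inE => /forallP pi1; apply/eq_from_tnth => k; rewrite tnth_mktuple.
case: ltnP => // k1; have k0 : k = 0%N :> nat by move: k1; case: (nat_of_ord k).
have := pi1 k; rewrite k0 eqxx /= => /eqP ->; rewrite eperm1.
apply/eq_from_tnth => e; rewrite tnth_mktuple invg1 perm1 tnth_mktuple.
have -> : tnth (tnth b k) e = nth 0 (slice b e) 0.
  by rewrite -[X in nth _ _ X]k0 -tnth_nth tnth_mktuple.
rewrite /equicorr /= mulr0 add0r.
by rewrite /resid !mul0r subr0 sqrtr1 mul1r.
Qed.

(** Telescoping over the hybrids, from the hypothesis of independence [K = 1] to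
    the planted one [K = m]. *)
Lemma reduction (P Q : probability (observation R m n) R) (eta : R) A :
  H1_law rho P -> H0_law P Q -> measurable A ->
  (forall K : 'I_m, (0 < K)%N -> (core n (pcorr rho K) <= eta%:E)%E) ->
  (`|P A - Q A| <= (m.-1%:R * eta)%:E)%E.
Proof.
move=> P1 Q0 mA coreE.
have [PE QE] := H1_H0_laws rho0 rho1 P1 Q0 mA.
pose h (b : m.-tuple (N.-tuple R)) : R := \1_A (obs b).
have mh : measurable_fun setT h.
  exact: (measurableT_comp (measurable_indic mA) (@measurable_obs R m n)).
have h01 b : 0 <= h b <= 1 by rewrite /h indicE; case: (_ \in _); rewrite /= ?lexx ler01.
pose S K := (\sum_(pi in align) \int[G]_b (h (hybrid rho K pi b))%:E)%E.
have hyb_set K pi : (\int[G]_b (h (hybrid rho K pi b))%:E =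
    G ((fun b => obs (hybrid rho K pi b)) @^-1` A))%E.
  rewrite -[in RHS](setIT (_ @^-1` _)) -integral_indic//.
  rewrite -[X in measurable X]setTI.
  exact: (measurableT_comp (@measurable_obs R m n) (measurable_hybrid rho K pi)).
have [p PEp] : exists p : R, P A = p%:E by exists (fine (P A)); rewrite fineK// fin_num_measure.
have [q QEq] : exists q : R, Q A = q%:E by exists (fine (Q A)); rewrite fineK// fin_num_measure.
have a0 := card_alignment_gt0 m n; set a : R := #|align|%:R.
have a_gt0 : 0 < a by rewrite ltr0n.
have S1 : (S 1%N = (a * q)%:E)%E.
  rewrite /S (eq_bigr (fun _ => q%:E)) => [|pi piA]; last first.
    rewrite hyb_set -QEq QE; congr (G _).
    by apply/seteqP; split => b /=; rewrite hybrid1.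
  by rewrite sumEFin sumr_const mulr_natl.
have Sm : (S m = (a * p)%:E)%E.
  rewrite EFinM -PEp PE muleA -EFinM mulfV ?mul1e ?gt_eqF//.
  by apply: eq_bigr => pi _; rewrite hyb_set.
have core_le (K : 'I_m) : (0 < K)%N ->
    (\sum_(pi in align) core n (pcorr rho K) <= (a * eta)%:E)%E.
  move=> K0; apply: (@le_trans _ _ (\sum_(pi in align) eta%:E)%E).
    by apply: lee_sum => pi _; exact: coreE.
  by rewrite sumEFin sumr_const mulr_natl.
have stepS K : (K < m)%N -> (S K.+1 <= (a * q)%:E + (a * (K%:R * eta))%:E)%E /\
    ((a * q)%:E <= S K.+1 + (a * (K%:R * eta))%:E)%E.
  elim: K => [|K IH] Km; first by rewrite S1 mul0r mulr0 adde0.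
  have [up lo] := IH (ltnW Km).
  have [] := hybrid_step rho0 rho1 (K := Ordinal Km) isT mh h01.
  rewrite /= -/(S K.+1) -/(S K.+2) big_split /= -/(S K.+1) => up1 lo1.
  have cK := core_le (Ordinal Km) isT.
  rewrite -natr1 mulrDl mul1r mulrDr EFinD addeA; split.
    by apply: (le_trans up1); exact: leeD.
  apply: (le_trans lo); rewrite (addeC (a * (K%:R * eta))%:E) addeA leeD2r//.
  by apply: (le_trans lo1); exact: leeD.
have [] := stepS m.-1; first by rewrite ltn_predL.
rewrite prednK// Sm PEp QEq -!EFinD !lee_fin -!mulrDr !ler_pM2l// => up lo.
by rewrite ler_norml; apply/andP; split; lra.
Qed.
End Reduction.

(** * Truncated second moments *)

Lemma integral_scale (R : realType) d (T : measurableType d) (mu : probability T R)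
    (k : R) (h : T -> R) : 0 <= k -> measurable_fun setT h -> (forall x, 0 <= h x) ->
  (\int[mu]_x (k * h x)%:E = k%:E * \int[mu]_x (h x)%:E)%E.
Proof.
move=> k0 mh h0; under eq_integral do rewrite EFinM.
rewrite ge0_integralZl//; first exact/measurable_EFinP.
by move=> x _; rewrite lee_fin.
Qed.

(** The second moment method, applied to a part [g] of the density [f] that
    carries almost all its mass. The inequality
    [|u| <= eta / 2 + u ^+ 2 / (2 * eta)] replaces Cauchy-Schwarz. *)
Lemma truncated_l1 (R : realType) d (T : measurableType d) (mu : probability T R)
    (f g : T -> R) (p s eta : R) : 0 < eta ->
  measurable_fun setT f -> measurable_fun setT g ->
  (forall x, 0 <= g x <= f x) ->
  (\int[mu]_x (f x)%:E = 1)%E -> (\int[mu]_x (f x - g x)%:E <= p%:E)%E ->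
  (\int[mu]_x ((g x ^+ 2)%:E) <= (1 + s)%:E)%E ->
  (\int[mu]_x (`|f x - 1|)%:E <= (p + eta / 2 + (s + 2 * p) / (2 * eta))%:E)%E.
Proof.
move=> eta0 mf mg gf f1 fgp g2s.
have [e0 e2] : eta != 0 /\ 0 <= eta^-1 by rewrite gt_eqF// invr_ge0 ltW.
have g0 x : 0 <= g x by case/andP : (gf x).
have f0 x : 0 <= f x by case/andP : (gf x) => ? ?; exact: (@le_trans _ _ (g x)).
have fg0 x : 0 <= f x - g x by rewrite subr_ge0; case/andP : (gf x).
have mabs : measurable_fun setT (fun x => (`|f x - 1|)%:E).
  apply/measurable_EFinP; apply: measurableT_comp => //.
  by apply: measurable_funB => //; exact: measurable_cst.
have mfE : measurable_fun setT (fun x => (eta^-1 * f x)%:E).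
  by apply/measurable_EFinP; apply: measurable_funM => //; exact: measurable_cst.
have mfg : measurable_fun setT (fun x => ((1 + eta^-1) * (f x - g x))%:E).
  apply/measurable_EFinP; apply: measurable_funM; first exact: measurable_cst.
  exact: measurable_funB.
have mg2 : measurable_fun setT (fun x => (eta^-1 / 2 * g x ^+ 2)%:E).
  apply/measurable_EFinP; apply: measurable_funM; first exact: measurable_cst.
  exact: measurable_funX.
pose C : R := eta / 2 + eta^-1 / 2.
have C0 : 0 <= C by rewrite addr_ge0// divr_ge0// ltW.
have key : (\int[mu]_x ((`|f x - 1|)%:E + (eta^-1 * f x)%:E) <=
   \int[mu]_x (((1 + eta^-1) * (f x - g x))%:E +
     ((eta^-1 / 2 * g x ^+ 2)%:E + (cst C x)%:E)))%E.
  apply: ge0_le_integral => //.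
  - by move=> x _; rewrite adde_ge0// lee_fin ?mulr_ge0.
  - exact: emeasurable_funD.
  - by apply: emeasurable_funD => //; apply: emeasurable_funD => //; apply/measurable_EFinP.
  move=> x _; rewrite -!EFinD lee_fin.
  have tri : `|f x - 1| <= (f x - g x) + `|g x - 1|.
    rewrite -{1}(ger0_norm (fg0 x)); apply: le_trans (ler_normD _ _).
    by rewrite addrA subrK.
  have amgm : `|g x - 1| <= eta / 2 + eta^-1 / 2 * (g x - 1) ^+ 2.
    rewrite -(real_normK (num_real (g x - 1))); set u := `|_|.
    have -> : eta / 2 + eta^-1 / 2 * u ^+ 2 = u + eta^-1 / 2 * (u - eta) ^+ 2.
      by field.
    by rewrite lerDl mulr_ge0 ?sqr_ge0 ?divr_ge0.
  have expand : eta^-1 / 2 * (g x - 1) ^+ 2 =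
      eta^-1 / 2 * g x ^+ 2 - eta^-1 * g x + eta^-1 / 2 by field.
  by rewrite expand in amgm; rewrite /C /cst; lra.
have If : (\int[mu]_x (eta^-1 * f x)%:E = eta^-1%:E)%E.
  by rewrite integral_scale// f1 mule1.
have Ifg : (\int[mu]_x ((1 + eta^-1) * (f x - g x))%:E <= ((1 + eta^-1) * p)%:E)%E.
  rewrite integral_scale ?addr_ge0//; last exact: measurable_funB.
  by rewrite EFinM lee_wpmul2l// lee_fin addr_ge0.
have Ig2 : (\int[mu]_x (eta^-1 / 2 * g x ^+ 2)%:E <= (eta^-1 / 2 * (1 + s))%:E)%E.
  rewrite (@integral_scale _ _ _ mu (eta^-1 / 2) (fun x => g x ^+ 2)) ?divr_ge0//.
  - by rewrite (EFinM (eta^-1 / 2)) lee_wpmul2l// lee_fin divr_ge0.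
  - exact: measurable_funX.
  - by move=> x; exact: sqr_ge0.
have IC : (\int[mu]_x (cst C x)%:E = C%:E)%E.
  by rewrite (integral_cst mu measurableT C%:E)/= probability_setT mule1.
have nn : (forall x, [set: T] x -> 0 <= (eta^-1 / 2 * g x ^+ 2)%:E)%E.
  by move=> x _; rewrite lee_fin mulr_ge0 ?sqr_ge0// divr_ge0.
rewrite ge0_integralD//= in key; last by move=> x _; rewrite lee_fin mulr_ge0.
rewrite ge0_integralD//= in key; last 3 first.
- by move=> x _; rewrite lee_fin mulr_ge0// addr_ge0.
- by move=> x _; rewrite adde_ge0 ?nn.
- by apply: emeasurable_funD => //; apply/measurable_EFinP.
rewrite ge0_integralD// in key.
rewrite If IC in key.
rewrite -(@leeD2rE _ eta^-1%:E)//; apply: (le_trans key).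
apply: (@le_trans _ _ (((1 + eta^-1) * p)%:E + ((eta^-1 / 2 * (1 + s))%:E + C%:E))%E).
  by apply: leeD => //; exact: leeD.
rewrite -!EFinD lee_fin /C le_eqVlt; apply/orP; left; apply/eqP; field.
by rewrite e0.
Qed.

(** * Products over the edges *)

Section EdgeProducts.
Context (R : realType).
Local Notation gam := (gam R).
Local Open Scope ereal_scope.

Lemma iid_prod_relabel d (T : measurableType d) (mu : probability T R) N
    (p : {perm 'I_N}) (phi : 'I_N -> T -> \bar R) :
  (forall e, measurable_fun setT (phi e)) -> (forall e x, 0 <= phi e x) ->
  \int[iid mu N]_b \prod_(e < N) phi e (tnth b (p e)) =
  \prod_(e < N) \int[mu]_x phi e x.
Proof.
move=> mphi phi0; rewrite -iid_prod//.
rewrite -(has_law_integral (iid_relabel mu p) (f := fun b => _)); last first.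
  by apply: measurable_eprod => e; exact: (measurableT_comp (mphi e) (measurable_tnth (p e))).
by apply: eq_integral => b _; apply: eq_bigr => e _; rewrite tnth_relabel.
Qed.

Lemma iid2_prod_relabel N (p : {perm 'I_N}) (Phi : 'I_N -> R -> R -> \bar R) :
  (forall e, measurable_fun setT (fun z : R * R => Phi e z.1 z.2)) ->
  (forall e x y, 0 <= Phi e x y) ->
  \int[iid gam N]_a \int[iid gam N]_b
    \prod_(e < N) Phi e (tnth a e) (tnth b (p e)) =
  \prod_(e < N) \int[gam]_x \int[gam]_y Phi e x y.
Proof.
move=> mPhi Phi0.
rewrite -(@iid_prod _ _ _ gam N (fun e x => \int[gam]_y Phi e x y)).
- apply: eq_integral => a _; apply: (@iid_prod_relabel _ _ gam N p
    (fun e y => Phi e (tnth a e) y)) => // e.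
  exact: (measurableT_comp (mPhi e) (pair1_measurable (tnth a e))).
- move=> e; exact: (measurable_fun_fubini_tonelli_F _ (mPhi e) (fun z => Phi0 e z.1 z.2)).
- by move=> e x; apply: integral_ge0.
Qed.

Lemma mehler_mass (r x : R) : (r ^+ 2 < 1)%R -> \int[gam]_y (mehler r x y)%:E = 1.
Proof.
move=> r1; have := @mehler_semigroup R r 0 x 0 r1; rewrite expr0n/= ltr01 => /(_ isT).
rewrite mulr0 mehler0 => <-; apply: eq_integral => y _.
by rewrite mehler0 mule1.
Qed.

Let mexp (p u : R) : measurable_fun setT
  (fun z : R * R => expR (p * z.1 * z.2 - u * (z.1 ^+ 2 + z.2 ^+ 2))).
Proof.
apply: measurableT_comp => //; apply: measurable_funB.
  by apply: measurable_funM => //; apply: measurable_funM => //; exact: measurable_cst.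
apply: measurable_funM; first exact: measurable_cst.
by apply: measurable_funD; apply: measurable_funX.
Qed.

Let int_kernel (k p u : R) (F : R -> R -> R) : (0 <= k)%R -> (0 < 1 + 2 * u)%R ->
  (p ^+ 2 < (1 + 2 * u) ^+ 2)%R ->
  (forall x y, F x y = (k * expR (p * x * y - u * (x ^+ 2 + y ^+ 2)))%R) ->
  \int[gam]_x \int[gam]_y (F x y)%:E =
  (k * (Num.sqrt ((1 + 2 * u) ^+ 2 - p ^+ 2))^-1)%:E.
Proof.
move=> k0 u0 pu FE; rewrite EFinM -gam2_expquad// -ge0_integralZl//; last 2 first.
- apply: (measurable_fun_fubini_tonelli_F (fun z : R * R =>
    (expR (p * z.1 * z.2 - u * (z.1 ^+ 2 + z.2 ^+ 2)))%:E)).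
    by apply/measurable_EFinP; exact: mexp.
  by move=> z; rewrite lee_fin expR_ge0.
- by move=> x _; apply: integral_ge0 => y _; rewrite lee_fin expR_ge0.
apply: eq_integral => x _; under eq_integral do rewrite FE.
rewrite (@integral_scale _ _ _ gam k (fun y => expR (p * x * y - u * (x ^+ 2 + y ^+ 2))))//.
exact: (measurableT_comp (mexp p u) (pair1_measurable x)).
Qed.

Lemma edge_mgf (r s : R) : (r ^+ 2 < 1)%R ->
  (2 * r * s + s ^+ 2 * (1 - r ^+ 2) < 1)%R ->
  \int[gam]_x \int[gam]_y (mehler r x y * expR (s * x * y))%:E =
  ((Num.sqrt (1 - (2 * r * s + s ^+ 2 * (1 - r ^+ 2))))^-1)%:E.
Proof.
move=> r1 rs1; have q0 : (0 < 1 - r ^+ 2)%R by rewrite subr_gt0.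
pose p : R := (r / (1 - r ^+ 2) + s)%R.
pose u : R := (r ^+ 2 / (2 * (1 - r ^+ 2)))%R.
have uE : (1 + 2 * u = (1 - r ^+ 2)^-1)%R by rewrite /u; field; rewrite gt_eqF.
have upE : ((1 + 2 * u) ^+ 2 - p ^+ 2 = (1 - (2 * r * s + s ^+ 2 * (1 - r ^+ 2))) / (1 - r ^+ 2))%R.
  by rewrite uE /p; field; rewrite gt_eqF.
rewrite (int_kernel (k := (Num.sqrt (1 - r ^+ 2))^-1%R) (p := p) (u := u)).
- rewrite upE sqrtrM ?subr_ge0 1?ltW// sqrtrV ?ltW// invfM invrK mulrCA mulVf ?mulr1//.
  by rewrite gt_eqF ?sqrtr_gt0.
- by rewrite invr_ge0 sqrtr_ge0.
- by rewrite uE invr_gt0.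
- by rewrite -subr_gt0 upE divr_gt0 ?subr_gt0.
- move=> x y; rewrite /mehler -[LHS]mulrA -expRD; congr (_ * expR _)%R.
  by rewrite /p /u; field; rewrite gt_eqF.
Qed.

(** The tilt by [- r / (1 - r ^+ 2)] is the exponent that the truncation of the
    edges between fixed points allows. *)
Lemma edge_square (r : R) : (r ^+ 2 < 1)%R ->
  \int[gam]_x \int[gam]_y (mehler r x y * mehler r x y *
     expR (- (r / (1 - r ^+ 2)) * x * y))%:E =
  ((Num.sqrt (1 + r ^+ 2 + r ^+ 4))^-1)%:E.
Proof.
move=> r1; have q0 : (0 < 1 - r ^+ 2)%R by rewrite subr_gt0.
pose p : R := (r / (1 - r ^+ 2))%R.
pose u : R := (r ^+ 2 / (1 - r ^+ 2))%R.
have uE : (1 + 2 * u = (1 + r ^+ 2) / (1 - r ^+ 2))%R by rewrite /u; field; rewrite gt_eqF.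
have upE : ((1 + 2 * u) ^+ 2 - p ^+ 2 = (1 + r ^+ 2 + r ^+ 4) / (1 - r ^+ 2) ^+ 2)%R.
  by rewrite uE /p; field; rewrite gt_eqF.
have r40 : (0 < 1 + r ^+ 2 + r ^+ 4)%R.
  by rewrite ltr_wpDr// ?ltr_wpDr// ?sqr_ge0// exprn_even_ge0.
rewrite (int_kernel (k := (1 - r ^+ 2)^-1%R) (p := p) (u := u)).
- rewrite upE sqrtrM ?ltW// sqrtrV ?sqr_ge0// sqrtr_sqr gtr0_norm// invfM invrK.
  by rewrite mulrCA mulVf ?mulr1// gt_eqF.
- by rewrite invr_ge0 ltW.
- by rewrite uE divr_gt0// ltr_wpDr ?sqr_ge0.
- by rewrite -subr_gt0 upE divr_gt0// exprn_gt0.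
- move=> x y; rewrite /mehler.
  have arrange (a b c : R) : (a * b * (a * b) * c = (a * a) * (b * b * c))%R by ring.
  rewrite arrange -!expRD -invfM -expr2 sqr_sqrtr ?ltW//; congr (_ * expR _)%R.
  by rewrite /p /u; field; rewrite gt_eqF.
Qed.

End EdgeProducts.

(** * Cycles of Mehler kernels *)

Section Cycles.
Context (R : realType) (N : nat) (q : R).
Hypothesis q01 : 0 <= q < 1.
Local Notation gam := (gam R).
Local Notation T := (N.-tuple R).
Implicit Types (x : 'I_N) (s : seq 'I_N) (a : T).

Let lt1 (p : R) : 0 <= p < 1 -> p ^+ 2 < 1.
Proof. by move=> /andP[p0 p1]; rewrite expr_lt1. Qed.

Fixpoint rest x s a : R :=
  if s is w :: s' then mehler q (tnth a w) (tnth a (head x s')) * rest x s' a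
  else 1.

Lemma rest_ge0 x s a : 0 <= rest x s a.
Proof. by elim: s => [|w s IH] //=; rewrite mulr_ge0// mehler_ge0. Qed.

Lemma measurable_rest x s : measurable_fun setT (rest x s).
Proof.
elim: s => [|w s IH] /=; first exact: measurable_cst.
apply: measurable_funM IH; apply: measurable_mehler; exact: measurable_tnth.
Qed.

Lemma rest_free x s z : z != x -> z \notin s -> free_of z (rest x s).
Proof.
move=> zx zs a y; elim: s zs => [|w s IH] //=.
rewrite inE negb_or => /andP[zw zs]; rewrite IH// !tnth_upd eq_sym (negbTE zw).
case: s zs {IH} => [|w' s] /=; first by rewrite eq_sym (negbTE zx).
by rewrite inE negb_or eq_sym => /andP[/negbTE ->].
Qed.

(** Integrating out the interior points of a path one at a time multiplies the
    correlations of the two kernels that meet there. *)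
Lemma chain_integral p x s (g : T -> \bar R) : 0 <= p < 1 ->
  measurable_fun setT g -> (forall a, 0 <= g a)%E ->
  uniq s -> x \notin s -> (forall z, z \in s -> free_of z g) ->
  (\int[iid gam N]_a ((mehler p (tnth a x) (tnth a (head x s)) * rest x s a)%:E * g a) =
   \int[iid gam N]_a ((mehler (p * q ^+ size s) (tnth a x) (tnth a x))%:E * g a))%E.
Proof.
move=> + mg g0; elim: s p => [|z s IH] p p01 /=.
  by move=> *; apply: eq_integral => a _; rewrite mulr1 mulr1.
move=> /andP[zs us]; rewrite inE negb_or => /andP[xz xs] gfree.
have mF : measurable_fun setT (fun a : T => ((mehler p (tnth a x) (tnth a z) *
    (mehler q (tnth a z) (tnth a (head x s)) * rest x s a))%:E * g a)%E).
  apply: emeasurable_funM mg; apply/measurable_EFinP.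
  apply: measurable_funM; last apply: measurable_funM; last exact: measurable_rest;
    apply: measurable_mehler; exact: measurable_tnth.
rewrite (iid_resample gam z)//; last first.
  by move=> a; rewrite mule_ge0// lee_fin !mulr_ge0 ?mehler_ge0 ?rest_ge0.
have pq01 : 0 <= p * q < 1.
  case/andP : p01 => p0 p1; case/andP : q01 => q0 q1.
  by rewrite mulr_ge0//= mulr_ilt1.
rewrite exprS mulrA -IH//; last first.
  by move=> w ws; apply: gfree; rewrite inE ws orbT.
apply: eq_integral => a _.
have hz : (head x s == z) = false.
  case: s zs {IH us xs gfree mF} => [|w s] /=; first by rewrite (negbTE xz).
  by rewrite inE negb_or eq_sym => /andP[/negbTE].
under eq_integral => y _.
  rewrite (gfree z) ?mem_head// rest_free 1?eq_sym// !tnth_upd eqxx (negbTE xz) hz.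
  rewrite mulrA EFinM EFinM -muleA muleC.
  over.
rewrite ge0_integralZl//; last 3 first.
- apply: emeasurable_funM; apply/measurable_EFinP; apply: measurable_mehler => //;
    exact: measurable_cst.
- by move=> y _; rewrite -EFinM lee_fin mulr_ge0// mehler_ge0.
- by rewrite mule_ge0// lee_fin rest_ge0.
by rewrite mehler_semigroup ?lt1// [LHS]muleC [in RHS]EFinM -[RHS]muleA.
Qed.

Lemma prod_rest (sigma : {perm 'I_N}) x y k a : iter k.+1 sigma y = x ->
  mehler q (tnth a y) (tnth a (head x (traject sigma (sigma y) k))) *
    rest x (traject sigma (sigma y) k) a =
  \prod_(e <- traject sigma y k.+1) mehler q (tnth a e) (tnth a (sigma e)).
Proof.
elim: k y => [|k IH] y; rewrite iterSr => yx.
  by rewrite /= big_seq1 mulr1 -yx.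
by rewrite [traject sigma y _]trajectS big_cons -IH.
Qed.

(** Once the path that goes around the cycle is contracted, the trace of the
    kernel of correlation [q ^+ l] is left, where [l] is the length of the cycle. *)
Lemma orbit_integral (sigma : {perm 'I_N}) x (g : T -> \bar R) :
  measurable_fun setT g -> (forall a, 0 <= g a)%E ->
  (forall z, z \in porbit sigma x -> free_of z g) ->
  (\int[iid gam N]_a ((\prod_(e in porbit sigma x)
      mehler q (tnth a e) (tnth a (sigma e)))%:E * g a) =
   ((1 - q ^+ #|porbit sigma x|)^-1)%:E * \int[iid gam N]_a g a)%E.
Proof.
move=> mg g0 gfree.
have [k kE] : exists k, #|porbit sigma x| = k.+1.
  exists #|porbit sigma x|.-1; rewrite prednK//.
  by apply/card_gt0P; exists x; exact: porbit_id.
have xk : iter k.+1 sigma x = x by rewrite -kE iter_porbit.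
have ut := uniq_traject_porbit sigma x; rewrite kE in ut.
have tE : porbit sigma x =i traject sigma x k.+1.
  by move=> y; rewrite porbit_traject kE.
have /= /andP[xt ut'] := ut.
under eq_integral => a _.
  rewrite (eq_bigl _ _ tE) -big_uniq//= -[X in X%:E](prod_rest a xk).
  over.
rewrite chain_integral// => [|z zt]; last first.
  by apply: gfree; rewrite tE trajectS inE zt orbT.
rewrite size_traject -exprS -kE.
have qk01 : 0 <= q ^+ #|porbit sigma x| < 1.
  case/andP : q01 => q0 q1; rewrite exprn_ge0//= exprn_ilt1// kE//.
rewrite (@iid_pull _ _ _ gam N x (fun z => (mehler (q ^+ #|porbit sigma x|) z z)%:E))//.
- by rewrite mehler_trace.
- by apply/measurable_EFinP; apply: measurable_mehler.
- by move=> z; rewrite lee_fin mehler_ge0.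
- by apply: gfree; exact: porbit_id.
Qed.

(** A product of kernels along a permutation factors over its cycles. Each
    cycle is charged to one of its points, and the other points may be charged
    as well, since all the charges are at least 1. *)
Lemma cycles_integral_le (sigma : {perm 'I_N}) (c : 'I_N -> R) (D : {set 'I_N})
    (g : T -> \bar R) : (forall e, 1 <= c e) ->
  (forall e, e \in D -> (1 - q ^+ #|porbit sigma e|)^-1 <= c e) ->
  (forall e, e \in D -> sigma e \in D) ->
  measurable_fun setT g -> (forall a, 0 <= g a)%E ->
  (forall z, z \in D -> free_of z g) ->
  (\int[iid gam N]_a ((\prod_(e in D)
      mehler q (tnth a e) (tnth a (sigma e)))%:E * g a) <=
   (\prod_(e in D) c e)%:E * \int[iid gam N]_a g a)%E.
Proof.
move=> c1; have [k] := ubnP #|D|; elim: k D g => // k IH D g.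
rewrite ltnS => Dk cD stabD mg g0 gfree.
have [->|[x xD]] := set_0Vmem D.
  by rewrite big_set0 mul1e; under eq_integral do rewrite big_set0 mul1e.
set O := porbit sigma x.
have OD : O \subset D.
  apply/fintype.subsetP => y /porbitP[i ->]; elim: i => [|i IHi]; first by rewrite expg0 perm1.
  by rewrite expgSr permM stabD.
have splitD (F : 'I_N -> R) : \prod_(e in D) F e = \prod_(e in O) F e * \prod_(e in D :\: O) F e.
  rewrite (bigID (mem O)) /=; congr (_ * _); apply: eq_bigl => e.
    by rewrite andb_idl// => /(fintype.subsetP OD).
  by rewrite inE andbC.
under eq_integral => a _ do rewrite splitD EFinM -muleA.
have mP (A : {set 'I_N}) : measurable_fun setT (fun a : T => \prod_(e in A)
    mehler q (tnth a e) (tnth a (sigma e))).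
  under eq_fun do rewrite -big_enum; apply: measurable_prod => e _.
  by apply: measurable_mehler; exact: measurable_tnth.
have P0 (A : {set 'I_N}) a : 0 <= \prod_(e in A) mehler q (tnth a e) (tnth a (sigma e)).
  by apply: prodr_ge0 => e _; exact: mehler_ge0.
have stabDO e : e \in D :\: O -> sigma e \in D :\: O.
  rewrite !inE => /andP[eO eD]; rewrite stabD// andbT; apply: contra eO => eO.
  by rewrite /O porbit_sym -(porbit_perm sigma 1 e) expg1 -porbit_sym.
rewrite orbit_integral; last 3 first.
- by apply: emeasurable_funM mg; exact/measurable_EFinP.
- by move=> a; apply: mule_ge0 => //; rewrite lee_fin.
- move=> z zO a y; rewrite gfree ?(fintype.subsetP OD)//; congr (_%:E * _)%E.
  apply: eq_bigr => e eDO; have := stabDO _ eDO; move: eDO.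
  rewrite !inE => /andP[eO _] /andP[seO _]; rewrite !tnth_upd.
  case: eqP => [ez|_]; first by rewrite ez zO in eO.
  by case: eqP => [ez|//]; rewrite ez zO in seO.
have int0 : (0 <= \int[iid gam N]_a g a)%E by apply: integral_ge0.
have cprod0 (A : {set 'I_N}) : 1 <= \prod_(e in A) c e.
  by elim/big_ind : _ => // a b a1 b1; exact: mulr_ege1.
apply: (@le_trans _ _ ((c x)%:E * ((\prod_(e in D :\: O) c e)%:E * \int[iid gam N]_a g a))%E).
  apply: lee_pmul => //.
  - rewrite lee_fin invr_ge0 subr_ge0; case/andP : q01 => q0 q1.
    by rewrite exprn_ile1// ltW.
  - by apply: integral_ge0 => a _; apply: mule_ge0 => //; rewrite lee_fin.
  - by rewrite lee_fin cD.
  - apply: IH => //.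
    + apply: leq_trans Dk; apply: proper_card; rewrite finset.properEneq finset.subsetDl andbT.
      by apply/eqP => DO; have := xD; rewrite -DO inE porbit_id.
    + by move=> e; rewrite inE => /andP[_]; exact: cD.
    + by move=> z; rewrite inE => /andP[_]; exact: gfree.
rewrite muleA -EFinM; apply: lee_wpmul2r => //; rewrite lee_fin splitD.
apply: ler_wpM2r; first exact: le_trans (cprod0 _).
rewrite (bigD1 x) ?porbit_id//=; apply: ler_peMr; first exact: le_trans (c1 x).
by elim/big_ind : _ => // a b a1 b1; exact: mulr_ege1.
Qed.

End Cycles.

(** * Two graphs *)

Section TwoGraphs.
Context (R : realType) (n : nat) (r : R).
Hypothesis r1 : r ^+ 2 < 1.
Local Notation N := (nedge n).
Local Notation gam := (gam R).
Local Notation T := (N.-tuple R).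
Local Notation mu := (iid gam N \x iid gam N)%E.

Let mlr t : measurable_fun setT (fun p : T * T => lr r p.1 p.2 t).
Proof. by apply: measurable_lr; [exact: measurable_fst|exact: measurable_snd]. Qed.

Lemma lr_mass t : (\int[iid gam N]_a \int[iid gam N]_b (lr r a b t)%:E = 1)%E.
Proof.
transitivity (\int[iid gam N]_a \int[iid gam N]_b
    \prod_(e < N) (mehler r (tnth a e) (tnth b (eperm t e)))%:E)%E.
  by apply: eq_integral => a _; apply: eq_integral => b _; rewrite prodEFin.
rewrite (iid2_prod_relabel (eperm t) (Phi := fun _ x y => (mehler r x y)%:E)).
- rewrite big1// => e _; under eq_integral do rewrite mehler_mass//.
  by rewrite integral_cst//= probability_setT mule1.
- move=> e; apply/measurable_EFinP; apply: measurable_mehler;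
    [exact: measurable_fst|exact: measurable_snd].
- by move=> e x y; rewrite lee_fin mehler_ge0.
Qed.

(** The square of the truncated average expands over pairs of permutations
    [t, t'], and the bound on a pair only depends on the relative permutation,
    which is uniform when [t] is fixed. *)
Lemma core_le (ind : 'S_n -> T * T -> R) (p eta : R) (B : 'S_n -> R) : 0 < eta ->
  (forall t, measurable_fun setT (ind t)) -> (forall t x, 0 <= ind t x <= 1) ->
  (forall t, \int[iid gam N]_a \int[iid gam N]_b
    (lr r a b t * (1 - ind t (a, b)))%:E <= p%:E)%E ->
  (forall t t', \int[iid gam N]_a \int[iid gam N]_b
    (lr r a b t * ind t (a, b) * (lr r a b t' * ind t' (a, b)))%:E <=
    (B (t * t'^-1)%g)%:E)%E ->
  (core n r <= (p + eta / 2 +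
    ((n`!%:R^-1 * \sum_(s : 'S_n) B s - 1) + 2 * p) / (2 * eta))%:E)%E.
Proof.
move=> eta0 mind ind01 bad sq.
have nf0 : 0 < n`!%:R :> R by rewrite ltr0n fact_gt0.
have nfI : 0 <= n`!%:R^-1 :> R by rewrite invr_ge0 ltW.
have ind0 t x : 0 <= ind t x by case/andP : (ind01 t x).
have ind1 t x : 0 <= 1 - ind t x by rewrite subr_ge0; case/andP : (ind01 t x).
pose f (x : T * T) := avg_lr r x.1 x.2.
pose g (x : T * T) := n`!%:R^-1 * \sum_(t : 'S_n) (lr r x.1 x.2 t * ind t x).
have mf : measurable_fun setT f.
  by apply: measurable_avg_lr; [exact: measurable_fst|exact: measurable_snd].
have mli t : measurable_fun setT (fun x : T * T => lr r x.1 x.2 t * ind t x).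
  exact: measurable_funM.
have mg : measurable_fun setT g.
  by apply: measurable_funM; [exact: measurable_cst|exact: measurable_sum].
have li0 t (x : T * T) : 0 <= lr r x.1 x.2 t * ind t x by rewrite mulr_ge0// lr_ge0.
have avg0 (F : 'S_n -> T * T -> R) :
    (forall t, measurable_fun setT (F t)) -> (forall t x, 0 <= F t x) ->
    (\int[mu]_x (n`!%:R^-1 * \sum_(t : 'S_n) F t x)%:E =
     n`!%:R^-1%:E * \sum_(t : 'S_n) \int[mu]_x (F t x)%:E)%E.
  move=> mF F0; rewrite integral_scale//; last 2 first.
  - exact: measurable_sum.
  - by move=> x; exact: sumr_ge0.
  congr (_ * _)%E; under eq_integral do rewrite -sumEFin.
  rewrite ge0_integral_sum//; last by move=> t x _; rewrite lee_fin.
  by move=> t; exact/measurable_EFinP.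
have avg (F : 'S_n -> T * T -> R) :
    (forall t, measurable_fun setT (F t)) -> (forall t x, 0 <= F t x) ->
    (\int[mu]_x (n`!%:R^-1 * \sum_(t : 'S_n) F t x)%:E =
     n`!%:R^-1%:E * \sum_(t : 'S_n) \int[iid gam N]_a \int[iid gam N]_b (F t (a, b))%:E)%E.
  move=> mF F0; rewrite avg0//; congr (_ * _)%E.
  apply: eq_bigr => t _; rewrite fubini_tonelli1//; first exact/measurable_EFinP.
  by move=> x; rewrite lee_fin.
have coreE : core n r = (\int[mu]_x (`|f x - 1|)%:E)%E.
  rewrite fubini_tonelli1//.
  by apply: measurable_core_integrand; [exact: measurable_fst|exact: measurable_snd].
rewrite coreE; apply: (@truncated_l1 _ _ _ _ f g) => //.
- move=> x; rewrite mulr_ge0 ?sumr_ge0//= /g /f /avg_lr ler_wpM2l//.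
  apply: ler_sum => t _; apply: ler_piMr; first exact: lr_ge0.
  by case/andP : (ind01 t x).
- rewrite /f /avg_lr avg//; last by move=> t x; exact: lr_ge0.
  under eq_bigr do rewrite lr_mass.
  rewrite (_ : (\sum_(t : 'S_n) 1 = n`!%:R%:E :> \bar R)%E); last first.
    by rewrite (eq_bigr (fun _ => 1%R%:E))// sumEFin sumr_const card_Sn.
  by rewrite -EFinM mulVf ?gt_eqF.
- have fgE x : f x - g x = n`!%:R^-1 * \sum_(t : 'S_n) (lr r x.1 x.2 t * (1 - ind t x)).
    rewrite /f /g /avg_lr -mulrBr -sumrB; congr (_ * _); apply: eq_bigr => t _; ring.
  under eq_integral do rewrite fgE.
  rewrite avg; last 2 first.
  + by move=> t; apply: measurable_funM => //; apply: measurable_funB => //; exact: measurable_cst.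
  + by move=> t x; rewrite mulr_ge0// lr_ge0.
  apply: (@le_trans _ _ (n`!%:R^-1%:E * \sum_(t : 'S_n) p%:E)%E).
    by rewrite lee_wpmul2l ?lee_fin//; apply: lee_sum => t _; exact: bad.
  by rewrite sumEFin sumr_const card_Sn -EFinM -[X in _ * X]mulr_natl mulrA mulVf ?mul1r ?gt_eqF.
- have g2E x : g x ^+ 2 = n`!%:R^-1 * \sum_(t : 'S_n) (n`!%:R^-1 *
      \sum_(t' : 'S_n) (lr r x.1 x.2 t * ind t x * (lr r x.1 x.2 t' * ind t' x))).
    rewrite /g exprMn expr2 -mulrA -mulr_sumr; congr (_ * (_ * _)).
    rewrite expr2 mulr_suml; apply: eq_bigr => t _; exact: mulr_sumr.
  under eq_integral do rewrite g2E.
  have mll t t' : measurable_fun setT (fun x : T * T =>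
      lr r x.1 x.2 t * ind t x * (lr r x.1 x.2 t' * ind t' x)) by exact: measurable_funM.
  have ll0 t t' (x : T * T) :
      0 <= lr r x.1 x.2 t * ind t x * (lr r x.1 x.2 t' * ind t' x) by rewrite mulr_ge0.
  rewrite (avg0 (fun t x => n`!%:R^-1 *
      \sum_(t' : 'S_n) (lr r x.1 x.2 t * ind t x * (lr r x.1 x.2 t' * ind t' x)))); last 2 first.
  + move=> t; apply: measurable_funM; first exact: measurable_cst.
    by apply: measurable_sum => t'.
  + by move=> t x; rewrite mulr_ge0// sumr_ge0.
  apply: (@le_trans _ _ (n`!%:R^-1%:E * \sum_(t : 'S_n)
      (n`!%:R^-1 * \sum_(s : 'S_n) B s)%:E)%E).
    rewrite lee_wpmul2l ?lee_fin//; apply: lee_sum => t _; rewrite avg//.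
    rewrite EFinM lee_wpmul2l ?lee_fin// -sumEFin.
    rewrite [leRHS](reindex_inj (mulgI t)) [leRHS](reindex_inj invg_inj) /=.
    by apply: lee_sum => t' _; exact: sq.
  rewrite sumEFin sumr_const card_Sn -EFinM -[X in (n`!%:R^-1 * X)%:E]mulr_natl mulrA.
  by rewrite mulVf ?mul1r ?gt_eqF// lee_fin subrKC.
Qed.

End TwoGraphs.

(** * Moments of the truncated likelihood ratio *)

Section Moments.
Context (R : realType) (N : nat) (r : R).
Hypothesis r01 : 0 <= r < 1.
Local Notation gam := (gam R).
Local Notation T := (N.-tuple R).
Implicit Types (p : {perm 'I_N}) (a b : T).

Let q := r ^+ 2.
Let q01 : 0 <= q < 1.
Proof. by case/andP : r01 => r0 r1; rewrite sqr_ge0 expr_lt1. Qed.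
Let q1 : r ^+ 2 < 1. Proof. by case/andP : q01. Qed.

Definition plr p a b : R := \prod_(e < N) mehler r (tnth a e) (tnth b (p e)).

Lemma plr_tilt p (E0 : {set 'I_N}) (s : R) : 2 * r * s + s ^+ 2 * (1 - r ^+ 2) < 1 ->
  (\int[iid gam N]_a \int[iid gam N]_b
    (plr p a b * \prod_(e in E0) expR (s * tnth a e * tnth b (p e)))%:E =
   ((Num.sqrt (1 - (2 * r * s + s ^+ 2 * (1 - r ^+ 2))))^-1 ^+ #|E0|)%:E)%E.
Proof.
move=> rs1.
pose Phi e x y := (mehler r x y * (if e \in E0 then expR (s * x * y) else 1))%:E.
transitivity (\int[iid gam N]_a \int[iid gam N]_b
    \prod_(e < N) Phi e (tnth a e) (tnth b (p e)))%E.
  apply: eq_integral => a _; apply: eq_integral => b _.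
  by rewrite prodEFin big_split /= -big_mkcond.
rewrite (iid2_prod_relabel p (Phi := Phi)); last 2 first.
- move=> e; apply/measurable_EFinP; apply: measurable_funM.
    by apply: measurable_mehler; [exact: measurable_fst|exact: measurable_snd].
  case: (e \in E0); last exact: measurable_cst.
  apply: measurableT_comp => //; apply: measurable_funM => //.
  by apply: measurable_funM => //; exact: measurable_cst.
- by move=> e x y; rewrite lee_fin mulr_ge0 ?mehler_ge0//; case: ifP => // _; exact: expR_ge0.
rewrite (eq_bigr (fun e => (if e \in E0 then
    (Num.sqrt (1 - (2 * r * s + s ^+ 2 * (1 - r ^+ 2))))^-1 else 1)%:E)).
  by rewrite prodEFin -big_mkcond prodr_const.
move=> e _; rewrite /Phi; case: ifP => _; first by rewrite edge_mgf.
under eq_integral do under eq_integral do rewrite mulr1.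
under eq_integral do rewrite mehler_mass//.
by rewrite integral_cst//= probability_setT mule1.
Qed.

Definition tilt : R := r / (1 - r ^+ 2).

(** Integrating out the second graph leaves kernels that join each edge to its
    image by the relative permutation [sigma]. On [E0], which [sigma] fixes
    pointwise, these kernels depend on one variable and the exponential tilt can
    be included; the others are dealt with by [cycles_integral_le]. *)
Lemma plr_square_le p p' (E0 : {set 'I_N}) (k : R) (c : 'I_N -> R) : 0 <= k ->
  (forall e, e \in E0 -> p e = p' e) ->
  (forall e, 1 <= c e) ->
  (forall e, e \notin E0 -> (1 - q ^+ #|porbit (p * p'^-1)%g e|)^-1 <= c e) ->
  (\int[iid gam N]_a \int[iid gam N]_b
    (plr p a b * plr p' a b *
     \prod_(e in E0) (k * expR (- tilt * tnth a e * tnth b (p e))))%:E <=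
   ((k * (Num.sqrt (1 + r ^+ 2 + r ^+ 4))^-1) ^+ #|E0| *
     \prod_(e in ~: E0) c e)%:E)%E.
Proof.
move=> k0 pE0 c1 cE0; set sigma := (p * p'^-1)%g.
have sigma_fix e : e \in E0 -> sigma e = e by move=> eE; rewrite permM pE0// permK.
pose H x y := mehler r x y * mehler r x y * (k * expR (- tilt * x * y)).
have mH : measurable_fun setT (fun z : R * R => H z.1 z.2).
  have mm : measurable_fun setT (fun z : R * R => mehler r z.1 z.2).
    by apply: measurable_mehler; [exact: measurable_fst|exact: measurable_snd].
  apply: measurable_funM; first exact: measurable_funM.
  apply: measurable_funM; first exact: measurable_cst.
  apply: measurableT_comp => //; apply: measurable_funM => //.
  by apply: measurable_funM => //; exact: measurable_cst.
have H0 x y : 0 <= H x y by rewrite !mulr_ge0 ?mehler_ge0 ?expR_ge0.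
pose Psi a e y : \bar R := (if e \in E0 then H (tnth a e) y else
  mehler r (tnth a e) y * mehler r y (tnth a (sigma e)))%:E.
have PsiE a b : ((plr p a b * plr p' a b *
    \prod_(e in E0) (k * expR (- tilt * tnth a e * tnth b (p e))))%:E =
    \prod_(e < N) Psi a e (tnth b (p e)))%E.
  rewrite prodEFin /plr [X in _ * X * _](reindex_inj (@perm_inj _ sigma)) /=.
  rewrite [X in _ * X]big_mkcond -!big_split /=; congr _%:E; apply: eq_bigr => e _.
  have -> : p' (sigma e) = p e by rewrite permM permKV.
  case: ifPn => eE; last by rewrite mulr1 (mehlerC r (tnth a (sigma e))).
  by rewrite sigma_fix.
pose kap x := (\int[gam]_y (H x y)%:E)%E.
have mkap : measurable_fun setT kap.
  apply: (measurable_fun_fubini_tonelli_F (fun z : R * R => (H z.1 z.2)%:E)).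
    exact/measurable_EFinP.
  by move=> z; rewrite lee_fin.
have kap0 x : (0 <= kap x)%E by apply: integral_ge0 => y _; rewrite lee_fin.
have Psi0 a e y : (0 <= Psi a e y)%E.
  by rewrite lee_fin; case: ifP => _ //; rewrite mulr_ge0// mehler_ge0.
pose g a := (\prod_(e < N) (if e \in E0 then kap (tnth a e) else 1))%E.
have inner a : (\int[iid gam N]_b (plr p a b * plr p' a b *
    \prod_(e in E0) (k * expR (- tilt * tnth a e * tnth b (p e))))%:E =
    (\prod_(e in ~: E0) mehler q (tnth a e) (tnth a (sigma e)))%:E * g a)%E.
  under eq_integral do rewrite PsiE.
  rewrite (iid_prod_relabel gam p)//; last first.
    move=> e; apply/measurable_EFinP; case: (e \in E0).
      exact: (measurableT_comp mH (pair1_measurable (tnth a e))).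
    by apply: measurable_funM; apply: measurable_mehler => //; exact: measurable_cst.
  rewrite -prodEFin [X in (X * _)%E]big_mkcond /= -big_split; apply: eq_bigr => e _.
  rewrite /Psi finset.in_setC /=; case: (e \in E0) => /=; first by rewrite mul1e.
  rewrite mule1; under eq_integral do rewrite EFinM.
  by rewrite mehler_semigroup.
under eq_integral do rewrite inner.
have mg : measurable_fun setT g.
  apply: measurable_eprod => e; case: (e \in E0); last exact: measurable_cst.
  exact: (measurableT_comp mkap (measurable_tnth e)).
have g0 a : (0 <= g a)%E by apply: eprod_ge0 => e; case: ifP.
apply: le_trans (cycles_integral_le (c := c) q01 _ _ _ _ _ _) _ => //.
- by move=> e; rewrite inE; exact: cE0.
- move=> e; rewrite !inE; apply: contra => seE.
  by have := sigma_fix _ seE; move/perm_inj => <-.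
- move=> z zE a y; apply: eq_bigr => e _.
  have [->|ez] := eqVneq e z; last by rewrite tnth_upd (negbTE ez).
  by rewrite finset.in_setC in zE; rewrite (negbTE zE).
rewrite muleC EFinM; apply: lee_wpmul2r.
  by rewrite lee_fin prodr_ge0// => e _; exact: le_trans (c1 e).
rewrite /g (@iid_prod _ _ _ gam N (fun e x => if e \in E0 then kap x else 1%E)); last 2 first.
- by move=> e; case: (e \in E0) => //; exact: measurable_cst.
- by move=> e x; case: ifP.
rewrite (eq_bigr (fun e => (if e \in E0 then
    k * (Num.sqrt (1 + r ^+ 2 + r ^+ 4))^-1 else 1)%:E)).
  by rewrite prodEFin -big_mkcond prodr_const.
move=> e _; case: ifP => _; last by rewrite integral_cst//= probability_setT mule1.
have mtilt : measurable_fun setT (fun z : R * R =>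
    mehler r z.1 z.2 * mehler r z.1 z.2 * expR (- tilt * z.1 * z.2)).
  have mm : measurable_fun setT (fun z : R * R => mehler r z.1 z.2).
    by apply: measurable_mehler; [exact: measurable_fst|exact: measurable_snd].
  apply: measurable_funM; first exact: measurable_funM.
  apply: measurableT_comp => //; apply: measurable_funM => //.
  by apply: measurable_funM => //; exact: measurable_cst.
have tilt0 x y : 0 <= mehler r x y * mehler r x y * expR (- tilt * x * y).
  by rewrite !mulr_ge0 ?mehler_ge0 ?expR_ge0.
rewrite EFinM -edge_square// -ge0_integralZl//.
- apply: eq_integral => x _; rewrite /kap -integral_scale//.
    by apply: eq_integral => y _; rewrite /H mulrCA.
  exact: (measurableT_comp mtilt (pair1_measurable x)).
- apply: (measurable_fun_fubini_tonelli_F (fun z : R * R =>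
    (mehler r z.1 z.2 * mehler r z.1 z.2 * expR (- tilt * z.1 * z.2))%:E)).
    exact/measurable_EFinP.
  by move=> z; rewrite lee_fin.
- by move=> x _; apply: integral_ge0 => y _; rewrite lee_fin.
Qed.

End Moments.

Section Truncation.
Context (R : realType) (N : nat) (J : finType) (E : J -> {set 'I_N}) (P : pred J).
Context (r d : R).
Hypothesis r01 : 0 <= r < 1.
Local Notation gam := (gam R).
Local Notation T := (N.-tuple R).
Implicit Types (p : {perm 'I_N}) (a b : T) (x : T * T).

Lemma one_sub_prod_le (F : J -> R) : (forall j, 0 <= F j <= 1) ->
  1 - \prod_(j | P j) F j <= \sum_(j | P j) (1 - F j).
Proof.
move=> F01; suff: 1 - \prod_(j | P j) F j <= \sum_(j | P j) (1 - F j) /\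
    0 <= \prod_(j | P j) F j <= 1 by case.
elim/big_rec2 : _ => [|j x y Pj [IH /andP[x0 x1]]]; first by rewrite subrr !lexx ler01.
have /andP[f0 f1] := F01 j; split; last by rewrite mulr_ge0//= mulr_ile1.
nra.
Qed.

Definition overlap p (j : J) x : R := \sum_(e in E j) tnth x.1 e * tnth x.2 (p e).
Definition tame_at p j x : bool := overlap p j x <= #|E j|%:R * (r + d).

(** Indicator of the event that the overlaps of the aligned graphs do not exceed
    their mean [#|E j| * r] too much, on all the sets of edges considered. *)
Definition tame p x : R := \prod_(j | P j) (tame_at p j x)%:R.

Lemma measurable_overlap p j : measurable_fun setT (overlap p j).
Proof.
rewrite /overlap; under eq_fun do rewrite -big_enum; apply: measurable_sum => e.
apply: measurable_funM.
  exact: (measurableT_comp (measurable_tnth e) measurable_fst).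
exact: (measurableT_comp (measurable_tnth (p e)) measurable_snd).
Qed.

Lemma measurable_tame_at p j : measurable_fun setT (fun x => (tame_at p j x)%:R : R).
Proof.
rewrite (_ : (fun x => _) = \1_(overlap p j @^-1` `]-oo, #|E j|%:R * (r + d)]%classic)).
  apply: measurable_indic; rewrite -[X in measurable X]setTI.
  by apply: (measurable_overlap p j) => //; exact: measurable_itv.
apply/funext => x; rewrite indicE /tame_at; congr (_%:R : R); congr nat_of_bool.
by apply/idP/idP; rewrite inE /= in_itv.
Qed.

Lemma measurable_tame p : measurable_fun setT (tame p).
Proof.
rewrite /tame; under eq_fun do rewrite big_mkcond /=.
apply: measurable_prod => j _; case: (P j); last exact: measurable_cst.
exact: measurable_tame_at.
Qed.

Let bool01 (b : bool) : 0 <= (b%:R : R) <= 1.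
Proof. by case: b; rewrite /= ?lexx ?ler01. Qed.

Lemma tame01 p x : 0 <= tame p x <= 1.
Proof.
rewrite /tame prodr_ge0/=; last by move=> j _; case/andP : (bool01 (tame_at p j x)).
by apply: prodr_ile1 => j _; exact: bool01.
Qed.

Lemma prod_tilt (lam : R) p j x :
  \prod_(e in E j) (expR (lam * (r + d)) * expR (- lam * tnth x.1 e * tnth x.2 (p e))) =
  expR (lam * (#|E j|%:R * (r + d) - overlap p j x)).
Proof.
under eq_bigr do rewrite -expRD.
rewrite -expR_sum; congr expR; rewrite big_split /= sumr_const /overlap mulrBr.
congr (_ + _); first by rewrite -mulr_natl; ring.
by rewrite mulr_sumr -sumrN; apply: eq_bigr => e _; ring.
Qed.

(** An indicator of [X <= c] is at most [exp (lam * (c - X))]. *)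
Lemma tame_le_tilt (lam : R) p j x : 0 <= lam -> P j ->
  tame p x <= \prod_(e in E j)
    (expR (lam * (r + d)) * expR (- lam * tnth x.1 e * tnth x.2 (p e))).
Proof.
move=> lam0 Pj; rewrite prod_tilt.
apply: (@le_trans _ _ (tame_at p j x)%:R).
  rewrite /tame (bigD1 j)//=; apply: ler_piMr; first by case/andP : (bool01 (tame_at p j x)).
  by apply: prodr_ile1 => i _; exact: bool01.
rewrite /tame_at; case: (leP (overlap p j x)) => le /=; last exact: expR_ge0.
by rewrite -[leLHS]expR0 ler_expR mulr_ge0// subr_ge0.
Qed.

(** Chernoff's bound, for each of the sets of edges of the truncation. *)
Lemma plr_untame p (s : R) : 0 <= s -> 2 * r * s + s ^+ 2 * (1 - r ^+ 2) < 1 ->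
  (\int[iid gam N]_a \int[iid gam N]_b (plr r p a b * (1 - tame p (a, b)))%:E <=
   (\sum_(j | P j) (expR (- (s * (r + d))) *
     (Num.sqrt (1 - (2 * r * s + s ^+ 2 * (1 - r ^+ 2))))^-1) ^+ #|E j|)%:E)%E.
Proof.
move=> s0 rs1.
have mplr : measurable_fun setT (fun x : T * T => plr r p x.1 x.2).
  apply: measurable_prod => e _; apply: measurable_mehler.
    exact: (measurableT_comp (measurable_tnth e) measurable_fst).
  exact: (measurableT_comp (measurable_tnth (p e)) measurable_snd).
have plr0 a b : 0 <= plr r p a b by apply: prodr_ge0 => e _; exact: mehler_ge0.
pose F j x : R := plr r p x.1 x.2 *
  (\prod_(e in E j) (expR (- s * (r + d)) * expR (- - s * tnth x.1 e * tnth x.2 (p e)))).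
have mF j : measurable_fun setT (F j).
  apply: measurable_funM => //; under eq_fun do rewrite (prod_tilt (- s)).
  apply: measurableT_comp => //; apply: measurable_funM; first exact: measurable_cst.
  by apply: measurable_funB; [exact: measurable_cst|exact: measurable_overlap].
have F0 j x : 0 <= F j x by rewrite mulr_ge0// prod_tilt expR_ge0.
have mL : measurable_fun setT (fun x : T * T => plr r p x.1 x.2 * (1 - tame p x)).
  apply: measurable_funM => //; apply: measurable_funB; first exact: measurable_cst.
  exact: measurable_tame.
have L0 x : 0 <= plr r p x.1 x.2 * (1 - tame p x).
  by rewrite mulr_ge0// subr_ge0; case/andP : (tame01 p x).
have LF x : plr r p x.1 x.2 * (1 - tame p x) <= \sum_(j | P j) F j x.
  rewrite -mulr_sumr ler_wpM2l//.
  apply: le_trans (one_sub_prod_le (fun j => bool01 (tame_at p j x))) _.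
  apply: ler_sum => j _; rewrite prod_tilt /tame_at; case: (leP (overlap p j x)) => le.
    by rewrite subrr expR_ge0.
  by rewrite subr0 -[leLHS]expR0 ler_expR mulNr -mulrN opprB mulr_ge0// subr_ge0 ltW.
have mFsum : measurable_fun setT (fun x => \sum_(j | P j) F j x).
  under eq_fun do rewrite big_mkcond /=; apply: measurable_sum => j.
  by case: (P j) => //; exact: measurable_cst.
rewrite -(fubini_tonelli1 (fun x : T * T => (plr r p x.1 x.2 * (1 - tame p x))%:E)); last 2 first.
- exact/measurable_EFinP.
- by move=> x; rewrite lee_fin.
apply: (@le_trans _ _ (\int[(iid gam N \x iid gam N)%E]_x (\sum_(j | P j) F j x)%:E)%E).
  apply: ge0_le_integral => //.
  - by move=> x _; rewrite lee_fin.
  - exact/measurable_EFinP.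
  - exact/measurable_EFinP.
  - by move=> x _; rewrite lee_fin.
under eq_integral do rewrite -sumEFin -big_filter.
rewrite ge0_integral_sum//; last 2 first.
- by move=> j; exact/measurable_EFinP.
- by move=> j x _; rewrite lee_fin.
rewrite big_filter -sumEFin; apply: lee_sum => j Pj.
pose G x := plr r p x.1 x.2 * \prod_(e in E j) expR (s * tnth x.1 e * tnth x.2 (p e)).
have FG x : F j x = expR (- (s * (r + d))) ^+ #|E j| * G x.
  rewrite /F /G big_split /= prodr_const mulNr opprK; ring.
have mG : measurable_fun setT G.
  apply: measurable_funM => //; under eq_fun do rewrite -big_enum.
  apply: measurable_prod => e _; apply: measurableT_comp => //.
  apply: measurable_funM; last first.
    exact: (measurableT_comp (measurable_tnth (p e)) measurable_snd).
  apply: measurable_funM; first exact: measurable_cst.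
  exact: (measurableT_comp (measurable_tnth e) measurable_fst).
have G0 x : 0 <= G x by rewrite mulr_ge0// prodr_ge0// => e _; exact: expR_ge0.
under eq_integral do rewrite FG.
rewrite integral_scale ?exprn_ge0 ?expR_ge0// fubini_tonelli1; last 2 first.
- exact/measurable_EFinP.
- by move=> x; rewrite lee_fin.
by rewrite /fubini_F /G/= plr_tilt// -EFinM exprMn.
Qed.

(** The truncation may be dropped, or traded for the tilt on a set of edges that
    the two alignments map in the same way. *)
Lemma tame_square_le p p' (E0 : {set 'I_N}) (c : 'I_N -> R) : 0 <= d ->
  E0 = finset.set0 \/ (exists2 j, P j & E0 = E j) ->
  (forall e, e \in E0 -> p e = p' e) ->
  (forall e, 1 <= c e) ->
  (forall e, e \notin E0 -> (1 - (r ^+ 2) ^+ #|porbit (p * p'^-1)%g e|)^-1 <= c e) ->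
  (\int[iid gam N]_a \int[iid gam N]_b
    (plr r p a b * tame p (a, b) * (plr r p' a b * tame p' (a, b)))%:E <=
   ((expR (tilt r * (r + d)) * (Num.sqrt (1 + r ^+ 2 + r ^+ 4))^-1) ^+ #|E0| *
     \prod_(e in ~: E0) c e)%:E)%E.
Proof.
move=> d0 E0E pE0 c1 cE0.
have q1 : 0 < 1 - r ^+ 2 by case/andP : r01 => r0 r1; rewrite subr_gt0 expr_lt1.
have tilt0 : 0 <= tilt r by case/andP : r01 => r0 _; rewrite divr_ge0// ltW.
apply: le_trans (plr_square_le r01 (expR_ge0 _) pE0 c1 cE0).
have mplr (u : {perm 'I_N}) d' (U : measurableType d') (f g : U -> T) :
    measurable_fun setT f -> measurable_fun setT g ->
    measurable_fun setT (fun z => plr r u (f z) (g z)).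
  move=> mf mg; apply: measurable_prod => e _; apply: measurable_mehler.
    exact: (measurableT_comp (measurable_tnth e) mf).
  exact: (measurableT_comp (measurable_tnth (u e)) mg).
have plr0 u a b : 0 <= plr r u a b by apply: prodr_ge0 => e _; exact: mehler_ge0.
have t0 u x : 0 <= tame u x by case/andP : (tame01 u x).
have t1 u x : tame u x <= 1 by case/andP : (tame01 u x).
have mL : measurable_fun setT (fun x : T * T =>
    (plr r p x.1 x.2 * tame p (x.1, x.2) * (plr r p' x.1 x.2 * tame p' (x.1, x.2)))%:E).
  apply/measurable_EFinP.
  by apply: measurable_funM; apply: measurable_funM;
    rewrite ?(_ : (fun x : T * T => tame _ (x.1, x.2)) = tame _);
    do ?[exact: measurable_tame|by apply: mplr; [exact: measurable_fst|exact: measurable_snd]|by apply/funext => -[]].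
have mR : measurable_fun setT (fun x : T * T => (plr r p x.1 x.2 * plr r p' x.1 x.2 *
    \prod_(e in E0) (expR (tilt r * (r + d)) * expR (- tilt r * tnth x.1 e * tnth x.2 (p e))))%:E).
  apply/measurable_EFinP; apply: measurable_funM.
    by apply: measurable_funM; apply: mplr; [exact: measurable_fst|exact: measurable_snd
      |exact: measurable_fst|exact: measurable_snd].
  under eq_fun do rewrite -big_enum.
  apply: measurable_prod => e _; apply: measurable_funM; first exact: measurable_cst.
  apply: measurableT_comp => //; apply: measurable_funM; last first.
    exact: (measurableT_comp (measurable_tnth (p e)) measurable_snd).
  apply: measurable_funM; first exact: measurable_cst.
  exact: (measurableT_comp (measurable_tnth e) measurable_fst).
have L0 a b : (0 <= (plr r p a b * tame p (a, b) * (plr r p' a b * tame p' (a, b)))%:E)%E.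
  by rewrite lee_fin !mulr_ge0.
have prod0 a b : 0 <= \prod_(e in E0) (expR (tilt r * (r + d)) *
    expR (- tilt r * tnth a e * tnth b (p e))).
  by apply: prodr_ge0 => e _; rewrite mulr_ge0 ?expR_ge0.
have R0 a b : (0 <= (plr r p a b * plr r p' a b *
    \prod_(e in E0) (expR (tilt r * (r + d)) * expR (- tilt r * tnth a e * tnth b (p e))))%:E)%E.
  by rewrite lee_fin !mulr_ge0.
have tame_le a b : tame p (a, b) <= \prod_(e in E0)
    (expR (tilt r * (r + d)) * expR (- tilt r * tnth a e * tnth b (p e))).
  case: E0E => [->|[j Pj ->]]; first by rewrite big_set0.
  exact: (@tame_le_tilt (tilt r) p j (a, b)).
apply: ge0_le_integral => //.
- by move=> a _; apply: integral_ge0 => b _.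
- exact: (measurable_fun_fubini_tonelli_F _ mL (fun x => L0 x.1 x.2)).
- exact: (measurable_fun_fubini_tonelli_F _ mR (fun x => R0 x.1 x.2)).
move=> a _; apply: ge0_le_integral => //.
- exact: (measurableT_comp mL (pair1_measurable a)).
- exact: (measurableT_comp mR (pair1_measurable a)).
move=> b _; rewrite lee_fin mulrACA; apply: ler_wpM2l; first exact: mulr_ge0.
by apply: le_trans (tame_le a b); apply: ler_piMr.
Qed.

End Truncation.

(** * The permutation of the edges induced by a permutation of the vertices *)

Lemma set2_eqP (T : finType) (i j k l : T) : k != l ->
  ([set i; j] = [set k; l])%SET -> (i = k /\ j = l) \/ (i = l /\ j = k).
Proof.
move=> kl E; have : (k \in [set i; j])%SET by rewrite E !inE eqxx.
have : (l \in [set i; j])%SET by rewrite E !inE eqxx orbT.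
have : (i \in [set k; l])%SET by rewrite -E !inE eqxx.
have : (j \in [set k; l])%SET by rewrite -E !inE eqxx orbT.
rewrite !inE => /orP[] /eqP -> /orP[] /eqP ->; rewrite ?eqxx ?(negbTE kl) ?[l == k]eq_sym
  ?(negbTE kl) //=; by [left|right].
Qed.

Section EdgeCounts.
Context (n : nat) (s : 'S_n).
Local Notation N := (nedge n).
Implicit Types (i j : 'I_n) (e : 'I_N).

Definition fixpts : {set 'I_n} := [set i | s i == i]%SET.
(** The smaller point of each 2-cycle. *)
Definition swaps : {set 'I_n} := [set i : 'I_n | (i < s i)%N && (s (s i) == i)]%SET.

Definition edges_in (S : {set 'I_n}) : {set 'I_N} := [set e | vs e \subset S]%SET.

Lemma vs_pair e : exists i j, [/\ i != j, vs e = [set i; j]%SET &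
  vs (eperm s e) = [set s i; s j]%SET].
Proof.
have /eqP/cards2P[i [j [ij eE]]] := card_vs e.
by exists i, j; split => //; rewrite vs_eperm eE imsetU1 imset_set1.
Qed.

Lemma eperm_fixed e : e \in edges_in fixpts -> eperm s e = e.
Proof.
rewrite inE => eF; apply: vs_inj; rewrite vs_eperm.
rewrite -[RHS]imset_id; apply: eq_in_imset => i ie.
by have := fintype.subsetP eF _ ie; rewrite inE => /eqP.
Qed.

Lemma two_cycle_swaps i : s (s i) = i -> s i != i -> i \in swaps \/ s i \in swaps.
Proof.
move=> ssi si; rewrite !inE ssi !eqxx !andbT.
by case: (ltngtP i (s i)) => [|| /val_inj E]; [left|right|rewrite -E eqxx in si].
Qed.

(** Apart from the pairs of fixed points, a permutation fixes an edge when it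
    swaps its ends. *)
Lemma card_fixed_edges :
  (#|[set e | eperm s e == e] :\: edges_in fixpts| <= #|swaps|)%N.
Proof.
rewrite -(card_imset _ (@vs_inj n)).
apply: leq_trans (leq_imset_card (fun i => [set i; s i])%SET swaps).
apply/subset_leq_card/fintype.subsetP => A /imsetP[e].
rewrite !inE => /andP[eF /eqP ee] ->{A}.
have [i [j [ij eE]]] := vs_pair e; rewrite ee eE => /esym/(set2_eqP ij)[[si sj]|[si sj]].
  move: eF; rewrite eE => /negP[]; apply/fintype.subsetP => k.
  by rewrite !inE => /orP[] /eqP ->; rewrite ?si ?sj.
have [iS|iS] : i \in swaps \/ s i \in swaps.
  by apply: two_cycle_swaps; rewrite ?si ?sj 1?eq_sym.
  by apply/imsetP; exists i => //; rewrite si.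
by apply/imsetP; exists j; [rewrite -si|rewrite sj finset.setUC].
Qed.

Definition involuted : {set 'I_n} := [set i | (s i != i) && (s (s i) == i)]%SET.

Lemma card_involuted : (#|involuted| <= 2 * #|swaps|)%N.
Proof.
rewrite mul2n -addnn -{2}(card_imset swaps (@perm_inj _ s)).
apply: leq_trans (leq_card_setU _ _).
apply/subset_leq_card/fintype.subsetP => i; rewrite inE => /andP[si /eqP ssi].
rewrite inE; have [->//|sS] := two_cycle_swaps ssi si.
by apply/orP; right; apply/imsetP; exists (s i).
Qed.

(** If the square of [s] fixes an edge which [s] moves, then either it fixes both
    ends, and one of them is in a 2-cycle, or it swaps them, and one end
    determines the other. *)
Lemma card_two_orbits :
  (#|[set e | (eperm s e != e) && (eperm s (eperm s e) == e)]%SET| <=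
   2 * #|swaps| * n + n)%N.
Proof.
rewrite -(card_imset _ (@vs_inj n)).
pose A : {set {set 'I_n}} := [set [set i; j] | i in involuted, j in [set: 'I_n]]%SET.
pose B : {set {set 'I_n}} := [set [set i; s (s i)] | i in [set: 'I_n]]%SET.
have cA : (#|A| <= 2 * #|swaps| * n)%N.
  rewrite /A curry_imset2X; apply: leq_trans (leq_imset_card _ _) _.
  by rewrite cardsX cardsT card_ord leq_mul2r card_involuted orbT.
have cB : (#|B| <= n)%N.
  by apply: leq_trans (leq_imset_card _ _) _; rewrite cardsT card_ord.
apply: leq_trans (leq_add cA cB); apply: leq_trans (leq_card_setU A B).
apply/subset_leq_card/fintype.subsetP => V /imsetP[e].
rewrite inE => /andP[see /eqP sse] ->{V}.
have [i [j [ij eE seE]]] := vs_pair e.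
have sseE : [set s (s i); s (s j)]%SET = [set i; j]%SET.
  by rewrite -eE -{1}sse vs_eperm seE imsetU1 imset_set1.
have [[si sj]|[si sj]] := set2_eqP ij sseE; rewrite inE; apply/orP.
- left; have [fi|fi] := eqVneq (s i) i; have [fj|fj] := eqVneq (s j) j.
  + by case/eqP : see; apply: vs_inj; rewrite seE eE fi fj.
  + by apply/imset2P; exists j i; rewrite ?inE ?fj ?sj ?eqxx// eE finset.setUC.
  + by apply/imset2P; exists i j; rewrite ?inE ?fi ?si ?eqxx// eE.
  + by apply/imset2P; exists i j; rewrite ?inE ?fi ?si ?eqxx// eE.
- by right; apply/imsetP; exists i; rewrite ?inE// eE si.
Qed.

Lemma card_porbit_ge e : (1 + (eperm s e != e) +
  ((eperm s e != e) && (eperm s (eperm s e) != e)) <= #|porbit (eperm s) e|)%N.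
Proof.
set p := eperm s.
have pe (m : nat) : (iter m p e) \in porbit p e by rewrite -permX mem_porbit.
have [E|E] := eqVneq (p e) e; first by apply/card_gt0P; exists e; exact: porbit_id.
have [E2|E2] := eqVneq (p (p e)) e.
  apply: (@leq_trans #|[set e; p e]%SET|); first by rewrite cards2 eq_sym E.
  apply/subset_leq_card/fintype.subsetP => x.
  by move=> /set2P[] ->; [exact: (pe 0%N)|exact: (pe 1%N)].
apply: (@leq_trans #|p (p e) |: [set e; p e]|%SET).
  by rewrite cardsU1 cards2 !inE (negbTE E2) (inj_eq perm_inj) (negbTE E) eq_sym E.
apply/subset_leq_card/fintype.subsetP => x.
by move=> /finset.setU1P[->|/set2P[] ->]; [exact: (pe 2%N)|exact: (pe 0%N)|exact: (pe 1%N)].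
Qed.

End EdgeCounts.

Lemma prod_if_le (R : numDomainType) (T : finType) (A B : {set T}) (k : R) m :
  1 <= k -> (#|(A :&: B)%SET| <= m)%N ->
  \prod_(e in A) (if e \in B then k else 1) <= k ^+ m.
Proof.
move=> k1 ABm; rewrite -big_mkcondr /= (eq_bigl (mem (A :&: B)%SET)).
  by rewrite prodr_const ler_weXn2l.
by move=> e; rewrite /= inE.
Qed.

Section CoreBound.
Context (R : realType) (n : nat) (r d : R).
Hypothesis r01 : 0 <= r < 1.
Hypothesis d0 : 0 <= d.
Local Notation N := (nedge n).
Local Notation gam := (gam R).

Definition cyc (l : nat) : R := (1 - (r ^+ 2) ^+ l)^-1.

Lemma cyc_ge1 l : (0 < l)%N -> 1 <= cyc l.
Proof.
case/andP : r01 => r0 r1 l0.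
have q0 : 0 <= (r ^+ 2) ^+ l by rewrite exprn_ge0// sqr_ge0.
have q1 : (r ^+ 2) ^+ l < 1 by rewrite -exprM expr_lt1// muln_gt0.
by rewrite /cyc invf_ge1 ?subr_gt0// gerBl.
Qed.

Lemma cyc_le k l : (0 < k <= l)%N -> cyc l <= cyc k.
Proof.
case/andP : r01 => r0 r1 /andP[k0 kl].
have l0 : (0 < l)%N by exact: leq_trans kl.
rewrite /cyc lef_pV2 ?posrE ?subr_gt0 -?exprM ?expr_lt1 ?muln_gt0//.
by rewrite lerD2l lerN2 ler_wiXn2l ?leq_mul2l// ltW.
Qed.

(** Bound on a term of the truncated second moment, for a relative permutation with
    [k] fixed points and [j] cycles of length 2. The first factor comes from the
    pairs of fixed points, [cyc 1 ^+ j] from the edges whose ends are swapped, and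
    the rest from the edge cycles of length 2 and of length at least 3. *)
Definition sqbound (k j : nat) : R :=
  (if (n <= 4 * k)%N
   then expR (tilt r * (r + d)) * (Num.sqrt (1 + r ^+ 2 + r ^+ 4))^-1
   else cyc 1) ^+ 'C(k, 2) *
  (cyc 1 ^+ j * (cyc 2 ^+ (2 * j * n + n) * cyc 3 ^+ (n * n))).

Let tameV (t : 'S_n) := tame (@edges_in n) (fun S : {set 'I_n} => (n <= 4 * #|S|)%N) r d (eperm t).

Lemma tameV_square_le (t t' : 'S_n) :
  (\int[iid gam N]_a \int[iid gam N]_b
    (lr r a b t * tameV t (a, b) * (lr r a b t' * tameV t' (a, b)))%:E <=
   (sqbound #|fixpts (t * t'^-1)%g| #|swaps (t * t'^-1)%g|)%:E)%E.
Proof.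
set s := (t * t'^-1)%g; pose p := eperm s.
pose c e : R := if p e == e then cyc 1 else if p (p e) == e then cyc 2 else cyc 3.
have c1 e : 1 <= c e by rewrite /c; case: ifP => _; [|case: ifP => _]; exact: cyc_ge1.
have cP e : (1 - (r ^+ 2) ^+ #|porbit p e|)^-1 <= c e.
  rewrite -/(cyc _) /c; have := card_porbit_ge s e; rewrite -/p.
  by case: (p e == e) => /=; [|case: (p (p e) == e) => /=] => le; apply: cyc_le.
pose big := (n <= 4 * #|fixpts s|)%N.
pose E0 := if big then edges_in (fixpts s) else finset.set0.
have E0F e : e \in E0 -> p e = e.
  by rewrite /E0; case: ifP => _; [exact: eperm_fixed|rewrite inE].
have pE : p = (eperm t * (eperm t')^-1)%g by rewrite /p epermM epermV.
have := @tame_square_le R N {set 'I_n} (@edges_in n) (fun S => (n <= 4 * #|S|)%N) r d r01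
  (eperm t) (eperm t') E0 c d0.
rewrite -pE => /(_ _ _ c1 (fun e _ => cP e)) => H.
apply: le_trans (H _ _) _.
- by rewrite /E0 /big; case: ifP => b; [right; exists (fixpts s)|left].
- move=> e eE; have := E0F e eE; rewrite pE permM => E.
  by rewrite -[LHS](permKV (eperm t')) E.
rewrite lee_fin.
pose F1 := [set e | p e == e]%SET.
pose F2 := [set e | (p e != e) && (p (p e) == e)]%SET.
pose F3 := [set e | (p e != e) && (p (p e) != e)]%SET.
have -> : \prod_(e in ~: E0) c e = \prod_(e in ~: E0) (if e \in F1 then cyc 1 else 1) *
    (\prod_(e in ~: E0) (if e \in F2 then cyc 2 else 1) *
     \prod_(e in ~: E0) (if e \in F3 then cyc 3 else 1)).
  rewrite -!big_split /=; apply: eq_bigr => e _; rewrite /c !inE.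
  by case: (p e == e) => /=; [|case: (p (p e) == e)]; rewrite /= ?(mul1r, mulr1).
have cyc0 l : (0 < l)%N -> 0 <= cyc l by move=> l0; apply: le_trans (cyc_ge1 l0).
have if0 (A B : {set 'I_N}) l : (0 < l)%N -> 0 <= \prod_(e in A) (if e \in B then cyc l else 1).
  by move=> l0; apply: prodr_ge0 => e _; case: ifP => // _; exact: cyc0.
have rest23 : \prod_(e in ~: E0) (if e \in F2 then cyc 2 else 1) *
     \prod_(e in ~: E0) (if e \in F3 then cyc 3 else 1) <=
     cyc 2 ^+ (2 * #|swaps s| * n + n) * cyc 3 ^+ (n * n).
  apply: ler_pM; rewrite ?if0//; apply: prod_if_le; rewrite ?cyc_ge1//.
    apply: leq_trans (card_two_orbits s); apply: subset_leq_card.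
    exact: finset.subsetIr.
  apply: leq_trans (max_card _) _; rewrite card_ord.
  have := card_edges_in [set: 'I_n]%SET; rewrite cardsT card_ord => cE.
  rewrite -[leqLHS]card_ord -cardsT (_ : [set: 'I_N]%SET = [set e | vs e \subset [set: 'I_n]]%SET).
    rewrite cE bin2 leq_half_double -addnn; apply: leqW.
    exact: leq_trans (leq_mul (leqnn n) (leq_pred n)) (leq_addr _ _).
  by apply/setP => e; rewrite !inE finset.subsetT.
have fixE := card_fixed_edges s; rewrite -/p -/F1 in fixE.
have rest0 : 0 <= \prod_(e in ~: E0) (if e \in F2 then cyc 2 else 1) *
     \prod_(e in ~: E0) (if e \in F3 then cyc 3 else 1) by rewrite mulr_ge0 ?if0.
rewrite /sqbound -/big; move: rest23 rest0; rewrite /E0; case: (boolP big) => b rest23 rest0.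
- rewrite card_edges_in; apply: ler_pM => //.
  + by rewrite mulr_ge0 ?if0.
  apply: ler_pM; rewrite ?if0//; apply: prod_if_le; first exact: cyc_ge1.
  by apply: leq_trans fixE; rewrite finset.setDE finset.setIC.
- rewrite cards0 expr0 mul1r [leRHS]mulrA -exprD; apply: ler_pM; rewrite ?if0//.
  apply: prod_if_le; first exact: cyc_ge1.
  rewrite finset.setC0 finset.setTI -(cardsID (edges_in (fixpts s)) F1) leq_add//.
  rewrite -card_edges_in; apply: subset_leq_card; exact: finset.subsetIr.
Qed.

Definition untamed (u : R) : R :=
  \sum_(S : {set 'I_n} | (n <= 4 * #|S|)%N) (expR (- (u * (r + d))) *
     (Num.sqrt (1 - (2 * r * u + u ^+ 2 * (1 - r ^+ 2))))^-1) ^+ 'C(#|S|, 2).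
Definition mean_sqbound : R :=
  n`!%:R^-1 * \sum_(s : 'S_n) sqbound #|fixpts s| #|swaps s|.

Lemma core_bound (u eta : R) : 0 < eta -> 0 <= u ->
  2 * r * u + u ^+ 2 * (1 - r ^+ 2) < 1 ->
  (core n r <= (untamed u + eta / 2 +
    ((mean_sqbound - 1) + 2 * untamed u) / (2 * eta))%:E)%E.
Proof.
move=> eta0 u0 ru.
have r1 : r ^+ 2 < 1 by case/andP : r01 => r0 r1; rewrite expr_lt1.
apply: (@core_le _ _ _ r1 tameV _ eta (fun s => sqbound #|fixpts s| #|swaps s|)) => //.
- by move=> t; exact: measurable_tame.
- by move=> t x; exact: tame01.
- move=> t; rewrite /untamed; under eq_bigr do rewrite -card_edges_in.
  exact: plr_untame.
- by move=> t t'; exact: tameV_square_le.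
Qed.

End CoreBound.

(** * Fixed points and 2-cycles of a uniform permutation *)

Lemma card_perm_prescribed (T : finType) l (w w' : l.-tuple T) : uniq w ->
  (#|[set s : {perm T} | map s w == w' :> seq T]%SET| <= (#|T| - l)`!)%N.
Proof.
move=> uw; have [->|[s0]] := set_0Vmem [set s : {perm T} | map s w == w' :> seq T]%SET.
  by rewrite cards0.
rewrite inE => /eqP s0w.
pose W : {set T} := [set x in w]%SET.
have cW : #|(~: W)%SET| = (#|T| - l)%N.
  rewrite cardsCs finset.setCK; congr subn.
  by rewrite cardsE; move/card_uniqP : uw => ->; rewrite size_tuple.
rewrite -cW -card_perm -(card_imset _ (@mulIg _ (s0^-1)%g)).
apply/subset_leq_card/fintype.subsetP => u /imsetP[s]; rewrite inE => /eqP sw ->{u}.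
rewrite unfold_in; apply/fintype.subsetP => x; rewrite inE; apply: contraR.
rewrite !inE negbK permM => xw; apply/eqP.
have : map s w = map s0 w by rewrite sw s0w.
by move/eq_in_map => /(_ x xw) ->; rewrite permK.
Qed.

(** Double counting of the pairs of a permutation and a tuple [d1 ++ d2 ++ s d2],
    with [d1] an enumeration of the [k] fixed points and [d2] one of the [j]
    smaller points of 2-cycles. A permutation has [k! * j!] such tuples, and a
    tuple prescribes the permutation at all its points. *)
Lemma card_perm_fix_swap n k j :
  (#|[set s : 'S_n | (#|fixpts s| == k) && (#|swaps s| == j)]%SET| * (k`! * j`!)
   <= n`!)%N.
Proof.
set A := [set s | _]%SET; pose l := (k + (j + j))%N.
pose tgt (w : l.-tuple 'I_n) : seq 'I_n :=
  take k w ++ drop j (drop k w) ++ take j (drop k w).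
have szt w : size (tgt w) == l.
  rewrite /tgt !size_cat !size_takel ?size_drop ?size_tuple /l; last 2 first.
  - by rewrite addKn leq_addr.
  - exact: leq_addr.
  by rewrite addKn addKn.
pose ttgt w : l.-tuple 'I_n := Tuple (szt w).
pose cnt := (\sum_(w : l.-tuple 'I_n | uniq w)
  #|[set s : 'S_n | map s w == tgt w :> seq 'I_n]%SET|)%N.
apply: (@leq_trans cnt); last first.
  have [ln|nl] := leqP l n; last first.
    rewrite /cnt big1// => w uw; have := card_uniqP uw; rewrite size_tuple => cw.
    by have := max_card (mem w); rewrite cw card_ord leqNgt nl.
  apply: (@leq_trans (\sum_(w : l.-tuple 'I_n | uniq w) (n - l)`!)%N).
    apply: leq_sum => w uw; have := card_perm_prescribed (ttgt w) uw.
    by rewrite card_ord.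
  rewrite sum_nat_const.
  have := @card_uniq_tuples 'I_n l predT; rewrite card_ord => cu.
  rewrite -(ffact_fact ln) leq_mul2r; apply/orP; right.
  rewrite -cu; apply: subset_leq_card; apply/fintype.subsetP => w.
  by rewrite !inE => uw; apply/andP; split => //; exact/allP.
have -> : cnt = (\sum_(s : 'S_n) #|[set w : l.-tuple 'I_n | uniq w & (map s w == tgt w :> seq 'I_n)]%SET|)%N.
  rewrite /cnt; under eq_bigr do rewrite -sum1_card.
  rewrite (exchange_big_dep xpredT)//=; apply: eq_bigr => s _; rewrite -sum1_card.
  by apply: eq_bigl => w; rewrite !inE.
rewrite -sum_nat_const; apply: (@leq_trans (\sum_(s in A)
    #|[set w : l.-tuple 'I_n | uniq w & (map s w == tgt w :> seq 'I_n)]%SET|)%N); last first.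
  by rewrite [leqRHS](bigID (mem A)) leq_addr.
apply: leq_sum => s; rewrite inE => /andP[/eqP sk /eqP sj].
pose D1 := [set t : k.-tuple 'I_n | all (mem (fixpts s)) t & uniq t]%SET.
pose D2 := [set t : j.-tuple 'I_n | all (mem (swaps s)) t & uniq t]%SET.
have c1 : #|D1| = k`!.
  by rewrite /D1 card_uniq_tuples (eq_card (B := fixpts s))// sk ffactnn.
have c2 : #|D2| = j`!.
  by rewrite /D2 card_uniq_tuples (eq_card (B := swaps s))// sj ffactnn.
pose f (d : k.-tuple 'I_n * j.-tuple 'I_n) : l.-tuple 'I_n :=
  [tuple of d.1 ++ (d.2 ++ map s d.2)].
have f_inj : injective f.
  move=> [a b] [a' b'] /(congr1 val) /= /eqP.
  rewrite eqseq_cat ?size_tuple// => /andP[/eqP /val_inj -> ].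
  by rewrite eqseq_cat ?size_tuple// => /andP[/eqP /val_inj -> _].
rewrite -c1 -c2 -cardsX -(card_imset _ f_inj).
apply/subset_leq_card/fintype.subsetP => w /imsetP[[a b]].
rewrite finset.in_setX !inE /= => /andP[/andP[/allP aF ua] /andP[/allP bS ub]] ->{w}.
have bS' x : x \in b -> (x < s x)%N /\ s (s x) = x.
  by move=> /bS; rewrite /= inE => /andP[? /eqP].
apply/andP; split.
- rewrite /f /= !cat_uniq ua ub (map_inj_uniq (@perm_inj _ s)) ub /= andbT.
  apply/andP; split.
    apply/hasPn => x; rewrite mem_cat => xb; apply/negP => /aF; rewrite /= inE => /eqP sx.
    case/orP : xb => [/bS' [xs _]|/mapP[y /bS' [ys ssy] xE]].
      by rewrite sx ltnn in xs.
    by move: sx; rewrite xE ssy => ysE; rewrite -ysE ltnn in ys.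
  apply/hasPn => x /mapP[y /bS' [ys ssy] ->]; apply/negP => /bS' [].
  by rewrite ssy ltnNge ltnW.
- rewrite /tgt /f /= take_size_cat ?size_tuple// drop_size_cat ?size_tuple//.
  rewrite drop_size_cat ?size_tuple// take_size_cat ?size_tuple//.
  rewrite !map_cat; apply/eqP; congr (_ ++ (_ ++ _)).
    rewrite -[RHS]map_id; apply/eq_in_map => x /aF; by rewrite /= inE => /eqP.
  rewrite -map_comp -[RHS]map_id; apply/eq_in_map => x /bS' [_ ssx]; exact: ssx.
Qed.

Lemma mean_perm_le (R : realType) n (F : nat -> nat -> R) :
  (forall k j, 0 <= F k j) ->
  n`!%:R^-1 * \sum_(s : 'S_n) F #|fixpts s| #|swaps s| <=
  \sum_(k < n.+1) \sum_(j < n.+1) F k j / (k`!%:R * j`!%:R).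
Proof.
move=> F0; have nf0 : 0 < n`!%:R :> R by rewrite ltr0n fact_gt0.
have kn (S : {set 'I_n}) : (#|S| < n.+1)%N by rewrite ltnS (leq_trans (max_card _))// card_ord.
rewrite ler_pdivrMl// (partition_big (fun s : 'S_n => (Ordinal (kn (fixpts s)))) xpredT)//=.
rewrite mulr_sumr; apply: ler_sum => k _.
rewrite (partition_big (fun s : 'S_n => (Ordinal (kn (swaps s)))) xpredT)//=.
rewrite mulr_sumr; apply: ler_sum => j _.
pose A := [set s : 'S_n | (#|fixpts s| == k) && (#|swaps s| == j)]%SET.
rewrite (eq_bigr (fun _ => F k j)) => [|s /andP[/eqP <- /eqP <-]]//.
rewrite (eq_bigl (mem A)) => [|s]; last by rewrite /= inE.
rewrite sumr_const -[leLHS]mulr_natr [leRHS]mulrCA ler_wpM2l//.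
rewrite ler_pdivlMr ?mulr_gt0 ?ltr0n ?fact_gt0// -!natrM ler_nat.
exact: card_perm_fix_swap.
Qed.

(** * Elementary estimates *)

Section Estimates.
Context (R : realType).
Implicit Types (x y k : R).

Lemma inv1B_le_expR x : 0 <= x < 1 -> (1 - x)^-1 <= expR (x / (1 - x)).
Proof.
move=> /andP[x0 x1]; have x1' : 0 < 1 - x by rewrite subr_gt0.
apply: le_trans (expR_ge1Dx _); rewrite le_eqVlt; apply/orP; left; apply/eqP.
by field; rewrite gt_eqF.
Qed.

Lemma inv1B_le_expR2 x : 0 <= x <= 1 / 2 -> (1 - x)^-1 <= expR (x + 2 * x ^+ 2).
Proof.
move=> /andP[x0 x1]; apply: (le_trans (inv1B_le_expR _)); first by apply/andP; split; lra.
rewrite ler_expR ler_pdivrMr; last lra.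
rewrite -subr_ge0 (_ : _ - x = x ^+ 2 * (1 - 2 * x)); last by ring.
by rewrite mulr_ge0 ?sqr_ge0//; lra.
Qed.

Lemma invsqrt1B_le_expR x : 0 <= x <= 1 / 2 ->
  (Num.sqrt (1 - x))^-1 <= expR (x / 2 + x ^+ 2).
Proof.
move=> x01; have /andP[x0 x1] := x01.
apply: invsqrt_le; [lra|exact: expR_gt0|].
rewrite -expRM_natl -ler_pdivrMl; last lra.
rewrite mulr1 (_ : 2%:R * _ = x + 2 * x ^+ 2); last by field.
exact: inv1B_le_expR2.
Qed.

Lemma invsqrt1D_le_expR x : 0 <= x ->
  (Num.sqrt (1 + x))^-1 <= expR ((x ^+ 2 - x) / 2).
Proof.
move=> x0; apply: invsqrt_le; [lra|exact: expR_gt0|].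
rewrite -expRM_natl -ler_pdivrMl; last lra.
rewrite mulr1 (_ : 2%:R * _ = x ^+ 2 - x); last by field.
apply: le_trans (expR_ge1Dx _).
rewrite invf_ple ?posrE; [|lra|nra].
rewrite -[leLHS]mul1r ler_pdivrMr; last nra.
have := exprn_ge0 3 x0; nra.
Qed.

(** Concavity of the logarithm between [1] and [x], from [ln (1 + u) <= u] at
    [u = k^-1 - 1] and at [u = x / k - 1]. *)
Lemma ln_chord k x : 1 <= k -> k <= x -> (k - 1) * ln x <= (x - 1) * ln k.
Proof.
move=> k1 kx; have k0 : 0 < k by lra.
have x0 : 0 < x by lra.
have lnk : 1 - k^-1 <= ln k.
  have := @le_ln1Dx R (k^-1 - 1); rewrite subrKC lnV ?posrE//.
  have : 0 < k^-1 by rewrite invr_gt0.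
  by move=> ki /(_ _); lra.
have lnxk : ln x - ln k <= x / k - 1.
  have := @le_ln1Dx R (x / k - 1); rewrite subrKC ln_div ?posrE//.
  have : 0 < x / k by rewrite divr_gt0.
  by move=> ki /(_ _); lra.
have e1 : (k - 1) * (ln x - ln k) <= (k - 1) * (x / k - 1) by apply: ler_wpM2l => //; lra.
have e2 : (x - k) * (1 - k^-1) <= (x - k) * ln k by apply: ler_wpM2l => //; lra.
have e3 : (k - 1) * (x / k - 1) = (x - k) * (1 - k^-1) by field; rewrite gt_eqF.
lra.
Qed.

Lemma exp_sum_le x n : 0 <= x -> \sum_(j < n) x ^+ j / j`!%:R <= expR x.
Proof.
move=> x0; rewrite -(big_mkord xpredT (fun j => x ^+ j / j`!%:R)).
have nd : nondecreasing_seq (series (exp_coeff x)).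
  by apply: nondecreasing_series => j _ _; rewrite /exp_coeff/= divr_ge0// exprn_ge0.
have := @nondecreasing_cvgn_le R _ nd (is_cvg_series_exp_coeff x) n.
by [].
Qed.

Lemma natX_le_fact (k : nat) : k%:R ^+ k / k`!%:R <= expR k%:R :> R.
Proof.
case: k => [|k]; first by rewrite expr0 fact0 divr1 expR0.
by have := @expR_ge1Dxn R k.+1%:R k (ler0n _ _); apply: le_trans; rewrite lerDr.
Qed.

Lemma expRB1_le y : expR y - 1 <= y * expR y.
Proof.
have := expR_ge1Dx (- y); rewrite expRN => e.
have e0 := expR_gt0 y; rewrite -(ler_pM2l e0) mulfV ?gt_eqF// in e; lra.
Qed.

Lemma geometric_tail K n : \sum_(K <= i < n) (1 / 2) ^+ i <= 2 * (1 / 2) ^+ K :> R.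
Proof.
have h0 m : 0 <= (1 / 2) ^+ m :> R by rewrite exprn_ge0// divr_ge0.
have [nK|Kn] := leqP n K; first by rewrite big_geq// mulr_ge0.
have : \sum_(K <= i < n) (1 / 2) ^+ i = 2 * (1 / 2) ^+ K - 2 * (1 / 2) ^+ n :> R.
  rewrite (eq_bigr (fun i => - (2 * (1 / 2) ^+ i.+1 - 2 * (1 / 2) ^+ i))); last first.
    by move=> i _; rewrite exprS; field.
  by rewrite sumrN telescope_sumr ?(ltnW Kn)// opprB.
move=> ->; have := h0 n; lra.
Qed.

End Estimates.

(** * The regime below the threshold *)

Section Regime.
Context (R : realType) (n : nat) (eps r : R).
Local Notation L := (ln (n%:R : R)).
Local Notation T := (L / n%:R).
Hypothesis eps01 : 0 < eps <= 1.
Hypothesis r0 : 0 <= r.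
Hypothesis rT : r ^+ 2 <= (4 - eps) * T.
Hypothesis L9 : 9 <= L.
Hypothesis epsT : 400 * T <= eps.
Hypothesis epsL : 512 * 1024 <= eps ^+ 2 * L.

(** Margin above the mean that the truncation allows. Being of order
    [eps * sqrt T], it adds [O(eps * T)] to the exponent of a pair of fixed points,
    while Chernoff's bound on a set of [n / 4] vertices or more gains a factor
    [exp (- c * eps ^+ 2 * n * ln n)], which beats the number of sets. *)
Definition slack : R := eps / 32 * Num.sqrt T.
Local Notation d := slack.

Lemma ge10_of_ln : 10 <= n%:R :> R.
Proof.
have [n0|n0] := posnP n; first by move: L9; rewrite n0 ln0; lra.
have := @le_ln1Dx R (n%:R - 1); rewrite subrKC => /(_ _) H.
have : (1 : R) <= n%:R by rewrite ler1n.
move=> n1; have : -1 < n%:R - 1 :> R by [lra].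
move=> /H h; have := le_trans L9 h; rewrite lerBrDr; apply: le_trans; lra.
Qed.

Let n_gt0 : 0 < n%:R :> R. Proof. exact: lt_le_trans ge10_of_ln. Qed.
Lemma rate_gt0 : 0 < T. Proof. by rewrite divr_gt0//; exact: lt_le_trans L9. Qed.
Let T1 : T <= 1 / 400. Proof. by case/andP : eps01 => e0 e1; have := epsT; lra. Qed.
Let q4T : r ^+ 2 <= 4 * T.
Proof. by case/andP : eps01 => e0 e1; have := mulr_gt0 e0 rate_gt0; have := rT; lra. Qed.
Let q0 : 0 <= r ^+ 2. Proof. exact: sqr_ge0. Qed.
Let r_le : r <= 2 * Num.sqrt T.
Proof.
rewrite -(@ler_pXn2r _ 2%N) ?nnegrE ?mulr_ge0 ?sqrtr_ge0//.
rewrite exprMn sqr_sqrtr ?(ltW rate_gt0)//; have := q4T; lra.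
Qed.
Let d2 : d ^+ 2 = eps ^+ 2 / 1024 * T.
Proof. by rewrite /slack exprMn sqr_sqrtr ?(ltW rate_gt0)//; field; rewrite ?gt_eqF. Qed.

Lemma slack_ge0 : 0 <= d.
Proof. by rewrite mulr_ge0 ?sqrtr_ge0// divr_ge0// ltW//; case/andP : eps01. Qed.

Let rd_le : r * d <= eps / 16 * T.
Proof.
rewrite (_ : eps / 16 * T = 2 * Num.sqrt T * d); first by rewrite ler_wpM2r ?slack_ge0.
rewrite /slack -[in LHS](sqr_sqrtr (ltW rate_gt0)); field.
by rewrite ?gt_eqF.
Qed.

Lemma regime_r1 : r < 1.
Proof. by rewrite -(@expr_lt1 _ 2%N)//; have := q4T; have := T1; lra. Qed.

Local Notation y := (2 * r * d + d ^+ 2 * (1 - r ^+ 2)).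

Let y0 : 0 <= y.
Proof.
have r1 := regime_r1; move: slack_ge0; generalize slack => v v0.
apply: addr_ge0; first by rewrite mulr_ge0// mulr_ge0.
by apply: mulr_ge0; rewrite ?sqr_ge0// subr_ge0 expr_le1// ltW.
Qed.

Let y_le : y <= 2 * r * d + d ^+ 2.
Proof. by have := mulr_ge0 (sqr_ge0 d) q0; rewrite mulrBr mulr1; lra. Qed.

Let y_leT : y <= eps / 6 * T.
Proof.
have /andP[e0 e1] := eps01; apply: (le_trans y_le); rewrite d2 -mulrA.
have e2 : eps ^+ 2 <= eps by rewrite expr2 ler_piMr// ltW.
have := ler_wpM2r (ltW rate_gt0) e2; have := rd_le; have := mulr_gt0 e0 rate_gt0; lra.
Qed.

Lemma regime_y1 : y < 1.
Proof.
have /andP[e0 e1] := eps01; have := y_leT; have := T1.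
have : eps / 6 * T <= T by rewrite ler_piMl ?(ltW rate_gt0)//; lra.
lra.
Qed.

Let tail_factor : expR (- (d * (r + d))) * (Num.sqrt (1 - y))^-1 <=
  expR (- (eps ^+ 2 / 4096 * T)).
Proof.
have /andP[e0 e1] := eps01.
have yh : 0 <= y <= 1 / 2.
  rewrite y0/=; have := y_leT; have := T1.
  have : eps / 6 * T <= T by rewrite ler_piMl ?(ltW rate_gt0)//; lra.
  lra.
apply: (@le_trans _ _ (expR (- (d * (r + d))) * expR (y / 2 + y ^+ 2))).
  by rewrite ler_wpM2l ?expR_ge0// invsqrt1B_le_expR.
rewrite -expRD ler_expR.
have y2 : y ^+ 2 <= eps ^+ 2 / 4096 * T.
  have : y ^+ 2 <= (eps / 6 * T) ^+ 2.
    by apply: lerXn2r; rewrite ?nnegrE ?y_leT//; exact: le_trans y0 y_leT.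
  move/le_trans; apply.
  rewrite (_ : _ ^+ 2 = eps ^+ 2 * T * (T / 36)); last by field; rewrite ?gt_eqF.
  rewrite (_ : eps ^+ 2 / 4096 * T = eps ^+ 2 * T / 4096); last by field; rewrite ?gt_eqF.
  apply: ler_wpM2l; first exact: mulr_ge0 (sqr_ge0 _) (ltW rate_gt0).
  by have := T1; lra.
have yl := y_le; have dd := d2.
rewrite (_ : d * (r + d) = r * d + d ^+ 2); last by ring.
lra.
Qed.

Let binE (k : nat) : 'C(k, 2)%:R = k%:R * (k%:R - 1) / 2 :> R.
Proof.
have : ('C(k, 2) * 2 = k * k.-1)%N.
  by case: k => // k; rewrite bin2 muln2 /= -[RHS]odd_double_half oddM /= andNb.
move=> /(congr1 (fun i => i%:R : R)); rewrite !natrM => e.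
have -> : 'C(k, 2)%:R = k%:R * k.-1%:R / 2 :> R by rewrite -e mulfK.
by case: (k) => [|k']; rewrite ?mul0r// -natr1 addrK.
Qed.

(** A set of at least [n / 4] vertices spans [n ^+ 2 / 64] edges or more, each of
    which brings the factor of [tail_factor]; there are [2 ^ n] such sets. *)
Lemma untamed_le : untamed n r d d <= expR (- n%:R).
Proof.
have x0 : 0 <= expR (- (d * (r + d))) * (Num.sqrt (1 - y))^-1 :> R.
  by rewrite mulr_ge0 ?expR_ge0// invr_ge0 sqrtr_ge0.
have Cn (k : nat) : (n <= 4 * k)%N -> n%:R ^+ 2 / 64 <= 'C(k, 2)%:R :> R.
  have aux (a b : R) : 10 <= a -> a <= 4 * b -> a ^+ 2 / 64 <= b * (b - 1) / 2.
    move=> a10 ab; have : 0 <= (b - a / 4) * (b + a / 4 - 1) by apply: mulr_ge0; lra.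
    have : 0 <= a * (a - 8) by apply: mulr_ge0; lra.
    by move=> h1 h2; lra.
  by move=> nk; rewrite binE; apply: aux ge10_of_ln _; rewrite -natrM ler_nat.
apply: (@le_trans _ _ (\sum_(S : {set 'I_n} | (n <= 4 * #|S|)%N) expR (- (2 * n%:R)))).
  apply: ler_sum => S nS.
  apply: (@le_trans _ _ (expR (- (eps ^+ 2 / 4096 * T)) ^+ 'C(#|S|, 2))).
    by apply: lerXn2r; rewrite ?nnegrE ?expR_ge0//; exact: tail_factor.
  rewrite -expRM_natl ler_expR mulrN lerN2.
  apply: (@le_trans _ _ (n%:R ^+ 2 / 64 * (eps ^+ 2 / 4096 * T))); last first.
    apply: ler_wpM2r; last exact: Cn.
    by apply: mulr_ge0 (ltW rate_gt0); apply: mulr_ge0; [exact: sqr_ge0|rewrite invr_ge0 ler0n].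
  have aux (a l : R) : 0 < a -> 512 * 1024 <= eps ^+ 2 * l ->
      2 * a <= a ^+ 2 / 64 * (eps ^+ 2 / 4096 * (l / a)).
    move=> a0 el; have -> : a ^+ 2 / 64 * (eps ^+ 2 / 4096 * (l / a)) =
      (eps ^+ 2 * l / 64 / 4096) * a by field; rewrite ?gt_eqF.
    by rewrite ler_pM2r//; lra.
  exact: aux n_gt0 epsL.
rewrite big_mkcond /=; apply: (@le_trans _ _ (\sum_(S : {set 'I_n}) expR (- (2 * n%:R)))).
  by apply: ler_sum => S _; case: ifP => // _; exact: expR_ge0.
rewrite sumr_const -cardsT -powersetT card_powerset cardsT card_ord -[leLHS]mulr_natl.
have -> : expR (- (2 * n%:R)) = expR (- n%:R) * expR (- n%:R) :> R.
  by rewrite -expRD; congr expR; ring.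
rewrite mulrA; apply: ler_piMl; first exact: expR_ge0.
rewrite natrX expRN ler_pdivrMr ?expR_gt0// mul1r.
rewrite -[X in expR X]mulr1 expRM_natl; apply: lerXn2r; rewrite ?nnegrE ?expR_ge0//.
by have := @expR_ge1Dx R 1; lra.
Qed.

Let q_half : r ^+ 2 <= 1 / 2.
Proof. by have := q4T; have := T1; lra. Qed.

Lemma cyc1_le : cyc r 1 <= expR (4 * T).
Proof.
rewrite /cyc expr1; apply: le_trans (inv1B_le_expR2 _) _.
  by rewrite q0 q_half.
rewrite ler_expR; have aux (q t : R) : 0 <= t -> 0 <= q -> q <= (4 - eps) * t ->
    400 * t <= eps -> q + 2 * q ^+ 2 <= 4 * t.
  move=> t0 qq qt te; have /andP[e0 e1] := eps01.
  have et : 0 <= eps * t by rewrite mulr_ge0// ltW.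
  have q4 : q <= 4 * t by lra.
  have : q ^+ 2 <= (4 * t) ^+ 2 by apply: lerXn2r; rewrite ?nnegrE ?mulr_ge0.
  have := ler_wpM2r t0 te; lra.
exact: aux (ltW rate_gt0) q0 rT epsT.
Qed.

Lemma cyc2_le : cyc r 2 <= expR (32 * T ^+ 2).
Proof.
rewrite /cyc; apply: le_trans (inv1B_le_expR2 _) _.
  rewrite sqr_ge0/=; apply: le_trans q_half.
  by rewrite expr2 ler_piMr//; have := q_half; lra.
rewrite ler_expR; have aux (q t : R) : 0 <= t -> 0 <= q -> q <= 4 * t -> q <= 1 / 2 ->
    q ^+ 2 + 2 * (q ^+ 2) ^+ 2 <= 32 * t ^+ 2.
  move=> t0 qq q4 q2.
  have q16 : q ^+ 2 <= (4 * t) ^+ 2 by apply: lerXn2r; rewrite ?nnegrE ?mulr_ge0.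
  have q21 : q ^+ 2 <= 1 / 2 by nra.
  have : (q ^+ 2) ^+ 2 <= q ^+ 2 * (1 / 2) by rewrite expr2 ler_wpM2l ?sqr_ge0.
  lra.
exact: aux (ltW rate_gt0) q0 q4T q_half.
Qed.

Lemma cyc3_le : cyc r 3 <= expR (128 * T ^+ 3).
Proof.
have q3 : (r ^+ 2) ^+ 3 <= 1 / 2.
  apply: le_trans q_half; rewrite exprS ler_piMr// expr_le1//.
  by have := q_half; lra.
rewrite /cyc; apply: le_trans (inv1B_le_expR2 _) _.
  by rewrite q3 andbT exprn_ge0.
rewrite ler_expR; have aux (q t : R) : 0 <= t -> 0 <= q -> q <= 4 * t -> q ^+ 3 <= 1 / 2 ->
    q ^+ 3 + 2 * (q ^+ 3) ^+ 2 <= 128 * t ^+ 3.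
  move=> t0 qq q4 q2.
  have q64 : q ^+ 3 <= (4 * t) ^+ 3 by apply: lerXn2r; rewrite ?nnegrE ?mulr_ge0.
  have : (q ^+ 3) ^+ 2 <= q ^+ 3 * (1 / 2) by rewrite expr2 ler_wpM2l ?exprn_ge0.
  lra.
exact: aux (ltW rate_gt0) q0 q4T q3.
Qed.

(** For a pair of fixed points, the truncation halves the exponent [q] of the
    second moment, up to the slack. *)
Lemma tamed_le : expR (tilt r * (r + d)) * (Num.sqrt (1 + r ^+ 2 + r ^+ 4))^-1 <=
  expR ((2 - eps / 4) * T).
Proof.
have qq0 : 0 <= r ^+ 2 + r ^+ 4 by rewrite addr_ge0// exprn_ge0.
apply: (@le_trans _ _ (expR (tilt r * (r + d)) *
    expR (((r ^+ 2 + r ^+ 4) ^+ 2 - (r ^+ 2 + r ^+ 4)) / 2))).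
  by rewrite ler_wpM2l ?expR_ge0// -addrA invsqrt1D_le_expR.
rewrite -expRD ler_expR.
have tiltE : tilt r * (r + d) = (r ^+ 2 + r * d) / (1 - r ^+ 2).
  by rewrite /tilt; field; rewrite gt_eqF// subr_gt0; have := q_half; lra.
rewrite tiltE (_ : r ^+ 4 = (r ^+ 2) ^+ 2); last by rewrite -exprM.
have aux (q x t : R) : 0 <= t -> 0 <= q -> q <= (4 - eps) * t -> q <= 1 / 2 -> 400 * t <= eps ->
    x <= eps / 16 * t ->
    (q + x) / (1 - q) + ((q + q ^+ 2) ^+ 2 - (q + q ^+ 2)) / 2 <= (2 - eps / 4) * t.
  move=> t0 qq qt q2 te xt; have /andP[e0 e1] := eps01.
  have et : 0 <= eps * t by rewrite mulr_ge0// ltW.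
  have q4 : q <= 4 * t by lra.
  have q16 : q ^+ 2 <= (4 * t) ^+ 2 by apply: lerXn2r; rewrite ?nnegrE ?mulr_ge0.
  have tt := ler_wpM2r t0 te.
  have dv : (q + x) / (1 - q) <= q + 2 * q ^+ 2 + 2 * (eps / 16 * t).
    rewrite ler_pdivrMr; last lra.
    have : 0 <= (1 - 2 * q) * (eps / 16 * t) by apply: mulr_ge0; lra.
    have : 0 <= q ^+ 2 * (1 - 2 * q) by apply: mulr_ge0; [exact: sqr_ge0|lra].
    by move=> h1 h2; lra.
  have sq : (q + q ^+ 2) ^+ 2 <= 9 / 4 * q ^+ 2.
    rewrite (_ : 9 / 4 * q ^+ 2 = (3 / 2 * q) ^+ 2); last by field.
    apply: lerXn2r; rewrite ?nnegrE ?addr_ge0 ?mulr_ge0 ?sqr_ge0//.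
    by have := ler_wpM2l qq q2; lra.
  have := sqr_ge0 q; lra.
exact: aux (ltW rate_gt0) q0 rT q_half epsT rd_le.
Qed.

(** [theta k] is the exponent due to the pairs among [k] fixed points, and
    [residue] bounds what the other cycles of edges add to the exponent, once and
    then for each 2-cycle of vertices. *)
Definition theta (k : nat) : R := k%:R * (k%:R - 1) / 2 *
  ((if (n <= 4 * k)%N then 2 - eps / 4 else 4) * T).
Definition residue : R := 160 * (T * L ^+ 2).

Lemma sqbound_le k j : sqbound n r d k j <= expR (theta k + residue * (1 + j%:R)).
Proof.
have r01 : 0 <= r < 1 by rewrite r0 regime_r1.
have cyc0 l : (0 < l)%N -> 0 <= cyc r l by move=> l0; exact: le_trans (cyc_ge1 r01 l0).
have step1 : (if (n <= 4 * k)%N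
   then expR (tilt r * (r + d)) * (Num.sqrt (1 + r ^+ 2 + r ^+ 4))^-1
   else cyc r 1) ^+ 'C(k, 2) <= expR (theta k).
  rewrite /theta -binE expRM_natl; case: ifP => _; apply: lerXn2r; rewrite ?nnegrE ?expR_ge0//.
  - exact: tamed_le.
  - exact: cyc0.
  - exact: cyc1_le.
have step2 : cyc r 1 ^+ j <= expR (j%:R * (4 * T)).
  by rewrite expRM_natl; apply: lerXn2r; rewrite ?nnegrE ?expR_ge0 ?cyc1_le ?cyc0.
have step3 : cyc r 2 ^+ (2 * j * n + n) <= expR ((2 * j * n + n)%:R * (32 * T ^+ 2)).
  by rewrite expRM_natl; apply: lerXn2r; rewrite ?nnegrE ?expR_ge0 ?cyc2_le ?cyc0.
have step4 : cyc r 3 ^+ (n * n) <= expR ((n * n)%:R * (128 * T ^+ 3)).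
  by rewrite expRM_natl; apply: lerXn2r; rewrite ?nnegrE ?expR_ge0 ?cyc3_le ?cyc0.
rewrite expRD; apply: ler_pM.
- by case: ifP => _; rewrite exprn_ge0 ?cyc0// mulr_ge0 ?expR_ge0// invr_ge0 sqrtr_ge0.
- by rewrite !mulr_ge0// exprn_ge0// cyc0.
- exact: step1.
apply: (@le_trans _ _ (expR (j%:R * (4 * T)) * (expR ((2 * j * n + n)%:R * (32 * T ^+ 2)) *
    expR ((n * n)%:R * (128 * T ^+ 3))))).
  apply: ler_pM => //; first by rewrite exprn_ge0// cyc0.
    by rewrite mulr_ge0// exprn_ge0// cyc0.
  by apply: ler_pM => //; rewrite exprn_ge0// cyc0.
rewrite -!expRD ler_expR /residue natrD !natrM.
have aux (a l m : R) : 0 < a -> 9 <= l -> 0 <= m ->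
    m * (4 * (l / a)) + ((2 * m * a + a) * (32 * (l / a) ^+ 2) + a * a * (128 * (l / a) ^+ 3)) <=
    160 * (l / a * l ^+ 2) * (1 + m).
  move=> a0 l9 m0; set t := l / a.
  have -> : (2 * m * a + a) * (32 * t ^+ 2) = (64 * m + 32) * (t * l).
    by rewrite /t; field; rewrite gt_eqF.
  have -> : a * a * (128 * t ^+ 3) = 128 * (t * l ^+ 2).
    by rewrite /t; field; rewrite gt_eqF.
  have t0 : 0 <= t by rewrite divr_ge0 ?(ltW a0)//; lra.
  have tl : t * l <= t * l ^+ 2 by rewrite ler_wpM2l// expr2 ler_peMr//; lra.
  have t1 : t <= t * l ^+ 2.
    by rewrite ler_peMr// exprn_ege1//; lra.
  have := ler_wpM2l m0 tl; have := ler_wpM2l m0 t1.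
  have : 0 <= t * l ^+ 2 by rewrite mulr_ge0 ?sqr_ge0.
  move=> h0; have := mulr_ge0 m0 h0; lra.
exact: aux n_gt0 L9 (ler0n _ _).
Qed.

End Regime.

Section Sums.
Context (R : realType) (n : nat) (eps : R).
Local Notation L := (ln (n%:R : R)).
Local Notation T := (L / n%:R).
Hypothesis eps01 : 0 < eps <= 1.
Hypothesis L9 : 9 <= L.
Local Notation theta := (theta n eps).

Let T0 : 0 < T. Proof. exact: rate_gt0. Qed.
Let n0 : 0 < n%:R :> R. Proof. exact: lt_le_trans (ge10_of_ln L9). Qed.

Let kk0 (k : nat) : 0 <= k%:R * (k%:R - 1) / 2 :> R.
Proof.
case: k => [|k]; first by rewrite !mul0r.
by rewrite divr_ge0// mulr_ge0// -natr1 addrK.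
Qed.

Lemma theta_ge0 k : 0 <= theta k.
Proof.
have /andP[e0 e1] := eps01.
by rewrite /theta mulr_ge0// mulr_ge0 ?(ltW T0)//; case: ifP => _; lra.
Qed.

Lemma theta_le_rate k : theta k <= 2 * k%:R ^+ 2 * T.
Proof.
have /andP[e0 e1] := eps01.
have c4 : (if (n <= 4 * k)%N then 2 - eps / 4 else 4) <= 4 by case: ifP => _; lra.
apply: (@le_trans _ _ (k%:R * (k%:R - 1) / 2 * (4 * T))).
  by rewrite /theta ler_wpM2l// ler_wpM2r// ltW.
rewrite [leLHS]mulrA; apply: ler_wpM2r; first exact: ltW T0.
have aux (a : R) : 0 <= a -> a * (a - 1) / 2 * 4 <= 2 * a ^+ 2 by move=> a0; lra.
exact: aux.
Qed.

(** Both bounds rest on the chord of the logarithm: up to [n] for the tamed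
    pairs, and only up to [n / 4] for the others, which is worth the factor 2
    by which their exponent is larger. *)
Lemma theta_le_ln k : (0 < k <= n)%N -> theta k <= (1 - eps / 8) * (k%:R * ln k%:R).
Proof.
move=> /andP[k0 kn]; have /andP[e0 e1] := eps01.
have k1 : 1 <= k%:R :> R by rewrite ler1n.
have knR : k%:R <= n%:R :> R by rewrite ler_nat.
have lnk : 0 <= ln k%:R :> R by exact: ln_ge0.
have kl0 : 0 <= k%:R * ln k%:R :> R by rewrite mulr_ge0.
rewrite /theta; case: leqP => nk.
- have := ln_chord k1 knR.
  have aux (a l b m : R) : 0 < a -> 1 <= b -> 0 <= m -> (b - 1) * l <= (a - 1) * m ->
      b * (b - 1) / 2 * ((2 - eps / 4) * (l / a)) <= (1 - eps / 8) * (b * m).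
    move=> a0 b1 m0 h.
    have -> : b * (b - 1) / 2 * ((2 - eps / 4) * (l / a)) =
       (1 - eps / 8) * (b * ((b - 1) * l / a)) by field; rewrite gt_eqF.
    apply: ler_wpM2l; first by lra.
    apply: ler_wpM2l; first by lra.
    by rewrite ler_pdivrMr//; lra.
  exact: aux n0 k1 lnk.
- have kn4 : k%:R <= n%:R / 4 :> R.
    by rewrite ler_pdivlMr// -natrM ler_nat mulnC ltnW.
  have := ln_chord k1 kn4; rewrite ln_div ?posrE//.
  have ln4 : ln (4 : R) <= 3.
    by have := @le_ln1Dx R 3; rewrite (_ : 1 + 3 = 4); [apply; lra|ring].
  have aux (a l l4 b m : R) : 0 < a -> 1 <= b -> 0 <= m -> 9 <= l -> l4 <= 3 ->
      (b - 1) * (l - l4) <= (a / 4 - 1) * m ->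
      b * (b - 1) / 2 * (4 * (l / a)) <= (1 - eps / 8) * (b * m).
    move=> a0 b1 m0 l9 l43 h.
    have -> : b * (b - 1) / 2 * (4 * (l / a)) = b * (2 * ((b - 1) * l / a)).
      by field; rewrite gt_eqF.
    rewrite [leRHS]mulrCA; apply: ler_wpM2l; first by lra.
    have h2 : (b - 1) * l * (2 / 3) <= (b - 1) * (l - l4).
      by rewrite -mulrA; apply: ler_wpM2l; lra.
    have h3 : (b - 1) * l / a <= 3 / 8 * m.
      by rewrite ler_pdivrMr//; lra.
    have : eps / 8 * m <= 1 / 8 * m by apply: ler_wpM2r => //; lra.
    lra.
  exact: aux n0 k1 lnk L9 ln4.
Qed.

(** The [k]-th term of the series is at most [exp (k - (eps / 8) * k * ln k)],
    since [k ^ k / k!] is at most [exp k]. *)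
Lemma theta_tail K k : 2 <= eps / 8 * ln K%:R -> (0 < K <= k)%N -> (k <= n)%N ->
  (expR (theta k) - 1) / k`!%:R <= (1 / 2) ^+ k.
Proof.
move=> eK /andP[K0 Kk] kn; have k0 : (0 < k)%N by exact: leq_trans Kk.
have /andP[e0 e1] := eps01.
have kR : 0 < k%:R :> R by rewrite ltr0n.
have f0 : 0 < k`!%:R :> R by rewrite ltr0n fact_gt0.
apply: (@le_trans _ _ (expR (theta k) / k`!%:R)).
  by rewrite ler_wpM2r ?invr_ge0 ?(ltW f0)//; lra.
apply: (@le_trans _ _ (expR (- (eps / 8 * (k%:R * ln k%:R))) * (k%:R ^+ k / k`!%:R))).
  rewrite [leRHS]mulrA; apply: ler_wpM2r; first by rewrite invr_ge0 ltW.
  rewrite -[X in _ <= _ * X ^+ k](lnK (x := k%:R)) ?posrE// -expRM_natl -expRD ler_expR.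
  by have := theta_le_ln (k := k); rewrite k0 kn => /(_ isT); lra.
apply: (@le_trans _ _ (expR (- (2 * k%:R)) * expR k%:R)).
  apply: ler_pM; rewrite ?expR_ge0 ?divr_ge0 ?exprn_ge0 ?natX_le_fact//.
  rewrite ler_expR lerN2.
  have lnKk : ln K%:R <= ln k%:R :> R by rewrite ler_ln ?posrE ?ltr0n// ler_nat.
  have : eps / 8 * ln K%:R <= eps / 8 * ln k%:R by rewrite ler_wpM2l//; lra.
  move=> h; have h2 : 2 <= eps / 8 * ln k%:R by lra.
  by have := ler_wpM2l (ltW kR) h2; lra.
rewrite -expRD (_ : - (2 * k%:R) + k%:R = - k%:R :> R); last by ring.
have -> : expR (- k%:R) = (expR 1)^-1 ^+ k :> R.
  by rewrite exprVn -expRM_natl mulr1 expRN.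
apply: lerXn2r;
  rewrite ?nnegrE ?invr_ge0 ?expR_ge0 ?divr_ge0//.
rewrite div1r lef_pV2 ?posrE ?expR_gt0//.
by have := @expR_ge1Dx R 1; lra.
Qed.

(** Dominated convergence by hand: each term tends to 0 with [T], uniformly on
    the head, and [theta_tail] bounds the rest. *)
Lemma theta_sum K : 2 <= eps / 8 * ln K%:R -> (0 < K)%N ->
  \sum_(k < n.+1) (expR (theta k) - 1) / k`!%:R <=
  K%:R * (2 * K%:R ^+ 2 * T * expR (2 * K%:R ^+ 2 * T)) + 2 * (1 / 2) ^+ K.
Proof.
move=> eK K0; set y := 2 * K%:R ^+ 2 * T.
have y0 : 0 <= y by rewrite mulr_ge0 ?(ltW T0)// mulr_ge0// exprn_ge0.
have small k : (k < K)%N -> (expR (theta k) - 1) / k`!%:R <= y * expR y.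
  move=> kK; apply: (@le_trans _ _ (expR (theta k) - 1)).
    rewrite ler_piMr//; first by rewrite subr_ge0 -expR0 ler_expR theta_ge0.
    by rewrite invf_le1 ?ltr0n ?fact_gt0// ler1n fact_gt0.
  apply: le_trans (expRB1_le y); rewrite lerD2r ler_expR.
  apply: le_trans (theta_le_rate k) _; rewrite ler_wpM2r ?(ltW T0)// ler_wpM2l//.
  by apply: lerXn2r; rewrite ?nnegrE// ler_nat ltnW.
rewrite -(big_mkord xpredT (fun k => (expR (theta k) - 1) / k`!%:R)).
have sum_small m : (m <= K)%N ->
    \sum_(0 <= k < m) (expR (theta k) - 1) / k`!%:R <= K%:R * (y * expR y).
  move=> mK; apply: (@le_trans _ _ (\sum_(0 <= k < m) y * expR y)).
    by rewrite !big_nat; apply: ler_sum => k /andP[_ km]; apply: small; exact: leq_trans mK.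
  rewrite sumr_const_nat subn0 -[leLHS]mulr_natl ler_wpM2r ?ler_nat//.
  by rewrite mulr_ge0// expR_ge0.
have tail0 : 0 <= 2 * (1 / 2) ^+ K :> R by rewrite mulr_ge0// exprn_ge0// divr_ge0.
have [nK|Kn] := leqP n.+1 K; first by have := sum_small _ nK; lra.
rewrite (big_cat_nat (n := K)) ?(ltnW Kn)//=; apply: lerD; first exact: sum_small.
apply: le_trans (geometric_tail R K n.+1); rewrite !big_nat; apply: ler_sum => k /andP[Kk kn].
by apply: (@theta_tail K) => //; rewrite K0.
Qed.

End Sums.

Section MeanSquare.
Context (R : realType) (n : nat) (eps r : R).
Local Notation L := (ln (n%:R : R)).
Local Notation T := (L / n%:R).
Hypothesis eps01 : 0 < eps <= 1.
Hypothesis r0 : 0 <= r.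
Hypothesis rT : r ^+ 2 <= (4 - eps) * T.
Hypothesis L9 : 9 <= L.
Hypothesis epsT : 400 * T <= eps.
Hypothesis epsL : 512 * 1024 <= eps ^+ 2 * L.
Local Notation h := (residue R n).
Hypothesis h1 : h <= 1.

Let h0 : 0 <= h.
Proof.
apply: mulr_ge0 => //; apply: mulr_ge0 (sqr_ge0 _).
exact: ltW (rate_gt0 L9).
Qed.

Let e1 : R := expR 1.
Let e10 : 0 <= e1. Proof. exact: expR_ge0. Qed.

(** [e^(t + y) - 1 = (e^t - 1) * e^y + (e^y - 1)] separates the fixed points from
    the 2-cycles. *)
Let split_term (k j : nat) :
  (expR (theta n eps k + h * (1 + j%:R)) - 1) / (k`!%:R * j`!%:R) <=
  (expR (theta n eps k) - 1) / k`!%:R * (e1 * (e1 ^+ j / j`!%:R)) +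
  1 ^+ k / k`!%:R * (h * e1 ^+ 2 * ((e1 ^+ 2) ^+ j / j`!%:R)).
Proof.
have kf : 0 < k`!%:R :> R by rewrite ltr0n fact_gt0.
have jf : 0 < j`!%:R :> R by rewrite ltr0n fact_gt0.
set t := theta n eps k; set y := h * (1 + j%:R).
have t0 : 0 <= expR t - 1 by rewrite subr_ge0 -expR0 ler_expR theta_ge0.
have j1 : 0 <= 1 + j%:R :> R by rewrite addr_ge0.
have e1j : expR (1 + j%:R) = e1 * e1 ^+ j :> R by rewrite expRD -[j%:R]mulr1 expRM_natl.
have ey : expR y <= e1 * e1 ^+ j by rewrite -e1j ler_expR; exact: ler_piMl.
have ey1 : expR y - 1 <= h * e1 ^+ 2 * (e1 ^+ 2) ^+ j.
  apply: le_trans (expRB1_le y) _.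
  have -> : h * e1 ^+ 2 * (e1 ^+ 2) ^+ j = h * (e1 * e1 ^+ j) * (e1 * e1 ^+ j).
    by rewrite -exprM mulnC exprM; ring.
  apply: ler_pM; rewrite ?expR_ge0//; first exact: mulr_ge0.
  rewrite /y ler_wpM2l// -e1j; apply: le_trans (expR_ge1Dx _); lra.
rewrite (_ : expR (t + y) - 1 = (expR t - 1) * expR y + (expR y - 1)); last first.
  by rewrite expRD; ring.
rewrite expr1n mulrDl; apply: lerD.
- rewrite (_ : _ / k`!%:R * _ = (expR t - 1) * (e1 * e1 ^+ j) / (k`!%:R * j`!%:R)); last first.
    by field; rewrite !gt_eqF.
  by rewrite ler_wpM2r ?invr_ge0 ?mulr_ge0 ?(ltW kf) ?(ltW jf)// ler_wpM2l.
- rewrite (_ : 1 / k`!%:R * _ = h * e1 ^+ 2 * (e1 ^+ 2) ^+ j / (k`!%:R * j`!%:R)); last first.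
    by field; rewrite !gt_eqF.
  by rewrite ler_wpM2r ?invr_ge0 ?mulr_ge0 ?(ltW kf) ?(ltW jf).
Qed.

Lemma mean_sqbound_le : mean_sqbound n r (slack n eps) - 1 <=
  (expR 1 * expR (expR 1)) * (\sum_(k < n.+1) (expR (theta n eps k) - 1) / k`!%:R) +
  (expR 1 * (expR 1 ^+ 2 * expR (expR 1 ^+ 2))) * h.
Proof.
have nf0 : 0 < n`!%:R :> R by rewrite ltr0n fact_gt0.
pose F (k j : nat) := expR (theta n eps k + h * (1 + j%:R)) - 1.
have F0 k j : 0 <= F k j.
  rewrite subr_ge0 -expR0 ler_expR addr_ge0 ?theta_ge0// mulr_ge0// addr_ge0//.
apply: (@le_trans _ _ (n`!%:R^-1 * \sum_(s : 'S_n) F #|fixpts s| #|swaps s|)).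
  rewrite /mean_sqbound /F sumrB sumr_const card_Sn mulrBr mulVf ?gt_eqF// lerD2r.
  rewrite ler_wpM2l ?invr_ge0 ?(ltW nf0)//; apply: ler_sum => s _.
  exact: sqbound_le.
apply: le_trans (mean_perm_le _ F0) _.
pose A k := (expR (theta n eps k) - 1) / k`!%:R.
pose B j : R := e1 * (e1 ^+ j / j`!%:R).
pose C k : R := 1 ^+ k / k`!%:R.
pose D j : R := h * e1 ^+ 2 * ((e1 ^+ 2) ^+ j / j`!%:R).
apply: (@le_trans _ _ (\sum_(k < n.+1) \sum_(j < n.+1) (A k * B j + C k * D j))).
  by apply: ler_sum => k _; apply: ler_sum => j _; exact: split_term.
have -> : \sum_(k < n.+1) \sum_(j < n.+1) (A k * B j + C k * D j) =
   (\sum_(k < n.+1) A k) * (\sum_(j < n.+1) B j) +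
   (\sum_(k < n.+1) C k) * (\sum_(j < n.+1) D j).
  rewrite !mulr_suml -big_split /=; apply: eq_bigr => k _.
  by rewrite !mulr_sumr -big_split.
have A0 : 0 <= \sum_(k < n.+1) A k.
  by apply: sumr_ge0 => k _; rewrite divr_ge0// subr_ge0 -expR0 ler_expR theta_ge0.
have C0 : 0 <= \sum_(k < n.+1) C k by apply: sumr_ge0 => k _; rewrite divr_ge0// exprn_ge0.
have D0 : 0 <= \sum_(k < n.+1) D k.
  apply: sumr_ge0 => k _; apply: mulr_ge0; first by rewrite mulr_ge0// sqr_ge0.
  by rewrite divr_ge0// exprn_ge0// sqr_ge0.
apply: lerD.
- rewrite [leRHS]mulrC ler_wpM2l// /B -mulr_sumr ler_wpM2l//.
  exact: exp_sum_le.
- rewrite (_ : _ * h = expR 1 * (h * e1 ^+ 2 * expR (e1 ^+ 2))); last by rewrite /e1; ring.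
  apply: ler_pM => //; first exact: (exp_sum_le n.+1 ler01).
  rewrite /D -mulr_sumr; apply: ler_wpM2l; first by rewrite mulr_ge0// sqr_ge0.
  by apply: exp_sum_le; exact: exprn_ge0.
Qed.

End MeanSquare.

(** * The two-graph problem below the threshold *)

Section CoreSmall.
Context (R : realType).
Local Notation Ln n := (ln (n%:R : R)).

Lemma ln_near (x : R) : \forall n \near \oo, x <= ln (n%:R : R).
Proof.
near=> n.
have xn : expR x <= n%:R by near: n; exact: nbhs_infty_ger.
by rewrite -[leLHS]expRK ler_ln ?posrE ?expR_gt0// (lt_le_trans (expR_gt0 x)).
Unshelve. all: end_near. Qed.

(** From [l ^+ 4 / 24 <= expR l] at [l = ln n]. *)
Lemma rate_le (n : nat) : 1 <= ln (n%:R : R) ->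
  ln (n%:R : R) / n%:R <= 24 / ln n%:R /\ residue R n <= 160 * 24 / ln n%:R.
Proof.
move=> L1.
have n0 : 0 < n%:R :> R.
  by rewrite ltr0n lt0n; apply/eqP => n0; move: L1; rewrite n0 ln0// ler10.
have e4 : ln (n%:R : R) ^+ 4 / 24 <= n%:R.
  have := @expR_ge1Dxn R (ln n%:R) 3 (le_trans ler01 L1); rewrite lnK ?posrE//.
  by apply: le_trans; rewrite lerDr.
have aux (l a : R) : 1 <= l -> 0 < a -> l ^+ 4 / 24 <= a ->
    l / a <= 24 / l /\ 160 * (l / a * l ^+ 2) <= 160 * 24 / l.
  move=> l1 a0 la; have l0 : 0 < l by lra.
  have t : l / a * l ^+ 2 <= 24 / l.
    rewrite ler_pdivlMr//.
    have -> : l / a * l ^+ 2 * l = l ^+ 4 / a by field; rewrite gt_eqF.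
    by rewrite ler_pdivrMr//; lra.
  split; last by rewrite -[leRHS]mulrA ler_wpM2l.
  apply: le_trans t; rewrite ler_peMr ?divr_ge0 ?(ltW l0) ?(ltW a0)//.
  by rewrite exprn_ege1.
exact: aux L1 n0 e4.
Qed.

Lemma mulr_expR_le (c y zeta : R) : 0 <= c -> 0 <= y -> y <= 1 ->
  y * (c * expR 1) <= zeta -> c * (y * expR y) <= zeta.
Proof.
move=> c0 y0 y1; apply: le_trans; rewrite mulrCA ler_wpM2l// ler_wpM2l//.
by rewrite ler_expR.
Qed.

Lemma core_small_eps01 (eps eta : R) : 0 < eps <= 1 -> 0 < eta ->
  \forall n \near \oo, forall r, 0 <= r ->
    r ^+ 2 <= (4 - eps) * (ln n%:R / n%:R) -> (core n r <= eta%:E)%E.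
Proof.
move=> eps01 eta0; have /andP[e0 e1] := eps01.
(* Solution of [zeta + 3 * zeta / (2 * eta) = eta / 2]. *)
pose zeta : R := eta ^+ 2 / (2 * eta + 3).
have den0 : 0 < 2 * eta + 3 by lra.
have zeta0 : 0 < zeta by rewrite divr_gt0// exprn_gt0.
pose K1 : R := expR 1 * expR (expR 1).
pose K2 : R := expR 1 * (expR 1 ^+ 2 * expR (expR 1 ^+ 2)).
have K10 : 0 < K1 by rewrite mulr_gt0 ?expR_gt0.
have K20 : 0 < K2 by rewrite !mulr_gt0 ?exprn_gt0 ?expR_gt0.
(* The length of the head of the series, from which its tail is small. *)
have [K [K0 eK tailK]] : exists K : nat, [/\ (0 < K)%N, 2 <= eps / 8 * ln K%:R &
    K1 * (2 * (1 / 2) ^+ K) <= zeta / 4 :> R].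
  near \oo => K; exists K; split.
  - by near: K; exact: nbhs_infty_gt.
  - rewrite mulrC -ler_pdivrMr; last lra.
    by near: K; exact: ln_near.
  - have KR : K1 * 2 / (zeta / 4) <= K%:R by near: K; exact: nbhs_infty_ger.
    have z4 : 0 < zeta / 4 by lra.
    rewrite ler_pdivrMr// in KR.
    have pK : K%:R <= 2 ^+ K :> R by rewrite -natrX ler_nat ltnW// ltn_expl.
    rewrite mulrA div1r exprVn ler_pdivrMr ?exprn_gt0//.
    by apply: (le_trans KR); rewrite mulrC ler_wpM2l// ltW.
pose c : R := 2 * K%:R ^+ 2.
have KR0 : 0 < K%:R :> R by rewrite ltr0n.
have c0 : 0 < c by rewrite mulr_gt0// exprn_gt0.
near=> n.
have L9 : 9 <= Ln n by near: n; exact: ln_near.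
have L0 : 0 < Ln n by lra.
have n0 : 0 < n%:R :> R by exact: lt_le_trans (ge10_of_ln L9).
have [TL hL] : Ln n / n%:R <= 24 / Ln n /\ residue R n <= 160 * 24 / Ln n by apply: rate_le; lra.
have bound (a b : R) : 0 < b -> a / b <= Ln n -> a / Ln n <= b.
  by move=> b0; rewrite !ler_pdivrMr// mulrC.
have T0 : 0 < Ln n / n%:R by rewrite divr_gt0.
have epsT : 400 * (Ln n / n%:R) <= eps.
  have : 24 / Ln n <= eps / 400 by apply: bound; [lra|near: n; exact: ln_near].
  by lra.
have epsL : 512 * 1024 <= eps ^+ 2 * Ln n.
  rewrite [leRHS]mulrC -ler_pdivrMr ?exprn_gt0//; near: n; exact: ln_near.
have h1 : residue R n <= 1.
  by apply: (le_trans hL); apply: bound => //; near: n; exact: ln_near.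
have hz : K2 * residue R n <= zeta / 4.
  rewrite mulrC -ler_pdivlMr//; apply: (le_trans hL); apply: bound; last by near: n; exact: ln_near.
  by rewrite divr_gt0//; lra.
have y1 : c * (Ln n / n%:R) <= 1.
  rewrite mulrC -ler_pdivlMr//; apply: (le_trans TL); apply: bound; last by near: n; exact: ln_near.
  by rewrite divr_gt0.
have yz : c * (Ln n / n%:R) * (K1 * K%:R * expR 1) <= zeta / 4.
  rewrite mulrAC mulrC -ler_pdivlMr; last by rewrite !mulr_gt0 ?expR_gt0.
  apply: (le_trans TL); apply: bound; last by near: n; exact: ln_near.
  apply: divr_gt0; first by lra.
  by rewrite mulr_gt0// !mulr_gt0 ?expR_gt0.
have zL : zeta^-1 <= Ln n by near: n; exact: ln_near.
move=> r r0 rT.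
have pz : untamed n r (slack n eps) (slack n eps) <= zeta.
  apply: (le_trans (untamed_le eps01 r0 rT L9 epsT epsL)).
  rewrite expRN -[leRHS]invrK lef_pV2 ?posrE ?expR_gt0 ?invr_gt0//.
  have := @expR_ge1Dx R n%:R; apply: le_trans; apply: (le_trans zL).
  have := @expR_ge1Dx R (Ln n); rewrite lnK ?posrE// => Lnn.
  have aux (a b : R) : 1 + a <= b -> a <= 1 + b by move=> ?; lra.
  exact: aux Lnn.
have Bz : mean_sqbound n r (slack n eps) - 1 <= zeta.
  apply: (le_trans (mean_sqbound_le eps01 r0 rT L9 epsT h1)).
  have S := theta_sum eps01 L9 eK K0.
  have S1 := ler_wpM2l (ltW K10) S.
  have S2 : K1 * (K%:R * (c * (Ln n / n%:R) * expR (c * (Ln n / n%:R)))) <= zeta / 4.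
    rewrite [leLHS]mulrA; apply: mulr_expR_le => //; rewrite mulr_ge0// ltW//.
  rewrite mulrDr in S1.
  have : K1 * (\sum_(k < n.+1) (expR (theta n eps k) - 1) / k`!%:R) <= zeta / 4 + zeta / 4.
    by apply: (le_trans S1); exact: lerD.
  by move=> S3; apply: (le_trans (lerD S3 hz)); lra.
have r01 : 0 <= r < 1 by rewrite r0 (regime_r1 eps01 r0 rT L9 epsT).
have d0 := slack_ge0 n eps01.
apply: le_trans (core_bound n r01 d0 eta0 d0 (regime_y1 eps01 r0 rT L9 epsT)) _.
rewrite lee_fin.
have : (mean_sqbound n r (slack n eps) - 1 + 2 * untamed n r (slack n eps) (slack n eps)) /
    (2 * eta) <= 3 * zeta / (2 * eta).
  by rewrite ler_wpM2r ?invr_ge0 ?mulr_ge0 ?(ltW eta0)//; lra.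
have : zeta + 3 * zeta / (2 * eta) = eta / 2.
  by rewrite /zeta; field; rewrite !gt_eqF.
lra.
Unshelve. all: end_near. Qed.

Lemma core_small (eps eta : R) : 0 < eps -> 0 < eta ->
  \forall n \near \oo, forall r, 0 <= r ->
    r ^+ 2 <= (4 - eps) * (ln n%:R / n%:R) -> (core n r <= eta%:E)%E.
Proof.
move=> eps0 eta0.
have e01 : 0 < Num.min eps 1 <= 1 by rewrite lt_min eps0 ltr01 ge_min lexx orbT.
near=> n => r r0 rT.
have : forall r, 0 <= r -> r ^+ 2 <= (4 - Num.min eps 1) * (ln n%:R / n%:R) ->
    (core n r <= eta%:E)%E by near: n; exact: core_small_eps01.
apply=> //; apply: (le_trans rT); rewrite ler_wpM2r ?divr_ge0//.
  by rewrite (le_trans ler01)//; near: n; exact: ln_near.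
by rewrite lerD2l lerN2 ge_min lexx.
Unshelve. all: end_near. Qed.

End CoreSmall.

(** * Impossibility of weak detection *)

(** [pcorr rho K ^+ 2 <= K * rho ^+ 2] and [K <= m - 1] bring each of the problems
    with two graphs below its own threshold [4 * ln n / n]. *)
Lemma events_close (R : realType) (m : nat) (hm : (2 <= m)%N)
  (eps : R) (heps : 0 < eps)
  (rho : nat -> R) (hrho01 : forall n, 0 <= rho n <= 1)
  (hrho : \forall n \near \oo,
     rho n ^+ 2 <= (4 - eps) / (m%:R - 1) * (ln n%:R / n%:R))
  (P Q : forall n, probability (observation R m n) R)
  (hP : forall n, H1_law (rho n) (P n))
  (hQ : forall n, H0_law (P n) (Q n)) (eta : R) : 0 < eta ->
  \forall n \near \oo, forall A, measurable A -> (`|P n A - Q n A| <= eta%:E)%E.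
Proof.
move=> eta0; have m0 : (0 < m)%N by exact: ltnW.
have m1 : 1 <= m%:R - 1 :> R by rewrite lerBrDr (_ : 1 + 1 = 2%:R) ?ler_nat.
have mR : 0 < m%:R :> R by rewrite ltr0n.
have eta_m : 0 < eta / m%:R by rewrite divr_gt0.
near=> n => A mA.
have small : forall r, 0 <= r -> r ^+ 2 <= (4 - eps) * (ln n%:R / n%:R) ->
    (core n r <= (eta / m%:R)%:E)%E by near: n; exact: core_small.
have L100 : 100 <= ln (n%:R : R) by near: n; exact: ln_near.
have rhoT : rho n ^+ 2 <= (4 - eps) / (m%:R - 1) * (ln n%:R / n%:R) by near: n.
have /andP[rho0 _] := hrho01 n.
have n0 : 0 < n%:R :> R.
  by rewrite ltr0n lt0n; apply/eqP => n0; move: L100; rewrite n0 ln0//; lra.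
have L0 : 0 < ln (n%:R : R) by lra.
have T0 : 0 < ln (n%:R : R) / n%:R by rewrite divr_gt0.
have rho1 : rho n < 1.
  have [TL _] : ln (n%:R : R) / n%:R <= 24 / ln n%:R /\ residue R n <= 160 * 24 / ln n%:R.
    by apply: rate_le; lra.
  have T100 : ln (n%:R : R) / n%:R <= 24 / 100.
    by apply: (le_trans TL); rewrite ler_wpM2l// lef_pV2 ?posrE.
  rewrite -(@expr_lt1 _ 2%N)//; apply: (le_lt_trans rhoT).
  have c4 : (4 - eps) / (m%:R - 1) <= 4.
    by rewrite ler_pdivrMr; lra.
  apply: (@le_lt_trans _ _ (4 * (ln n%:R / n%:R))); first by rewrite ler_wpM2r// ltW.
  by lra.
apply: (@le_trans _ _ (m.-1%:R * (eta / m%:R))%:E).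
  apply: (reduction rho0 rho1 m0 (hP n) (hQ n) mA) => K K0.
  apply: small; first exact: pcorr_ge0.
  apply: (le_trans (sqr_pcorr_le rho0 rho1 K)).
  apply: (@le_trans _ _ ((m%:R - 1) * rho n ^+ 2)).
    rewrite ler_wpM2r ?sqr_ge0// lerBrDr natr1 ler_nat; exact: ltn_ord.
  rewrite -ler_pdivlMl; last by lra.
  by rewrite mulrA [_^-1 * _]mulrC.
rewrite lee_fin mulrCA ler_piMr ?(ltW eta0)// ler_pdivrMr// mul1r ler_nat leq_pred//.
Unshelve. all: end_near. Qed.

Lemma tv_distance_le (R : realType) (m n : nat)
    (P Q : probability (observation R m n) R) (eta : R) :
  (forall A, measurable A -> (`|P A - Q A| <= eta%:E)%E) ->
  (0 <= tv_distance P Q <= eta%:E)%E.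
Proof.
move=> PQ; apply/andP; split; last by apply: ge_ereal_sup => _ [A mA <-]; exact: PQ.
apply: ereal_sup_ge; exists (`|P set0 - Q set0|)%E; first by exists set0.
exact: abse_ge0.
Qed.

Theorem corollary4p1 (R : realType) (m : nat) (hm : (2 <= m)%N)
  (eps : R) (heps : 0 < eps)
  (rho : nat -> R) (hrho01 : forall n, 0 <= rho n <= 1)
  (hrho : \forall n \near \oo,
     rho n ^+ 2 <= (4 - eps) / (m%:R - 1) * (ln n%:R / n%:R))
  (P Q : forall n, probability (observation R m n) R)
  (hP : forall n, H1_law (rho n) (P n))
  (hQ : forall n, H0_law (P n) (Q n)) :
  weak_detection_impossible P Q.
Proof.
have close := events_close hm heps hrho01 hrho hP hQ.
split.
- move=> T tau mT [c c0 test].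
  have c20 : 0 < c / 2 by rewrite divr_gt0.
  near \oo => n.
  have cl : forall A, measurable A -> (`|P n A - Q n A| <= (c / 2)%:E)%E.
    by near: n; exact: close.
  have te : (P n [set x | (T n x < tau n)%R] + Q n [set x | (tau n <= T n x)%R] <=
    (1 - c)%:E)%E by near: n.
  pose A := [set x | (tau n <= T n x)%R].
  have mA : measurable A.
    rewrite (_ : A = T n @^-1` `[tau n, +oo[%classic).
      by rewrite -[X in measurable X]setTI; apply: (mT n) => //; exact: measurable_itv.
    by apply/seteqP; split => x /=; rewrite in_itv/= andbT.
  have AC : [set x | (T n x < tau n)%R] = ~` A.
    by apply/seteqP; split => x /=; rewrite /A /= ltNge => /negP.
  have := cl A mA; rewrite AC probability_setC// -/A in te *.
  have [p pE] : exists p : R, P n A = p%:E by exists (fine (P n A)); rewrite fineK// fin_num_measure.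
  have [q qE] : exists q : R, Q n A = q%:E by exists (fine (Q n A)); rewrite fineK// fin_num_measure.
  move: te; rewrite pE qE -!EFinD !lee_fin => te; rewrite ler_norml => /andP[_ pq]; lra.
- apply/fine_cvgP; split.
    near=> n.
    have /andP[t0 t1] : (0 <= tv_distance (P n) (Q n) <= 1%:E)%E.
      by apply: tv_distance_le; near: n; exact: close.
    by rewrite ge0_fin_numE// (le_lt_trans t1)// ltry.
  apply/cvgrPdist_le => e e0; near=> n.
  have /andP[t0 t1] : (0 <= tv_distance (P n) (Q n) <= e%:E)%E.
    by apply: tv_distance_le; near: n; exact: close.
  rewrite /= sub0r normrN ger0_norm ?fine_ge0//.
  by rewrite -lee_fin fineK// ge0_fin_numE// (le_lt_trans t1)// ltry.
Unshelve. all: end_near. Qed.
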